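(* Let $\boldsymbol{W}=(\boldsymbol{W}_t)_{t\ge 0}=(X_t,Y_t)_{t\ge0}$ be standard planar Brownian motion started at the origin, let $\mathbb{D}=\{\boldsymbol{x}\in\mathbb{R}^2:\|\boldsymbol{x}\|<1\}$ and $\tau_{\mathbb{D}}=\inf\{t\ge0:\boldsymbol{W}_t\notin\mathbb{D}\}$. Define the maximum horizontal displacement $$M=\sup_{0\le t\le \tau_{\mathbb{D}}} X_t .$$ Then the cumulative distribution function of $M$ is $$\mathbb{P}(M<a)=\frac{2\arcsin a}{\pi-\arccos a},\qquad 0<a<1.$$ Furthermore, $$\mathbb{E}[M]=\int_0^{\pi/2}\left(1-\frac{2t}{\frac{\pi}{2}+t}\right)\cos t\,dt\approx 0.511655 .$$ Consequently, if $\mathsf{P}_{\tau_{\mathbb{D}}}$ denotes the perimeter of the convex hull of the path $\{\boldsymbol{W}_t:0\le t\le\tau_{\mathbb{D}}\}$, then $$\mathbb{E}[\mathsf{P}_{\tau_{\mathbb{D}}}]=2\pi\,\mathbb{E}[M]\approx 3.214826 .$$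
   Context: The convex hull of a set $\mathcal{A}\subset\mathbb{R}^2$ is the intersection of all convex subsets of $\mathbb{R}^2$ containing $\mathcal{A}$. *)

(* Defs.v *)
From HB Require Import structures.
From mathcomp Require Import all_boot all_order all_algebra.
From mathcomp Require Import all_classical all_reals all_analysis.
Set Implicit Arguments. Unset Strict Implicit. Unset Printing Implicit Defensive.
Import Order.TTheory GRing.Theory Num.Theory.
Import numFieldNormedType.Exports.
Local Open Scope classical_set_scope.
Local Open Scope ring_scope.

Section defs.
Context {R : realType}.

(* Standard planar Brownian motion W_t = (X_t, Y_t) started at the origin,
   on the probability space (T, P): W_0 = 0, every path is continuous,
   each coordinate is a random variable, and for every time grid
   s_0 < s_1 < ... < s_n (s_0 >= 0) the 2n increment coordinates
   X_{s_(i+1)} - X_{s_i}, Y_{s_(i+1)} - Y_{s_i} are mutually independent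
   centered Gaussians with variance s_(i+1) - s_i (finite-dimensional
   distributions of planar BM). *)
Definition planar_BM {d} {T : measurableType d} (P : probability T R)
    (X Y : R -> T -> R) : Prop :=
  [/\ (forall w, X 0 w = 0 /\ Y 0 w = 0),
      (forall w, continuous (fun t => X t w) /\ continuous (fun t => Y t w)),
      (forall t, measurable_fun setT (X t) /\ measurable_fun setT (Y t)) &
      (forall (n : nat) (s : nat -> R) (A B : nat -> set R),
         0 <= s 0%N ->
         (forall i, (i < n)%N -> s i < s i.+1) ->
         (forall i, measurable (A i) /\ measurable (B i)) ->
         P (\bigcap_(i in [set i | (i < n)%N])
              [set w | A i (X (s i.+1) w - X (s i) w) /\
                       B i (Y (s i.+1) w - Y (s i) w)]) =
         (\prod_(0 <= i < n)
            (normal_prob 0 (Num.sqrt (s i.+1 - s i)) (A i) *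
             normal_prob 0 (Num.sqrt (s i.+1 - s i)) (B i)))%E)].

(* exit time of the open unit disk: inf {t >= 0 : W_t \notin D}
   (+oo if the path never leaves D) *)
Definition exit_time {T : Type} (X Y : R -> T -> R) (w : T) : \bar R :=
  ereal_inf [set t%:E | t in [set t | 0 <= t /\ 1 <= X t w ^+ 2 + Y t w ^+ 2]].

Definition upto {T : Type} (X Y : R -> T -> R) (w : T) : set R :=
  [set t | 0 <= t /\ (t%:E <= exit_time X Y w)%E].

Definition max_horiz {T : Type} (X Y : R -> T -> R) (w : T) : \bar R :=
  ereal_sup [set (X t w)%:E | t in upto X Y w].

Definition stopped_path {T : Type} (X Y : R -> T -> R) (w : T) : set (R * R) :=
  [set (X t w, Y t w) | t in upto X Y w].

Definition convex_set2 (C : set (R * R)) : Prop :=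
  forall x y (l : R), C x -> C y -> 0 <= l -> l <= 1 ->
    C (l * x.1 + (1 - l) * y.1, l * x.2 + (1 - l) * y.2).

Definition convex_hull2 (A : set (R * R)) : set (R * R) :=
  [set z | forall C, convex_set2 C -> A `<=` C -> C z].

Definition boundary2 (A : set (R * R)) : set (R * R) :=
  closure A `\` interior A.

Definition dist2 (p q : R * R) : R :=
  Num.sqrt ((p.1 - q.1) ^+ 2 + (p.2 - q.2) ^+ 2).

(* Euclidean diameter (0 for the empty set) *)
Definition diam2 (E : set (R * R)) : \bar R :=
  ereal_sup ([set 0%E] `|` [set (dist2 p q)%:E | p in E & q in E]).

Definition hausdorff1_delta (E : set (R * R)) (delta : R) : \bar R :=
  ereal_inf [set (\sum_(0 <= i <oo) diam2 (U i))%E |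
             U in [set U : nat -> set (R * R) |
                   E `<=` \bigcup_i U i /\ forall i, (diam2 (U i) <= delta%:E)%E]].

Definition hausdorff1 (E : set (R * R)) : \bar R :=
  ereal_sup [set hausdorff1_delta E delta | delta in [set delta : R | 0 < delta]].

Definition perimeter2 (K : set (R * R)) : \bar R := hausdorff1 (boundary2 K).

Definition hull_perimeter {T : Type} (X Y : R -> T -> R) (w : T) : \bar R :=
  perimeter2 (convex_hull2 (stopped_path X Y w)).

End defs.

(* Main.v *)
(* Let 0 < a < 1 and let v(z) be the angle under which z sees the chord {x = a}
   of the unit disc. To the left of the chord v is harmonic; it equals arccos a
   on the arc bounding that region (inscribed angles), pi on the chord and
   2 arccos a at the origin. Stopping at the exit from the region gives
   2 arccos a = p pi + (1 - p) arccos a, hence p = P(M >= a) =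
   arccos a / (pi - arccos a). Optional stopping is carried out on the grids of
   mesh 16^-n up to time 2^n: the second-order terms of v cancel because the two
   coordinates of a step have equal variance, the error per step of mesh h is
   O(h^(3/2)), and the angle is extended past the segment by truncating the
   abscissa.

   E[M] is the integral of the tail of M, computed with a = sin t; it equals
   pi (Si pi - Si (pi/2)) - 1, which Taylor polynomials of Si enclose.

   For the perimeter, fix N directions and let p_j be points of the closed hull
   extremal in these directions, h_j the support values. The boundary arc from
   p_j to p_(j+1) projects onto the tangent at the middle direction along a
   segment of length L_j, with a Lipschitz inverse of constant 1 / cos (pi/N),
   and sum_j L_j = 2 sin (pi/N) sum_j h_j. So the perimeter lies between this sum
   and its quotient by cos (pi/N). By rotation invariance every h_j is
   distributed as M; take expectations and let N tend to infinity. The hull has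
   an interior almost surely, because W_t and W_2t are not collinear. *)
Require Import Defs.
From HB Require Import structures.
From mathcomp Require Import all_boot all_order all_algebra.
From mathcomp Require Import all_classical all_reals all_analysis.
From mathcomp Require Import measurable_realfun ring lra zify.
Set Implicit Arguments. Unset Strict Implicit. Unset Printing Implicit Defensive.
Import Order.TTheory GRing.Theory Num.Theory.
Import numFieldNormedType.Exports.
Local Open Scope classical_set_scope.
Local Open Scope ring_scope.

(** * Gaussian moments and independent increments *)

(** [planar_BM] only describes increments along deterministic time grids: no filtration, strong
    Markov property or Ito calculus is given to start from. On a grid, independence of the next
    increment from the past follows from uniqueness of measures, and this is all that stopping at
    grid times needs. A Gaussian step may be arbitrarily long, so the Taylor estimate has to hold
    for every step, even one across the segment. The angle is discontinuous at the ends of the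
    segment, so the segment is kept at a positive distance from the region where the walk lives. The
    boundary values are then only close to the ideal ones, and the two inequalities for the tail
    come from two different segments, each followed by a limit. A direction [(c, s)] with
    [c ^+ 2 + s ^+ 2 = 1] runs through the argument, since the perimeter needs the law of the
    maximum in every direction. It is not shown that the rotated process is again a Brownian motion:
    the rotation is applied to the walk, and trace-free quadratic forms remain trace-free under
    it. *)

Lemma ge0_integralT_comp_oppr {R : realType} (f : R -> R) : continuous f ->
  (forall x, 0 <= f x) ->
  (\int[lebesgue_measure]_x (f (- x))%:E = \int[lebesgue_measure]_x (f x)%:E)%E.
Proof.
have split0 (g : R -> R) : continuous g -> (forall x, 0 <= g x) ->
    (\int[lebesgue_measure]_x (g x)%:E =
     \int[lebesgue_measure]_(x in `[0%R, +oo[) (g (- x))%:E +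
     \int[lebesgue_measure]_(x in `[0%R, +oo[) (g x)%:E)%E.
  move=> cg g0.
  have mg : measurable_fun setT g by exact: continuous_measurable_fun.
  rewrite -(setUv `[0%R, +oo[%classic) ge0_integral_setU//=; first last.
  - exact/disj_setPCl.
  - by move=> x _; rewrite lee_fin.
  - by apply/measurable_EFinP; rewrite setUv.
  - exact: measurableC.
  rewrite addeC; congr (_ + _)%E.
  rewrite setCitvr integral_itv_bndo_bndc; last exact/measurable_EFinP/measurable_funTS.
  rewrite -{1}oppr0 ge0_integration_by_substitutionNy//.
  exact: continuous_subspaceT.
move=> cf f0; rewrite split0//; last first.
  by move=> x; apply: continuous_comp; [exact: opp_continuous|exact: cf].
rewrite [RHS]split0// addeC; congr (_ + _)%E.
by apply: eq_integral => x _; rewrite opprK.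
Qed.

Section normal_moments.
Context {R : realType}.
Implicit Types (s h : R) (f : R -> R).
Local Notation mu := (@lebesgue_measure R).

Lemma ge0_integral_normal_prob m s f : measurable_fun setT f ->
  (forall x, 0 <= f x) ->
  (\int[normal_prob m s]_x (f x)%:E =
   \int[mu]_x (f x * normal_pdf m s x)%:E)%E.
Proof.
move=> mf f0.
pose nu : {finite_measure set (measurableTypeR R) -> \bar R} := normal_prob m s.
have dom : nu `<< mu := normal_prob_dominates m s.
rewrite -[LHS](Radon_Nikodym_SigmaFinite.change_of_variables dom) //; last first.
  exact/measurable_EFinP.
apply: ae_eq_integral => //.
- apply: emeasurable_funM; first exact/measurable_EFinP.
  exact: measurable_int (Radon_Nikodym_SigmaFinite.f_integrable _).
- apply/measurable_EFinP; apply: measurable_funM => //.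
  exact: measurable_normal_pdf.
- under [X in ae_eq _ _ _ X]eq_fun do rewrite EFinM.
  apply: ae_eqe_mul2l; apply: integral_ae_eq => //.
  + exact: Radon_Nikodym_SigmaFinite.f_integrable.
  + by apply/measurable_EFinP; exact: measurable_normal_pdf.
  + move=> E _ mE.
    by rewrite -Radon_Nikodym_SigmaFinite.f_integral.
Qed.

(** A polynomial factor is paid for by doubling the variance. With [u = x^2 / (4 h)] the two
    densities carry [exp (- 2 u)] and [exp (- u)], so a spare [exp (- u)] absorbs [u] or [u ^+ 2];
    the peaks differ by a factor [sqrt 2 <= 2]. Moment bounds follow without computing an integral,
    since the wider density has mass one. *)
Lemma normal_pdf_comparison h x : 0 < h ->
  [/\ x ^+ 2 * normal_pdf 0 (Num.sqrt h) x
      <= 8 * h * normal_pdf 0 (Num.sqrt (2 * h)) x &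
     x ^+ 4 * normal_pdf 0 (Num.sqrt h) x
      <= 128 * h ^+ 2 * normal_pdf 0 (Num.sqrt (2 * h)) x].
Proof.
move=> h0; have h20 : 0 < 2 * h by rewrite mulr_gt0.
rewrite !normal_pdfE ?gt_eqF ?sqrtr_gt0// /normal_peak /normal_fun /=.
rewrite !subr0 !sqr_sqrtr ?(ltW h0) ?(ltW h20)//.
set u := x ^+ 2 / (4 * h).
have u0 : 0 <= u by rewrite divr_ge0 ?sqr_ge0// mulr_ge0// ltW.
have -> : - x ^+ 2 / (h *+ 2) = - u - u.
  by rewrite /u; field; rewrite gt_eqF.
have -> : - x ^+ 2 / ((2 * h) *+ 2) = - u.
  by rewrite /u; field; rewrite gt_eqF.
have -> : x ^+ 2 = 4 * h * u by rewrite /u; field; rewrite gt_eqF.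
have -> : x ^+ 4 = 16 * h ^+ 2 * u ^+ 2 by rewrite /u; field; rewrite gt_eqF.
rewrite expRD; set e := expR (- u).
have e0 : 0 < e by rewrite expR_gt0.
have key t : t * expR (- t) <= 1.
  rewrite expRN ler_pdivrMr ?expR_gt0// mul1r.
  by have := expR_ge1Dx t; lra.
have ue1 : u * e <= 1 by exact: key.
have ue2 : u ^+ 2 * e <= 4.
  have : (u / 2) * expR (- (u / 2)) <= 1 by exact: key.
  have <- : expR (- (u / 2)) * expR (- (u / 2)) = e.
    by rewrite -expRD /e; congr expR; field.
  have := expR_gt0 (- (u / 2)); set q := expR _ => q0 uq.
  have uq0 : 0 <= u / 2 * q by apply: mulr_ge0; [exact: divr_ge0|exact: ltW].
  have -> : u ^+ 2 * (q * q) = 4 * (u / 2 * q) ^+ 2 by field.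
  by nra.
have hp0 : 0 < h * pi *+ 2 by rewrite mulrn_wgt0// mulr_gt0// pi_gt0.
have sq : Num.sqrt (2 * h * pi *+ 2) <= 2 * Num.sqrt (h * pi *+ 2).
  have -> : 2 * h * pi *+ 2 = 2 * (h * pi *+ 2) by ring.
  rewrite sqrtrM// ler_pM2r ?sqrtr_gt0//.
  by rewrite -[leRHS]ger0_norm// -sqrtr_sqr ler_sqrt ?sqr_ge0//; lra.
set p := (Num.sqrt (h * pi *+ 2))^-1; set p' := (Num.sqrt (2 * h * pi *+ 2))^-1.
have p0 : 0 < p by rewrite invr_gt0 sqrtr_gt0.
have pp' : p <= 2 * p'.
  rewrite /p /p' -[2 * _^-1]invrK lef_pV2 ?posrE ?sqrtr_gt0//; last first.
    rewrite invr_gt0 mulr_gt0 ?invr_gt0 ?sqrtr_gt0//.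
    have -> : 2 * h * pi *+ 2 = 2 * (h * pi *+ 2) by ring.
    by rewrite mulr_gt0.
  by rewrite invfM invrK ler_pdivrMl.
have pe : p * e <= 2 * p' * e by rewrite ler_pM2r.
have hs0 : 0 < 4 * h by rewrite mulr_gt0.
split.
- have -> : 4 * h * u * (p * (e * e)) = 4 * h * (u * e * (p * e)) by ring.
  have -> : 8 * h * (p' * e) = 4 * h * (2 * p' * e) by ring.
  rewrite ler_pM2l//; apply: le_trans pe.
  by rewrite ler_piMl// ltW// mulr_gt0.
- have -> : 16 * h ^+ 2 * u ^+ 2 * (p * (e * e)) =
    64 * h ^+ 2 * (u ^+ 2 * e / 4 * (p * e)) by field.
  have -> : 128 * h ^+ 2 * (p' * e) = 64 * h ^+ 2 * (2 * p' * e) by ring.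
  have h2 : 0 < h ^+ 2 by rewrite exprn_gt0.
  have A : u ^+ 2 * e / 4 * (p * e) <= 2 * p' * e.
    by apply: le_trans pe; rewrite ler_piMl//; try lra; exact/ltW/mulr_gt0.
  by rewrite ler_pM2l// mulr_gt0.
Qed.

Local Open Scope ereal_scope.

Lemma ge0_integral_normal_le h f (C : R) : (0 < h)%R ->
  measurable_fun setT f -> (forall x, (0 <= f x)%R) ->
  (forall x, (f x * normal_pdf 0 (Num.sqrt h) x <=
              C * normal_pdf 0 (Num.sqrt (2 * h)) x)%R) ->
  \int[normal_prob 0 (Num.sqrt h)]_x (f x)%:E <= C%:E.
Proof.
move=> h0 mf f0 fC; rewrite ge0_integral_normal_prob//.
apply: (@le_trans _ _
    (\int[mu]_x (C * normal_pdf 0 (Num.sqrt (2 * h)) x)%:E)).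
  apply: ge0_le_integral => //.
  - by move=> x _; rewrite lee_fin mulr_ge0// normal_pdf_ge0.
  - apply/measurable_EFinP; apply: measurable_funM => //.
    exact: measurable_normal_pdf.
  - apply/measurable_EFinP; apply: measurable_funM => //.
    exact: measurable_normal_pdf.
  - by move=> x _; rewrite lee_fin.
under eq_integral do rewrite EFinM.
rewrite integralZl//; last exact: integrable_normal_pdf.
by rewrite integral_normal_pdf mule1.
Qed.

Lemma normal_moment2_le h : (0 < h)%R ->
  \int[normal_prob 0 (Num.sqrt h)]_x (x ^+ 2)%:E <= (8 * h)%:E.
Proof.
move=> h0; apply: ge0_integral_normal_le => // x.
- exact: sqr_ge0.
- by have [] := normal_pdf_comparison x h0.
Qed.

Lemma normal_moment4_le h : (0 < h)%R ->
  \int[normal_prob 0 (Num.sqrt h)]_x (x ^+ 4)%:E <= (128 * h ^+ 2)%:E.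
Proof.
move=> h0; apply: ge0_integral_normal_le => // x.
- by rewrite exprn_even_ge0.
- by have [] := normal_pdf_comparison x h0.
Qed.

Lemma integrable_normal_sqr h : (0 < h)%R ->
  (normal_prob 0 (Num.sqrt h)).-integrable setT (fun x : R => (x ^+ 2)%:E).
Proof.
move=> h0; apply/integrableP; split; first exact/measurable_EFinP.
under eq_integral do rewrite gee0_abs ?lee_fin ?sqr_ge0//.
exact: le_lt_trans (normal_moment2_le h0) (ltry _).
Qed.

Lemma integrable_normal_expr4 h : (0 < h)%R ->
  (normal_prob 0 (Num.sqrt h)).-integrable setT (fun x : R => (x ^+ 4)%:E).
Proof.
move=> h0; apply/integrableP; split; first exact/measurable_EFinP.
under eq_integral do rewrite gee0_abs ?lee_fin ?exprn_even_ge0//.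
exact: le_lt_trans (normal_moment4_le h0) (ltry _).
Qed.

Lemma integrable_normal_id h : (0 < h)%R ->
  (normal_prob 0 (Num.sqrt h)).-integrable setT (fun x : R => x%:E).
Proof.
move=> h0.
have aux (y : R) : (`|y| <= `|1 + y ^+ 2|)%R.
  rewrite [leRHS]ger0_norm ?addr_ge0 ?sqr_ge0// ler_norml.
  by apply/andP; split; nra.
apply: (@le_integrable _ _ R (normal_prob 0 (Num.sqrt h)) setT measurableT
  (fun x : R => x%:E) (fun x : R => (1 + x ^+ 2)%R%:E)).
- exact/measurable_EFinP.
- move=> x _; rewrite /= lee_fin; exact: aux.
- under eq_fun do rewrite EFinD.
  apply: integrableD => //; last exact: integrable_normal_sqr.
  exact: finite_measure_integrable_cst.
Qed.

(** The positive and negative parts are mirror images of each other and the density is even. *)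
Lemma integral_normal_id h : (0 < h)%R ->
  \int[normal_prob 0 (Num.sqrt h)]_x x%:E = 0.
Proof.
move=> h0; set g := normal_prob _ _.
rewrite integralE.
have pn x : (fun x : R => x%:E)^\+ x = (fun x : R => x%:E)^\- (- x)%R.
  by rewrite funeposE funenegE /= opprK.
suff -> : \int[g]_x (fun x : R => x%:E)^\+ x =
          \int[g]_x (fun x : R => x%:E)^\- x.
  rewrite subee// ge0_fin_numE; last exact: integral_ge0.
  have /integrable_funeneg := integrable_normal_id h0.
  by move=> /(_ measurableT)/integrable_lty; apply.
have pE (x : R) : (fun x : R => x%:E)^\+ x = (Num.max x 0)%:E.
  by rewrite funeposE -EFin_max.
have nE (x : R) : (fun x : R => x%:E)^\- x = (Num.max (- x) 0)%:E.
  by rewrite funenegE -EFin_max.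
under eq_integral do rewrite pE.
under [RHS]eq_integral do rewrite nE.
have c0 : continuous (fun x : R => Num.max x 0)%R.
  have -> : (fun x : R => Num.max x 0)%R = (fun x => (x + `|x|) / 2)%R.
    by apply/funext => x; rewrite maxr_absE subr0 addr0.
  move=> x; apply: cvgMl; apply: cvgD; first exact: cvg_id.
  exact: norm_continuous.
have cp : continuous (normal_pdf 0 (Num.sqrt h)).
  by apply: continuous_normal_pdf; rewrite gt_eqF ?sqrtr_gt0.
have c1 : continuous
    (fun x : R => Num.max x 0 * normal_pdf 0 (Num.sqrt h) x)%R.
  by move=> x; apply: cvgM; [exact: c0|exact: cp].
have max0 (x : R) : (0 <= Num.max x 0)%R by rewrite le_max lexx orbT.
rewrite !ge0_integral_normal_prob//; first last.
- exact: continuous_measurable_fun.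
- apply: continuous_measurable_fun => x.
  apply: (@continuous_comp _ _ _ -%R (fun x : R => Num.max x 0)%R); last exact: c0.
  exact: opp_continuous.
rewrite -(ge0_integralT_comp_oppr c1)/=.
- apply: eq_integral => x _; rewrite !normal_pdfE ?gt_eqF ?sqrtr_gt0//.
  by rewrite /normal_fun !subr0 sqrrN.
- by move=> x; rewrite mulr_ge0// normal_pdf_ge0.
Qed.

End normal_moments.

(** Carries the independence of an increment from rectangles to all measurable sets of the plane. *)
Lemma finite_measure_prod_unique d1 d2 (T1 : measurableType d1)
    (T2 : measurableType d2) (R : realType)
    (m1 m2 : {measure set (T1 * T2) -> \bar R}) :
  (m1 setT < +oo)%E ->
  (forall A B, measurable A -> measurable B -> m1 (A `*` B) = m2 (A `*` B)) ->
  forall C, measurable C -> m1 C = m2 C.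
Proof.
move=> m1oo m12.
pose G : set (set (T1 * T2)) :=
  [set C | exists A B, [/\ measurable A, measurable B & C = A `*` B]].
apply: (@measure_unique _ _ _ G (fun=> setT)).
- rewrite measurable_prod_measurableType //; congr (<<s _ >>).
  rewrite predeqE; split => [[A mA [B mB <-]]|[A [B [mA mB ->]]]].
    by exists A, B.
  by exists A => //; exists B.
- move=> _ _ [A [B [mA mB ->]]] [A' [B' [mA' mB' ->]]].
  exists (A `&` A'), (B `&` B'); split; [exact: measurableI..|].
  by rewrite setXI.
- by move=> _; exists setT, setT; split => //; rewrite setXTT.
- by rewrite bigcup_const.
- by move=> _ [A [B [mA mB ->]]]; exact: m12.
- by [].
Qed.

Section expectation_indep.
Context d d1 d2 (T : measurableType d) (T1 : measurableType d1)
  (T2 : measurableType d2) (R : realType).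
Variables (P : probability T R) (gam : probability T2 R).
Variables (S : {mfun T >-> T1}) (D : {mfun T >-> T2}).
Hypothesis indepSD : forall A C, measurable A -> measurable C ->
  P (S @^-1` A `&` D @^-1` C) = (P (S @^-1` A) * gam C)%E.

Let SD w := (S w, D w).

Let mSD : measurable_fun setT SD.
Proof. exact: measurable_fun_pair. Qed.

HB.instance Definition _ := isMeasurableFun.Build _ _ _ _ SD mSD.

Lemma joint_law C : measurable C ->
  P (SD @^-1` C) = (distribution P S \x gam)%E C.
Proof.
move=> mC.
rewrite [RHS](@product_measure_unique _ _ _ _ _ (distribution P S) gam
  (distribution P SD))//.
Qed.

Lemma normr_expectation_indep_le (phi : T1 * T2 -> R) (M B : R) :
  measurable_fun setT phi -> (forall z, `|phi z| <= M) ->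
  (forall s, (`|\int[gam]_x (phi (s, x))%:E| <= B%:E)%E) ->
  (`|\int[P]_w (phi (S w, D w))%:E| <= B%:E)%E.
Proof.
move=> mphi phiM phiB.
have bphi (T0 : Type) (f : T0 -> T1 * T2) : [bounded (phi \o f) x | x in setT].
  exists M; split; first exact: num_real.
  by move=> N MN x _ /=; exact: le_trans (phiM _) (ltW MN).
have iphi : (distribution P S \x gam)%E.-integrable setT (EFin \o phi).
  apply: measurable_bounded_integrable => //; last exact: bphi id.
  by rewrite -[ltLHS](joint_law measurableT) preimage_setT probability_setT ltey.
have -> : (\int[P]_w (phi (S w, D w))%:E =
           \int[distribution P SD]_z (phi z)%:E)%E.
  rewrite integral_pushforward//=; last first.
    rewrite preimage_setT.
    apply: (measurable_bounded_integrable (f := phi \o SD)) => //=.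
    + by rewrite probability_setT ltey.
    + exact: measurableT_comp.
    + exact: bphi.
  exact/measurable_EFinP.
rewrite (eq_measure_integral (distribution P S \x gam)%E); last first.
  by move=> C mC _; rewrite -[RHS](joint_law mC).
rewrite -integral12_prod_meas1//.
apply: le_trans (le_abse_integral _ _ _) _ => //.
  exact: measurable_fubini_F iphi.
apply: (@le_trans _ _ (\int[distribution P S]_x B%:E)%E).
  apply: ge0_le_integral => //.
  - by apply: measurableT_comp => //; exact: measurable_fubini_F iphi.
  - by move=> s _; exact: phiB.
by rewrite integral_cst//= probability_setT mule1.
Qed.

End expectation_indep.

Section gauss2.
Context {R : realType}.
Variable h : R.
Local Notation MR := (measurableTypeR R).
Local Notation g1 := (normal_prob 0 (Num.sqrt h)).

Definition gauss2 : set (MR * MR) -> \bar R := (g1 \x g1)%E.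

HB.instance Definition _ := Measure.on gauss2.

Lemma gauss2X (A B : set MR) : measurable A -> measurable B ->
  gauss2 (A `*` B) = (g1 A * g1 B)%E.
Proof. by move=> mA mB; rewrite /gauss2 /= product_measure1E. Qed.

Lemma gauss2_setT : gauss2 setT = 1%E.
Proof. by rewrite -setXTT gauss2X// !probability_setT mule1. Qed.

HB.instance Definition _ :=
  @Measure_isProbability.Build _ _ R gauss2 gauss2_setT.

End gauss2.

Section increments.
Context {R : realType} {d : measure_display} {T : measurableType d}.
Local Notation MR := (measurableTypeR R).
Variables (P : probability T R) (X Y : R -> T -> R).
Hypothesis BM : planar_BM P X Y.
Variables (h : R) (h0 : 0 < h).

Definition position t w : MR * MR := (X t w, Y t w).
Definition increment k w : MR * MR :=
  (X (k.+1%:R * h) w - X (k%:R * h) w, Y (k.+1%:R * h) w - Y (k%:R * h) w).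

(** One box for each of the first [k] increments: a family closed under intersection, with the exact
    shape of the events in [planar_BM]. The sigma-algebra it generates plays the role of the
    filtration at grid time [k]. *)
Definition past (k : nat) : set (set T) :=
  [set E | exists A B : nat -> set MR,
     (forall i, measurable (A i) /\ measurable (B i)) /\
     E = \bigcap_(i in [set i | (i < k)%N])
       [set w | A i (increment i w).1 /\ B i (increment i w).2]].

Lemma measurable_position t : measurable_fun setT (position t).
Proof.
by case: BM => _ _ m _; apply: measurable_fun_pair; have [] := m t.
Qed.

Lemma measurable_increment k : measurable_fun setT (increment k).
Proof.
case: BM => _ _ m _; apply: measurable_fun_pair; apply: measurable_funB;
  by have [] := m (k.+1%:R * h); have [] := m (k%:R * h).
Qed.

Lemma past_measurable k : past k `<=` measurable.
Proof.
move=> _ [A [B [mAB ->]]]; apply: bigcap_measurableType => i _.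
have [mA mB] := mAB i.
rewrite -[X in measurable X]setTI.
exact: (@measurable_increment i measurableT (A i `*` B i) (measurableX mA mB)).
Qed.

Lemma past_setI k : setI_closed (past k).
Proof.
move=> _ _ [A [B [mAB ->]]] [A' [B' [mAB' ->]]].
exists (fun i => A i `&` A' i), (fun i => B i `&` B' i); split.
  by move=> i; have [? ?] := mAB i; have [? ?] := mAB' i;
    split; exact: measurableI.
rewrite -bigcapI; apply: eq_bigcapr => i _.
by apply/seteqP; split => w /= [[]]; do ![case=> ? ?|move=> ? ?]; split; split.
Qed.

Lemma past_setT k : past k setT.
Proof.
exists (fun=> setT), (fun=> setT); split => //.
by apply/esym; rewrite -subTset => w _ i _.
Qed.

Lemma past_increment_indep k E A B : past k E ->
  measurable A -> measurable B ->
  P (E `&` increment k @^-1` (A `*` B)) = (P E * gauss2 h (A `*` B))%E.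
Proof.
move=> [A' [B' [mAB' ->]]] mA mB; rewrite gauss2X//.
have [_ _ _ fdd] := BM.
pose s (i : nat) : R := i%:R * h.
have s0 : 0 <= s 0%N by rewrite /s mul0r.
have ss i : s i < s i.+1 by rewrite ltr_pM2r// ltr_nat.
have dss i : s i.+1 - s i = h by rewrite /s -mulrBl -natr1 addrAC subrr add0r mul1r.
have sE i : s i = i%:R * h by [].
clearbody s.
(* The given boxes with the new one put at index [k]: the formulas for [k] and [k.+1] increments
   then differ by one factor. *)
pose A2 i := if i == k then A else A' i.
pose B2 i := if i == k then B else B' i.
have mAB2 i : measurable (A2 i) /\ measurable (B2 i).
  by rewrite /A2 /B2; case: ifP.
have E1 := fdd k s A' B' s0 (fun i _ => ss i) mAB'.
have E2 := fdd k.+1 s A2 B2 s0 (fun i _ => ss i) mAB2.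
rewrite big_nat_recr// in E2.
have A2k : A2 k = A by rewrite /A2 eqxx.
have B2k : B2 k = B by rewrite /B2 eqxx.
have A2i i : (i < k)%N -> A2 i = A' i by move=> ik; rewrite /A2 ltn_eqF.
have B2i i : (i < k)%N -> B2 i = B' i by move=> ik; rewrite /B2 ltn_eqF.
clearbody A2 B2.
rewrite A2k B2k dss in E2.
transitivity (P (\bigcap_(i in [set i | (i < k.+1)%N])
  [set w | A2 i (X (s i.+1) w - X (s i) w) /\
           B2 i (Y (s i.+1) w - Y (s i) w)])); last first.
  rewrite E2; apply: (congr2 mule) => //; transitivity (P
      (\bigcap_(i in [set i | (i < k)%N])
        [set w | A' i (X (s i.+1) w - X (s i) w) /\
                 B' i (Y (s i.+1) w - Y (s i) w)])).
    by rewrite E1; apply: eq_big_nat => i /andP[_ ik]; rewrite A2i// B2i.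
  congr (P _); apply: eq_bigcapr => i _.
  by apply/seteqP; split => w /=; rewrite !sE.
congr (P _); apply/seteqP; split => w.
- move=> [H [HA HB]] i; rewrite /= ltnS leq_eqVlt => /predU1P[->|ik].
    by rewrite A2k B2k !sE.
  by rewrite A2i// B2i//; rewrite !sE; exact: H.
- move=> H; split.
    by move=> i ik; have := H i (leqW ik); rewrite /= A2i// B2i// !sE.
  by have := H k (ltnSn k); rewrite /= A2k B2k !sE.
Qed.

Lemma past_sub_measurable k E : <<s past k >> E -> measurable E.
Proof.
apply: smallest_sub; last exact: past_measurable.
exact: sigma_algebra_measurable.
Qed.

(** Two uniqueness arguments in turn: for a fixed rectangle both sides are measures in [E] that
    agree on [past k]; then for a fixed [E] both sides are measures in [C] that agree on
    rectangles. *)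
Lemma past_increment_indep_sigma k E C : <<s past k >> E -> measurable C ->
  P (E `&` increment k @^-1` C) = (P E * gauss2 h C)%E.
Proof.
move=> sE; have mE := past_sub_measurable sE.
have mpre C' : measurable C' -> measurable (increment k @^-1` C').
  by move=> mC'; rewrite -[X in measurable X]setTI; exact: measurable_increment.
have key A B : measurable A -> measurable B ->
    P (E `&` increment k @^-1` (A `*` B)) = (P E * gauss2 h (A `*` B))%E.
  move=> mA mB; have mAB := mpre _ (measurableX mA mB).
  pose r := NngNum (fine_ge0 (measure_ge0 (gauss2 h) (A `*` B))).
  have rE : (r%:num)%:E = gauss2 h (A `*` B).
    by rewrite /= fineK// fin_num_measure//; exact: measurableX.
  have := @g_sigma_algebra_measure_unique _ R T (past k) (@past_measurable k)
    (fun=> setT) (fun=> past_setT k) (bigcup_const _ _)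
    (mrestr P mAB) (mscale r P) (@past_setI k) _ _ E sE.
  rewrite -rE muleC; apply.
  - by exists 0%N.
  - move=> E' pE'; apply: etrans (past_increment_indep pE' mA mB) _.
    by rewrite -rE muleC.
  - by move=> _; rewrite ltey_eq fin_num_measure.
have mfk := measurable_increment k.
pose q := NngNum (fine_ge0 (measure_ge0 P E)).
have qE : (q%:num)%:E = P E by rewrite /= fineK// fin_num_measure.
move=> mC.
have := @finite_measure_prod_unique _ _ MR MR R
  (measure_function_pushforward__canonical__measure_function_Measure
    (mrestr P mE) mfk) (mscale q (gauss2 h)) _ _ C mC.
rewrite -qE setIC; apply.
- change (P (setT `&` E) < +oo)%E.
  by rewrite setTI ltey_eq fin_num_measure.
- move=> A B mA mB; apply: (@etrans _ _ (P (E `&` increment k @^-1` (A `*` B)))).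
    by rewrite setIC.
  by rewrite (key _ _ mA mB) -qE.
Qed.

Lemma past_measurable_increment k i : (i < k)%N ->
  measurable_fun (setT : set (g_sigma_algebraType (past k)))
    (increment i : g_sigma_algebraType (past k) -> MR * MR).
Proof.
move=> ik; apply/measurable_fun_pairP; split.
- move=> _ C mC; rewrite setTI; apply: sub_sigma_algebra.
  exists (fun j => if j == i then C else setT), (fun=> setT); split.
    by move=> j; split => //; case: ifP.
  apply/seteqP; split => w /=.
    by move=> Cw j _; split => //; case: eqP => // ->.
  by move=> /(_ i ik)[]; rewrite eqxx.
- move=> _ C mC; rewrite setTI; apply: sub_sigma_algebra.
  exists (fun=> setT), (fun j => if j == i then C else setT); split.
    by move=> j; split => //; case: ifP.
  apply/seteqP; split => w /=.
    by move=> Cw j _; split => //; case: eqP => // ->.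
  by move=> /(_ i ik)[]; rewrite eqxx.
Qed.

Lemma past_measurable_position k j : (j <= k)%N ->
  measurable_fun (setT : set (g_sigma_algebraType (past k)))
    (position (j%:R * h) : g_sigma_algebraType (past k) -> MR * MR).
Proof.
move=> jk; have [W0 _ _ _] := BM.
have -> : position (j%:R * h) = fun w =>
    (\sum_(i < j) (increment i w).1, \sum_(i < j) (increment i w).2).
  apply/funext => w; rewrite /position /increment /=.
  rewrite -!(big_mkord xpredT (fun i => _ (i.+1%:R * h) w - _ (i%:R * h) w)).
  by rewrite !telescope_sumr// mul0r; have [-> ->] := W0 w; rewrite !subr0.
apply: measurable_fun_pair; apply: measurable_sum => i;
  have ik := leq_trans (ltn_ord i) jk;
  by have /measurable_fun_pairP[] := past_measurable_increment ik.
Qed.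

End increments.

(** * The angle function *)

Section atan_estimates.
Context {R : realType}.
Implicit Types (a b t x y : R).

Lemma cos_gt0_ltpihalf x : `|x| < pi -> 0 < cos x -> `|x| < pi / 2.
Proof.
move=> xpi; rewrite -cos_norm; move: (normr_ge0 x) xpi; move: `|x| => y y0 ypi.
apply: contraTT; rewrite -!leNgt => ypi2.
rewrite -(@cos_pihalf R); have [->//|yn] := eqVneq y (pi / 2).
apply: ltW; rewrite ltr_cos ?in_itv/= ?y0 ?(ltW ypi)//.
  by rewrite lt_neqAle eq_sym yn.
by rewrite divr_ge0 ?pi_ge0//= ler_pdivrMr// ler_peMr ?pi_ge0// ler1n.
Qed.

Lemma cos_atan_gt0 x : 0 < cos (atan x).
Proof.
by rewrite cos_gt0_pihalf// atan_gtNpi2 atan_ltpi2.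
Qed.

Lemma sin_atan x : sin (atan x) = x * cos (atan x).
Proof.
by rewrite -{2}(atanK x) /tan divfK// gt_eqF// cos_atan_gt0.
Qed.

Lemma cos_atanD a b :
  cos (atan a + atan b) = (1 - a * b) * (cos (atan a) * cos (atan b)).
Proof. by rewrite cosD !sin_atan; ring. Qed.

Lemma sin_atanD a b :
  sin (atan a + atan b) = (a + b) * (cos (atan a) * cos (atan b)).
Proof. by rewrite sinD !sin_atan; ring. Qed.

Lemma norm_atanD a b : `|atan a + atan b| < pi.
Proof.
rewrite ltr_norml.
have := atan_gtNpi2 a; have := atan_gtNpi2 b.
have := atan_ltpi2 a; have := atan_ltpi2 b.
by move=> *; apply/andP; split; lra.
Qed.

(** [a * b < 1] makes the cosine of the sum positive; the sum, already in [(-pi, pi)], then lies in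
    the range where [tan] is inverted by [atan]. *)
Lemma atanD a b : a * b < 1 -> atan a + atan b = atan ((a + b) / (1 - a * b)).
Proof.
move=> ab1; have ca := cos_atan_gt0 a; have cb := cos_atan_gt0 b.
have cs0 : 0 < cos (atan a + atan b).
  by rewrite cos_atanD mulr_gt0 ?subr_gt0// mulr_gt0.
have := cos_gt0_ltpihalf (norm_atanD a b) cs0; rewrite ltr_norml => h.
rewrite -[LHS]tanK ?in_itv//=; congr atan.
rewrite /tan cos_atanD sin_atanD; field.
by rewrite !gt_eqF ?subr_gt0.
Qed.

Lemma atanB a b : - 1 < a * b -> atan a - atan b = atan ((a - b) / (1 + a * b)).
Proof. by move=> ab1; rewrite -atanN atanD ?mulrN ?opprK// ltrNl. Qed.

Lemma atan_sub_le t : `|atan t - t| <= `|t| ^+ 3.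
Proof.
wlog t0 : t / 0 <= t => [hw|].
  have [/hw//|/ltW t0] := leP 0 t.
  have := hw (- t); rewrite oppr_ge0 => /(_ t0).
  by rewrite atanN -opprD !normrN.
rewrite [in leRHS]ger0_norm//; have [->|tn0] := eqVneq t 0.
  by rewrite atan0 subrr normr0 expr0n.
have {tn0} t0 : 0 < t by rewrite lt_def tn0.
pose df (x : R) := (1 + x ^+ 2)^-1 - 1.
have [|c] := @MVT R (fun x => atan x - x) df 0 t t0 _.
  apply: continuous_subspaceT => x; apply: cvgB; last exact: cvg_id.
  exact: continuous_atan.
rewrite in_itv/= => /andP[c0 ct].
rewrite atan0 !subr0 => ->; rewrite /df.
have c2 : 0 < 1 + c ^+ 2 by rewrite ltr_pwDl ?sqr_ge0.
have -> : (1 + c ^+ 2)^-1 - 1 = - (c ^+ 2 / (1 + c ^+ 2)).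
  by field; rewrite gt_eqF.
rewrite mulNr normrN ger0_norm; last first.
  by rewrite mulr_ge0 ?divr_ge0 ?sqr_ge0 ?ltW.
have -> : t ^+ 3 = t ^+ 2 * t by ring.
rewrite ler_pM2r// ler_pdivrMr//.
have : c ^+ 2 <= t ^+ 2 by apply: lerXn2r; rewrite ?nnegrE ltW.
have : 0 <= c ^+ 2 by exact: sqr_ge0.
by nra.
Qed.

(** With [z = xi + i eta] this is the second-order expansion of [Im log (1 + z)], whose main part is
    [Im (z - z^2 / 2) = eta - eta xi]. *)
Lemma atan_taylor2 (xi eta n : R) : `|xi| <= n -> `|eta| <= n -> n <= 2^-1 ->
  `|atan (eta / (1 + xi)) - eta + eta * xi| <= 10 * n ^+ 3.
Proof.
move=> xin etan n2.
have n0 : 0 <= n by exact: le_trans xin.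
have xi1 : 2^-1 <= 1 + xi.
  by move: xin; rewrite ler_norml => /andP[? ?]; lra.
have xi0 : 0 < 1 + xi by exact: lt_le_trans xi1.
set t := eta / (1 + xi).
have tn : `|t| <= 2 * n.
  rewrite normrM normfV (gtr0_norm xi0) ler_pdivrMr//; nra.
have -> : atan t - eta + eta * xi = (atan t - t) + t * xi ^+ 2.
  by rewrite /t; field; rewrite gt_eqF.
apply: le_trans (ler_normD _ _) _.
have h1 : `|atan t - t| <= 8 * n ^+ 3.
  apply: le_trans (atan_sub_le t) _.
  have -> : 8 * n ^+ 3 = (2 * n) ^+ 3 by ring.
  by apply: lerXn2r; rewrite ?nnegrE ?mulr_ge0.
have h2 : `|t * xi ^+ 2| <= 2 * n ^+ 3.
  rewrite normrM normrX.
  have -> : 2 * n ^+ 3 = (2 * n) * n ^+ 2 by ring.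
  by apply: ler_pM; rewrite ?exprn_ge0//; apply: lerXn2r; rewrite ?nnegrE.
lra.
Qed.

(* [eta] and [xi] are the imaginary and real parts of the relative
   displacement of the complex number [p + i u] when it moves
   to [(p - e1) + i (u + e2)]. *)
Lemma atan_quotient_taylor2 (p u e1 e2 eps n : R) : 0 < eps -> eps <= p ->
  n = `|e1| + `|e2| -> n <= eps / 2 ->
  let q := p ^+ 2 + u ^+ 2 in
  let eta := (p * e2 + u * e1) / q in
  let xi := (u * e2 - p * e1) / q in
  [/\ `|eta| <= n / eps, `|xi| <= n / eps &
  `|atan ((u + e2) / (p - e1)) - atan (u / p) - eta + eta * xi|
    <= 10 * (n / eps) ^+ 3].
Proof.
move=> eps0 epsp nE nle q eta xi.
have p0 : 0 < p by exact: lt_le_trans epsp.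
have q0 : 0 < q by rewrite /q ltr_pwDl ?sqr_ge0// exprn_gt0.
have n0 : 0 <= n by rewrite nE addr_ge0.
have pq : eps * p <= q.
  have : 0 <= u ^+ 2 by exact: sqr_ge0.
  by rewrite /q; nra.
have uq : eps * `|u| <= q.
  have : u ^+ 2 = `|u| ^+ 2 by rewrite real_normK ?num_real.
  rewrite /q => ->; move: (normr_ge0 u); move: `|u| => v v0.
  have h1 : eps * v <= p * v by rewrite ler_wpM2r.
  have h2 : 0 <= p * v by rewrite mulr_ge0// ltW.
  by have := sqr_ge0 (p - v); rewrite sqrrB; lra.
have bound (x y z : R) : `|x| <= p * `|y| + `|u| * `|z| ->
    `|y| + `|z| = n -> `|x / q| <= n / eps.
  move=> xle yzn; rewrite normrM normfV (gtr0_norm q0) ler_pdivrMr//.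
  apply: le_trans xle _; rewrite mulrAC ler_pdivlMr// -yzn.
  have := normr_ge0 y; have := normr_ge0 z; nra.
have etan : `|eta| <= n / eps.
  apply: (@bound _ e2 e1); last by rewrite addrC.
  by rewrite (le_trans (ler_normD _ _))// !normrM (gtr0_norm p0).
have xin : `|xi| <= n / eps.
  apply: (@bound _ e1 e2) => //.
  by rewrite (le_trans (ler_normB _ _))// !normrM (gtr0_norm p0) addrC.
split => //.
have n2 : n / eps <= 2^-1 by rewrite ler_pdivrMr// mulrC.
have xi0 : 0 < 1 + xi.
  by move: xin; rewrite ler_norml => /andP[? ?]; lra.
have pe0 : 0 < p - e1.
  have : e1 <= n by rewrite nE (le_trans (ler_norm _))// lerDl.
  by lra.
have ab : 1 + (u + e2) / (p - e1) * (u / p) = q * (1 + xi) / (p * (p - e1)).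
  by rewrite /xi /q; field; rewrite !gt_eqF.
have := atan_taylor2 xin etan n2.
have -> : eta / (1 + xi) =
    ((u + e2) / (p - e1) - u / p) / (1 + (u + e2) / (p - e1) * (u / p)).
  rewrite ab /eta; field; rewrite !gt_eqF//=.
rewrite -atanB//; rewrite -subr_gt0 opprK addrC ab.
by rewrite divr_gt0 ?mulr_gt0.
Qed.

End atan_estimates.

Section harmonic_angle.
Context {R : realType}.
Implicit Types (A b a x y p u : R).

(* The angle under which the point [(x, y)] sees the vertical segment from
   [(A, -b)] to [(A, b)]; it is harmonic in the half-plane [x < A]. *)
Definition angle A b x y : R := atan ((b - y) / (A - x)) + atan ((b + y) / (A - x)).

Definition cut_angle A b m x y : R := angle A b (Num.min x m) y.

Lemma norm_angle_lt A b x y : `|angle A b x y| < pi.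
Proof. exact: norm_atanD. Qed.

(** No smallness of the step is assumed. A step of size at most [(A - a) / 2] does not meet the
    truncation and the expansion applies; for a longer one [n / (A - a)] exceeds 1/2, and every term
    on the left is separately bounded by a multiple of its cube. *)
Lemma cut_atan_taylor2 A a x u (e1 e2 n : R) : a < A -> x <= a ->
  n = `|e1| + `|e2| ->
  let p := A - x in
  let q := p ^+ 2 + u ^+ 2 in
  let eta := (p * e2 + u * e1) / q in
  let xi := (u * e2 - p * e1) / q in
  is_true (`|atan ((u + e2) / (A - Num.min (x + e1) (a + (A - a) / 2)))
    - atan (u / p) - eta + eta * xi| <= 80 * (n / (A - a)) ^+ 3).
Proof.
move=> aA xa nE p q eta xi; set eps := A - a.
have eps0 : 0 < eps by rewrite subr_gt0.
have epsp : eps <= p by rewrite lerB.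
have n0 : 0 <= n by rewrite nE addr_ge0.
have ne0 : 0 <= n / eps by rewrite divr_ge0// ltW.
have [nle|nge] := leP n (eps / 2).
  have [_ _] := @atan_quotient_taylor2 R p u e1 e2 eps n eps0 epsp nE nle.
  have -> : Num.min (x + e1) (a + eps / 2) = x + e1.
    apply/min_idPl; apply: lerD => //.
    by apply: le_trans nle; rewrite nE (le_trans (ler_norm _))// lerDl.
  rewrite -/q -/eta -/xi /p opprD addrA => /le_trans; apply.
  by rewrite ler_wpM2r ?exprn_ge0// ler_nat.
have r1 : 1 <= 2 * (n / eps).
  by rewrite mulrA ler_pdivlMr// mul1r; move: nge; rewrite ltr_pdivrMr//; lra.
set r := n / eps in ne0 r1 *.
have etar : `|eta| <= r /\ `|xi| <= r.
  have nn0 : 0 < n by apply: lt_trans nge; rewrite divr_gt0.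
  (* [eta] and [xi] are linear in the step, so their bounds for a long step come from the step
     shrunk to size [eps / 2]. *)
  pose t := eps / 2 / n.
  have s0 : 0 < t by rewrite divr_gt0 ?divr_gt0.
  have nt : eps / 2 = `|t * e1| + `|t * e2|.
    by rewrite !(normrM t) !(gtr0_norm s0) -mulrDr -nE divfK ?gt_eqF.
  have /= [] := @atan_quotient_taylor2 R p u (t * e1) (t * e2) eps
    (eps / 2) eps0 epsp nt (lexx _).
  have -> : (p * (t * e2) + u * (t * e1)) / (p ^+ 2 + u ^+ 2) = t * eta.
    by rewrite /eta /q; ring.
  have -> : (u * (t * e2) - p * (t * e1)) / (p ^+ 2 + u ^+ 2) = t * xi.
    by rewrite /xi /q; ring.
  rewrite !(normrM t) (gtr0_norm s0) => h1 h2 _.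
  have rE : t * r = eps / 2 / eps.
    by rewrite /t /r; field; rewrite !gt_eqF.
  by rewrite -rE !ler_pM2l// in h1 h2.
have [etan xin] := etar.
have pi4 : (pi : R) <= 4 by have := @pihalf_lt2 R; lra.
have d4 z z' : `|atan z - atan z'| <= (4 : R).
  apply: le_trans pi4; apply: ltW; rewrite -atanN; exact: norm_atanD.
apply: le_trans (ler_normD _ _) _.
apply: le_trans (lerD (ler_normB _ _) (lexx _)) _.
have h3 : `|eta * xi| <= r ^+ 2 by rewrite normrM expr2 ler_pM.
have h4 : 1 <= 8 * r ^+ 3 by nra.
have := d4 ((u + e2) / (A - Num.min (x + e1) (a + eps / 2))) (u / p).
have h5 : r <= 4 * r ^+ 3 by nra.
have h6 : r ^+ 2 <= 2 * r ^+ 3 by nra.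
by lra.
Qed.

(** Harmonicity shows in the quadratic part: it has no trace, so its mean vanishes for an isotropic
    increment. The cubic error is split by [d^3 <= lam d^2 + d^4 / lam] so that only even moments
    are needed; [lam] is left free and will be [sqrt h]. The constant is 160 for two arctangents,
    times 8 for the cube of [n <= 2 de], times 8 for [de ^+ 4]. *)
Lemma cut_angle_taylor2 A b a (c s : R) x y :
  a < A -> x <= a -> c ^+ 2 + s ^+ 2 = 1 ->
  exists al be ka mu : R, forall d1 d2 lam : R, 0 < lam ->
  `|cut_angle A b (a + (A - a) / 2) (x + (c * d1 + s * d2)) (y + (- s * d1 + c * d2))
    - cut_angle A b (a + (A - a) / 2) x y
    - (al * d1 + be * d2 + ka * (d1 ^+ 2 - d2 ^+ 2) + mu * (d1 * d2))|
  <= 10240 / (A - a) ^+ 3 *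
     (lam * (d1 ^+ 2 + d2 ^+ 2) + (d1 ^+ 4 + d2 ^+ 4) / lam).
Proof.
move=> aA xa cs1; set m := a + (A - a) / 2.
have eps0 : 0 < A - a by rewrite subr_gt0.
have xm : Num.min x m = x by apply/min_idPl; rewrite /m; lra.
pose p := A - x; pose u1 := b - y; pose u2 := b + y.
pose q1 := p ^+ 2 + u1 ^+ 2; pose q2 := p ^+ 2 + u2 ^+ 2.
pose k1 := p * u1 / q1 ^+ 2; pose l1 := (u1 ^+ 2 - p ^+ 2) / q1 ^+ 2.
pose k2 := p * u2 / q2 ^+ 2; pose l2 := (u2 ^+ 2 - p ^+ 2) / q2 ^+ 2.
pose g1 := u1 / q1 + u2 / q2; pose g2 := p / q2 - p / q1.
pose K := k1 + k2; pose L := l2 - l1.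
(* [(g1, g2)] is the gradient and [K (e1^2 - e2^2) - L e1 e2] the quadratic part in the rotated step
   [(e1, e2)]; the witnesses are the coefficients after substituting [e1] and [e2] in terms of [d1]
   and [d2]. *)
exists (g1 * c - g2 * s), (g1 * s + g2 * c),
  (- (K * (s ^+ 2 - c ^+ 2) - L * (c * s))),
  (- (K * (- 4 * (c * s)) + L * (c ^+ 2 - s ^+ 2))) => d1 d2 lam lam0.
set e1 := c * d1 + s * d2; set e2 := - s * d1 + c * d2.
set n := `|e1| + `|e2|.
have H1 := @cut_atan_taylor2 A a x u1 e1 (- e2) n aA xa.
rewrite normrN in H1; have {}H1 := H1 erefl.
have H2 := @cut_atan_taylor2 A a x u2 e1 e2 n aA xa erefl.
rewrite /= -/p -/q1 -/q2 -/m in H1 H2.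
rewrite /cut_angle /angle xm -/p.
rewrite -/u1 -/u2.
have -> : b - (y + e2) = u1 - e2 by rewrite /u1; ring.
have -> : b + (y + e2) = u2 + e2 by rewrite /u2; ring.
set D1 := _ - _ - _ + _ in H1; set D2 := _ - _ - _ + _ in H2.
rewrite [X in `|X|](_ : _ = D1 + D2); last first.
  rewrite /D1 /D2 /g1 /g2 /K /L /k1 /k2 /l1 /l2 /e1 /e2.
  have q10 : q1 != 0.
    by rewrite gt_eqF// ltr_pwDl ?sqr_ge0// exprn_gt0// /p; lra.
  have q20 : q2 != 0.
    by rewrite gt_eqF// ltr_pwDl ?sqr_ge0// exprn_gt0// /p; lra.
  have c2 : c ^+ 2 = 1 - s ^+ 2 by rewrite -cs1; ring.
  move: (atan _) (atan _) (atan _) (atan _) => t1 t2 t3 t4.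
  by field; rewrite q10 q20.
apply: le_trans (ler_normD _ _) _; apply: le_trans (lerD H1 H2) _.
set de := `|d1| + `|d2|.
have de0 : 0 <= de by rewrite addr_ge0.
have c1 : `|c| <= 1.
  by rewrite -(@ler_pXn2r _ 2) ?nnegrE// expr1n real_normK ?num_real// -cs1 lerDl sqr_ge0.
have s1 : `|s| <= 1.
  by rewrite -(@ler_pXn2r _ 2) ?nnegrE// expr1n real_normK ?num_real// -cs1 lerDr sqr_ge0.
have n2 : n <= 2 * de.
  have -> : 2 * de = (`|d1| + `|d2|) + (`|d1| + `|d2|) by rewrite /de; ring.
  apply: lerD; apply: le_trans (ler_normD _ _) _; rewrite !normrM ?normrN;
    by apply: lerD; apply: ler_piMl.
have n0 : 0 <= n by rewrite addr_ge0.
have -> : 80 * (n / (A - a)) ^+ 3 + 80 * (n / (A - a)) ^+ 3 =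
  160 * n ^+ 3 / (A - a) ^+ 3 by field; rewrite gt_eqF.
rewrite [leRHS]mulrAC ler_pM2r ?invr_gt0 ?exprn_gt0//.
have n3 : n ^+ 3 <= 8 * de ^+ 3.
  have -> : 8 * de ^+ 3 = (2 * de) ^+ 3 by ring.
  by apply: lerXn2r; rewrite ?nnegrE ?mulr_ge0.
have d3 : de ^+ 3 <= lam * de ^+ 2 + de ^+ 4 / lam.
  rewrite -subr_ge0.
  have -> : lam * de ^+ 2 + de ^+ 4 / lam - de ^+ 3 =
     de ^+ 2 / lam * (lam ^+ 2 - lam * de + de ^+ 2) by field; rewrite gt_eqF.
  rewrite mulr_ge0 ?divr_ge0 ?exprn_ge0 ?(ltW lam0)//.
  by have := sqr_ge0 (lam - de); have := mulr_ge0 (ltW lam0) de0; rewrite sqrrB; nra.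
have dd2 : de ^+ 2 <= 2 * (d1 ^+ 2 + d2 ^+ 2).
  rewrite /de -(real_normK (num_real d1)) -(real_normK (num_real d2)).
  by have := sqr_ge0 (`|d1| - `|d2|); rewrite sqrrB sqrrD; lra.
have dd4 : de ^+ 4 <= 8 * (d1 ^+ 4 + d2 ^+ 4).
  have -> : de ^+ 4 = (de ^+ 2) ^+ 2 by ring.
  have : (de ^+ 2) ^+ 2 <= (2 * (d1 ^+ 2 + d2 ^+ 2)) ^+ 2.
    by apply: lerXn2r; rewrite ?nnegrE ?mulr_ge0 ?addr_ge0 ?sqr_ge0.
  by have := sqr_ge0 (d1 ^+ 2 - d2 ^+ 2); rewrite !sqrrB; nra.
have h1 := ler_wpM2l (ltW lam0) dd2.
have h2 : de ^+ 4 / lam <= 8 * (d1 ^+ 4 + d2 ^+ 4) / lam.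
  by rewrite ler_pM2r ?invr_gt0.
have h3 : 0 <= lam * (d1 ^+ 2 + d2 ^+ 2) by rewrite mulr_ge0 ?addr_ge0 ?sqr_ge0 ?ltW.
have h4 : 8 * (d1 ^+ 4 + d2 ^+ 4) / lam = 8 * ((d1 ^+ 4 + d2 ^+ 4) / lam).
  by rewrite mulrA.
rewrite h4 in h2; nra.
Qed.

End harmonic_angle.

Section gauss2_moments.
Context {R : realType}.
Local Notation MR := (measurableTypeR R).
Variables (h : R) (h0 : 0 < h).
Local Notation g1 := (normal_prob 0 (Num.sqrt h)).
Local Notation g2 := (gauss2 h).
Local Open Scope ereal_scope.

Lemma gauss2_integralM (phi psi : MR -> R) :
  g1.-integrable setT (EFin \o phi) -> g1.-integrable setT (EFin \o psi) ->
  g2.-integrable setT (fun z : MR * MR => (phi z.1 * psi z.2)%:E) /\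
  \int[g2]_z (phi z.1 * psi z.2)%:E =
  \int[g1]_x (phi x)%:E * \int[g1]_x (psi x)%:E.
Proof.
move=> iphi ipsi.
have mphi : measurable_fun setT phi.
  by apply/measurable_EFinP; exact: measurable_int iphi.
have mpsi : measurable_fun setT psi.
  by apply/measurable_EFinP; exact: measurable_int ipsi.
have mm : measurable_fun setT (fun z : MR * MR => (phi z.1 * psi z.2)%:E).
  apply/measurable_EFinP; apply: measurable_funM.
    exact: measurableT_comp.
  exact: measurableT_comp.
have apsi : \int[g1]_x `|(psi x)%:E| < +oo by case/integrableP : ipsi.
have aphi : \int[g1]_x `|(phi x)%:E| < +oo by case/integrableP : iphi.
have apsi0 : 0 <= \int[g1]_x `|(psi x)%:E| by exact: integral_ge0.
have im : (g1 \x g1).-integrable setT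
    (fun z : MR * MR => (phi z.1 * psi z.2)%:E).
  have inner (x : MR) : \int[g1]_y `|(phi x * psi y)%:E| =
      `|(phi x)%:E| * \int[g1]_y `|(psi y)%:E|.
    transitivity (\int[g1]_y (`|(phi x)%:E| * `|(psi y)%:E|)).
      by apply: eq_integral => y _; rewrite EFinM abseM.
    rewrite ge0_integralZl//.
    by apply/measurableT_comp => //; exact/measurable_EFinP.
  apply/integrable12ltyP => //.
  rewrite (eq_integral (fun x => `|(phi x)%:E| * \int[g1]_y `|(psi y)%:E|));
    last by move=> x _; exact: inner.
  rewrite ge0_integralZr//; last first.
    by apply/measurableT_comp => //; exact/measurable_EFinP.
  apply: lte_mul_pinfty => //; first exact: integral_ge0.
  by rewrite ge0_fin_numE//; exact: integral_ge0.
split => //.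
rewrite -[LHS](integral12_prod_meas1 im).
have fpsi : \int[g1]_x (psi x)%:E \is a fin_num by exact: integrable_fin_num.
rewrite (eq_integral (fun x => (phi x)%:E * \int[g1]_y (psi y)%:E)).
  by rewrite -(fineK fpsi) integralZr.
by move=> x _; rewrite /fubini_F -integralZl.
Qed.

Lemma gauss2_integral_fst (phi : MR -> R) : g1.-integrable setT (EFin \o phi) ->
  g2.-integrable setT (fun z : MR * MR => (phi z.1)%:E) /\
  \int[g2]_z (phi z.1)%:E = \int[g1]_x (phi x)%:E.
Proof.
move=> iphi.
have i1 : g1.-integrable setT (EFin \o (fun _ : MR => 1%R)).
  exact: finite_measure_integrable_cst.
have [] := gauss2_integralM iphi i1.
rewrite integral_cst// [X in _ * X]mul1e [X in _ * X]probability_setT mule1.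
by rewrite (_ : (fun z : MR * MR => (phi z.1 * 1)%:E) = (fun z => (phi z.1)%:E));
  last by apply/funext => z; rewrite mulr1.
Qed.

Lemma gauss2_integral_snd (phi : MR -> R) : g1.-integrable setT (EFin \o phi) ->
  g2.-integrable setT (fun z : MR * MR => (phi z.2)%:E) /\
  \int[g2]_z (phi z.2)%:E = \int[g1]_x (phi x)%:E.
Proof.
move=> iphi.
have i1 : g1.-integrable setT (EFin \o (fun _ : MR => 1%R)).
  exact: finite_measure_integrable_cst.
have [] := gauss2_integralM i1 iphi.
rewrite integral_cst// [X in X * _]mul1e [X in X * _]probability_setT mul1e.
by rewrite (_ : (fun z : MR * MR => (1 * phi z.2)%:E) = (fun z => (phi z.2)%:E));
  last by apply/funext => z; rewrite mul1r.
Qed.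

Lemma gauss2_quadratic_mean0 (al be ka mu : R) :
  let p (z : MR * MR) := (al * z.1 + be * z.2 + ka * (z.1 ^+ 2 - z.2 ^+ 2)
                          + mu * (z.1 * z.2))%R in
  g2.-integrable setT (EFin \o p) /\ \int[g2]_z (p z)%:E = 0.
Proof.
have iid := integrable_normal_id h0; have isq := integrable_normal_sqr h0.
have [i1 e1] := gauss2_integral_fst iid.
have [i2 e2] := gauss2_integral_snd iid.
have [i3 e3] := gauss2_integral_fst isq.
have [i4 e4] := gauss2_integral_snd isq.
have [i5 e5] := gauss2_integralM iid iid.
rewrite integral_normal_id// in e1 e2 e5.
move=> p.
have pE : EFin \o p = (fun z : MR * MR => al%:E * (z.1)%:E + be%:E * (z.2)%:E
    + ka%:E * ((z.1 ^+ 2)%:E - (z.2 ^+ 2)%:E) + mu%:E * (z.1 * z.2)%:E).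
  by apply/funext => z; rewrite /= !EFinD !EFinM EFinB.
have j1 := integrableZl measurableT al i1.
have j2 := integrableZl measurableT be i2.
have j34 := integrableB measurableT i3 i4.
have j3 := integrableZl measurableT ka j34.
have j5 := integrableZl measurableT mu i5.
have k1 := integrableD measurableT j1 j2.
have k2 := integrableD measurableT k1 j3.
have k3 := integrableD measurableT k2 j5.
split; first by rewrite pE.
transitivity (\int[g2]_z (EFin \o p) z) => //; rewrite pE.
rewrite integralD// integralD// integralD// !integralZl// integralB//.
rewrite e1 e2 e3 e4 e5 !mule0 !add0e adde0 subee ?mule0//.
by apply: integrable_fin_num.
Qed.

(** The weight [sqrt h] gives the second and the fourth moments the same order [h^(3/2)]; 272 is 8 +
    8 + 128 + 128. *)
Lemma gauss2_integral_le (K : R) : (0 <= K)%R ->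
  \int[g2]_z (K * (Num.sqrt h * (z.1 ^+ 2 + z.2 ^+ 2)
             + (z.1 ^+ 4 + z.2 ^+ 4) / Num.sqrt h))%:E
  <= (K * 272 * (h * Num.sqrt h))%:E.
Proof.
move=> K0; have s0 : (0 < Num.sqrt h)%R by rewrite sqrtr_gt0.
have isq := integrable_normal_sqr h0; have i4 := integrable_normal_expr4 h0.
have [j1 e1] := gauss2_integral_fst isq.
have [j2 e2] := gauss2_integral_snd isq.
have [j3 e3] := gauss2_integral_fst i4.
have [j4 e4] := gauss2_integral_snd i4.
have k1 := integrableD measurableT j1 j2.
have k2 := integrableD measurableT j3 j4.
have l1 := integrableZl measurableT (K * Num.sqrt h)%R k1.
have l2 := integrableZl measurableT (K / Num.sqrt h)%R k2.
rewrite (eq_integral (fun z : MR * MR =>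
  (K * Num.sqrt h)%:E * ((z.1 ^+ 2)%:E + (z.2 ^+ 2)%:E) +
  (K / Num.sqrt h)%:E * ((z.1 ^+ 4)%:E + (z.2 ^+ 4)%:E))); last first.
  move=> [x y] _; move: (x : R) (y : R) => {}x {}y.
  transitivity ((K * Num.sqrt h * (x ^+ 2 + y ^+ 2) +
    K / Num.sqrt h * (x ^+ 4 + y ^+ 4))%R%:E); last by [].
  by congr EFin => /=; ring.
rewrite integralD// !integralZl// !integralD// e1 e2 e3 e4.
have m2 := normal_moment2_le h0; have m4 := normal_moment4_le h0.
apply: (@le_trans _ _ ((K * Num.sqrt h)%:E * ((8 * h)%:E + (8 * h)%:E) +
  (K / Num.sqrt h)%:E * ((128 * h ^+ 2)%:E + (128 * h ^+ 2)%:E))).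
  apply: leeD; apply: lee_wpmul2l; rewrite ?lee_fin ?mulr_ge0 ?invr_ge0 ?(ltW s0)//;
    exact: leeD.
change ((K * Num.sqrt h * (8 * h + 8 * h) +
  K / Num.sqrt h * (128 * h ^+ 2 + 128 * h ^+ 2))%R%:E <=
  (K * 272 * (h * Num.sqrt h))%:E); rewrite lee_fin.
set r := Num.sqrt h in s0 *.
have hE : h = (r ^+ 2)%R by rewrite sqr_sqrtr// ltW.
rewrite hE le_eqVlt; apply/orP; left; apply/eqP; field.
by rewrite gt_eqF.
Qed.

Lemma gauss2_taylor_le (phi : MR * MR -> R) (M K al be ka mu : R) :
  measurable_fun setT phi -> (forall z, `|phi z| <= M)%R -> (0 <= K)%R ->
  (forall d1 d2 : R, `|phi (d1, d2) - (al * d1 + be * d2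
      + ka * (d1 ^+ 2 - d2 ^+ 2) + mu * (d1 * d2))|
    <= K * (Num.sqrt h * (d1 ^+ 2 + d2 ^+ 2) +
            (d1 ^+ 4 + d2 ^+ 4) / Num.sqrt h))%R ->
  `|\int[g2]_z (phi z)%:E| <= (K * 272 * (h * Num.sqrt h))%:E.
Proof.
move=> mphi phiM K0 phiE.
have [ip p0] := gauss2_quadratic_mean0 al be ka mu.
set p := (X in EFin \o X) in ip; rewrite -/p in p0.
have iphi : g2.-integrable setT (EFin \o phi).
  apply: measurable_bounded_integrable => //.
    by rewrite [ltLHS]probability_setT ltey.
  exists M; split; first exact: num_real.
  by move=> N MN x _ /=; exact: le_trans (phiM _) (ltW MN).
have id := integrableB measurableT iphi ip.
have -> : \int[g2]_z (phi z)%:E = \int[g2]_z ((phi z)%:E - (p z)%:E).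
  by rewrite integralB// [X in _ - X]p0 sube0.
apply: le_trans (le_abse_integral _ _ _) _ => //.
  exact: measurable_int id.
apply: le_trans (gauss2_integral_le K0).
apply: ge0_le_integral => //.
- by apply: measurableT_comp => //; exact: measurable_int id.
- apply/measurable_EFinP; apply: measurable_funM => //.
  have m1 : measurable_fun setT (fst : MR * MR -> MR) by exact: measurable_fst.
  have m2 : measurable_fun setT (snd : MR * MR -> MR) by exact: measurable_snd.
  apply: measurable_funD; apply: measurable_funM => //; apply: measurable_funD;
    exact: measurable_funX.
- by move=> [d1 d2] _; rewrite -EFinB /= lee_fin; exact: phiE.
Qed.

End gauss2_moments.

(** * Optional stopping along a grid *)

Section stopped_sequence.
Context {U : Type}.
Implicit Types (G : pred U) (g : nat -> U).

Fixpoint alive G g k : bool :=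
  if k is k'.+1 then alive G g k' && G (g k) else G (g 0%N).

(** The value kept is the first one outside [G], not the last one inside. Whether step [k.+1] is
    made depends only on the values up to [k], as the independence argument requires. *)
Fixpoint stopped G g k : U :=
  if k is k'.+1 then (if alive G g k' then g k else stopped G g k') else g 0%N.

Lemma alive_stopped G g k : alive G g k -> stopped G g k = g k.
Proof. by case: k => //= k /andP[->]. Qed.

Lemma alive_in G g k : alive G g k -> G (g k).
Proof. by case: k => //= k /andP[]. Qed.

Lemma dead_stopped G g k : ~~ alive G g k ->
  exists2 n, (n <= k)%N & ~~ G (g n) /\ stopped G g k = g n.
Proof.
elim: k => [|k IH] /=; first by exists 0%N.
have [_ Gk|nak _] := boolP (alive G g k); first by exists k.+1.
by have [n nk H] := IH nak; exists n => //; exact: leq_trans nk _.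
Qed.

Lemma dead_le G g j k : ~~ alive G g j -> (j <= k)%N ->
  ~~ alive G g k /\ stopped G g k = stopped G g j.
Proof.
move=> naj; elim: k => [|k IH]; first by rewrite leqn0 => /eqP <-.
rewrite leq_eqVlt => /predU1P[<-//|/IH[/negbTE nak e]] /=.
by rewrite nak.
Qed.

Lemma stopped_exit G g k j : (j <= k)%N -> ~~ G (g j) ->
  exists2 n, (n <= j)%N & ~~ G (g n) /\ stopped G g k = g n.
Proof.
move=> jk Gj; have naj : ~~ alive G g j by apply: contra Gj; exact: alive_in.
by have [_ ->] := dead_le naj jk; exact: dead_stopped.
Qed.

End stopped_sequence.

Section first_exit.
Context {R : realType}.
Implicit Types (x y : R -> R) (a r : R).

Definition capped_disc a r : pred (R * R) :=
  fun z => (z.1 <= a) && (z.1 ^+ 2 + z.2 ^+ 2 <= r ^+ 2).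

(** [s] is the infimum of the outside times. The region is closed, so the path is still inside at
    [s] and the outside times merely accumulate there from the right; the comparison with the grid
    uses exactly this. *)
Lemma first_exit x y a r : continuous x -> continuous y ->
  x 0 = 0 -> y 0 = 0 -> 0 < a -> 0 < r ->
  (exists2 t, 0 <= t & ~~ capped_disc a r (x t, y t)) ->
  exists2 s, 0 <= s & [/\
    (forall t, 0 <= t -> t <= s -> capped_disc a r (x t, y t)),
    x s = a \/ x s ^+ 2 + y s ^+ 2 = r ^+ 2 &
    forall e, 0 < e ->
      exists t, [/\ s <= t, t < s + e & ~~ capped_disc a r (x t, y t)]].
Proof.
move=> cx cy x0 y0 a0 r0 [t0 t00 Gt0].
pose E := [set t | 0 <= t /\ ~~ capped_disc a r (x t, y t)].
have hE : has_inf E by split; [exists t0|exists 0 => t []].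
pose s := inf E.
have cn : continuous (fun t => x t ^+ 2 + y t ^+ 2).
  have -> : (fun t => x t ^+ 2 + y t ^+ 2) = (fun t => x t * x t + y t * y t).
    by apply/funext => t; rewrite !expr2.
  by move=> t; apply: cvgD; apply: cvgM; (exact: cx || exact: cy).
have Elb t : 0 <= t -> t < s -> capped_disc a r (x t, y t).
  move=> t0' ts; apply: contraPT ts => Gt; apply/negP; rewrite -leNgt.
  by apply: ge_inf; [case: hE|split].
have Enear e : 0 < e ->
    exists t, [/\ s <= t, t < s + e & ~~ capped_disc a r (x t, y t)].
  move=> e0; have [t [t0' Gt] ts] := inf_adherent e0 hE.
  by exists t; split => //; apply: ge_inf; [case: hE|split].
have s0 : 0 <= s by apply: lb_le_inf; [case: hE|move=> t []].
have near_s (P : R -> bool) : (\forall t \near s, P t) ->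
    exists2 e, 0 < e & forall t, `|s - t| < e -> P t.
  by move=> /nbhs_ballP[e /= e0 H]; exists e.
have Gs : capped_disc a r (x s, y s).
  have [s00|sn0] := eqVneq s 0.
    rewrite s00 x0 y0 /capped_disc /= expr0n/= addr0 (ltW a0)/=.
    by rewrite exprn_ge0// ltW.
  apply: contrapT => /negP; rewrite negb_and -!ltNge /= => H.
  have : \forall t \near s, ~~ capped_disc a r (x t, y t).
    case/orP: H => H.
      apply: filterS (cvgr_gt _ (cx s) _ H) => t /= at_.
      by rewrite negb_and -!ltNge at_.
    apply: filterS (cvgr_gt _ (cn s) _ H) => t /= at_.
    by rewrite negb_and -!ltNge /= at_ orbT.
  move=> /near_s[e e0 He].
  pose t := Num.max 0 (s - e / 2).
  have s0' : 0 < s by rewrite lt_def sn0.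
  have ts : t < s by rewrite gt_max s0'/=; lra.
  have : capped_disc a r (x t, y t) by apply: Elb => //; rewrite le_max lexx.
  apply/negP; apply: He; rewrite gtr0_norm ?subr_gt0//.
  have : s - e / 2 <= t by rewrite le_max lexx orbT.
  by lra.
exists s => //; split => //.
- move=> t t0'; rewrite le_eqVlt => /predU1P[->//|]; exact: Elb.
- move: (Gs) => /andP[/= xa nr].
  have [->|xna] := eqVneq (x s) a; first by left.
  right; apply/eqP; apply: contrapT => /negP nrn.
  have xlta : x s < a by rewrite lt_neqAle xna.
  have nltr : x s ^+ 2 + y s ^+ 2 < r ^+ 2 by rewrite lt_neqAle nrn.
  have : \forall t \near s, capped_disc a r (x t, y t).
    have h1 := cvgr_lt _ (cx s) _ xlta.
    have h2 := cvgr_lt _ (cn s) _ nltr.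
    near=> t; apply/andP; split; apply: ltW => /=.
      by near: t; exact: h1.
    by near: t; exact: h2.
  move=> /near_s[e e0 He].
  have [t [st te]] := Enear e e0.
  by rewrite He// distrC ger0_norm ?subr_ge0//; lra.
Unshelve. all: by end_near. Qed.

End first_exit.

Section rotation.
Context {R : realType}.
Local Notation MR := (measurableTypeR R).

Definition rotate (c s : R) (z : MR * MR) : MR * MR :=
  (c * z.1 + s * z.2, - s * z.1 + c * z.2).

Lemma rotate_normsq c s z : c ^+ 2 + s ^+ 2 = 1 ->
  (rotate c s z).1 ^+ 2 + (rotate c s z).2 ^+ 2 = z.1 ^+ 2 + z.2 ^+ 2.
Proof.
case: z => x y cs; rewrite /rotate /=; move: (x : R) (y : R) => {}x {}y.
rewrite -[RHS]mul1r -cs; ring.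
Qed.

Lemma measurable_rotate c s : measurable_fun setT (rotate c s).
Proof.
by apply: measurable_fun_pair; apply: measurable_funD; apply: measurable_funM.
Qed.

Lemma measurable_capped_disc (a r : R) :
  measurable_fun setT (capped_disc a r : MR * MR -> bool).
Proof.
have m1 : measurable_fun setT (fst : MR * MR -> MR) by exact: measurable_fst.
have m2 : measurable_fun setT (snd : MR * MR -> MR) by exact: measurable_snd.
apply: measurable_and; first exact: measurable_fun_ler.
apply: measurable_fun_ler => //.
by apply: measurable_funD; exact: measurable_funX.
Qed.

Lemma continuous_cut_inverse (A m : R) : m < A ->
  continuous (fun x : R => (A - Num.min x m)^-1).
Proof.
move=> mA.
have cmin : continuous (fun x : R => Num.min x m).
  have -> : (fun x : R => Num.min x m) = (fun x => (x + m - `|x - m|) / 2).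
    by apply/funext => y; rewrite minr_absE.
  move=> x; apply: cvgMl; apply: cvgB.
    by apply: cvgD; [exact: cvg_id|exact: cvg_cst].
  apply: cvg_norm; apply: cvgB; [exact: cvg_id|exact: cvg_cst].
move=> x; apply: cvgV; first by rewrite gt_eqF// subr_gt0 gt_min mA orbT.
by apply: cvgB; [exact: cvg_cst|exact: cmin].
Qed.

Lemma measurable_cut_angle (A b m : R) : m < A ->
  measurable_fun setT (fun z : MR * MR => cut_angle A b m z.1 z.2).
Proof.
move=> mA.
have m1 : measurable_fun setT (fst : MR * MR -> MR) by exact: measurable_fst.
have m2 : measurable_fun setT (snd : MR * MR -> MR) by exact: measurable_snd.
pose i (x : R) := (A - Num.min x m)^-1.
have ci : continuous i by exact: continuous_cut_inverse.
have mi : measurable_fun setT (fun z : MR * MR => i z.1).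
  by apply: (measurableT_comp (f := i)) => //; exact: continuous_measurable_fun.
have mat : measurable_fun setT (@atan R).
  by apply: continuous_measurable_fun => x; exact: continuous_atan.
apply: measurable_funD; apply: measurableT_comp => //; apply: measurable_funM => //.
  exact: measurable_funB.
exact: measurable_funD.
Qed.

End rotation.

Section stopped_walk.
Context {R : realType} {d : measure_display} {T : measurableType d}.
Local Notation MR := (measurableTypeR R).
Variables (P : probability T R) (X Y : R -> T -> R).
Hypothesis BM : planar_BM P X Y.
Variables (c s A b a r : R).
Hypotheses (cs1 : c ^+ 2 + s ^+ 2 = 1) (aA : a < A).

Let m := a + (A - a) / 2.
Let f (z : MR * MR) := cut_angle A b m z.1 z.2.
Let G : pred (MR * MR) := capped_disc a r.

Definition rotated_position t w := rotate c s (position X Y t w).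

Definition stopped_walk h k w :=
  stopped G (fun j => rotated_position (j%:R * h) w) k.

Let mf : measurable_fun setT f.
Proof.
apply: measurable_cut_angle.
by rewrite /m; move: aA => ?; lra.
Qed.

Let f_bound z : `|f z| <= 4.
Proof.
by have := norm_angle_lt A b (Num.min z.1 m) z.2; have := @pihalf_lt2 R;
  rewrite /f /cut_angle; lra.
Qed.

Lemma measurable_rotated_position t : measurable_fun setT (rotated_position t).
Proof.
apply: measurableT_comp; first exact: measurable_rotate.
exact: measurable_position BM _.
Qed.

Let alive_walk h k w := alive G (fun j => rotated_position (j%:R * h) w) k.

Let past_measurable_alive h k j : (j <= k)%N ->
  measurable_fun (setT : set (g_sigma_algebraType (past X Y h k)))
    (alive_walk h j : g_sigma_algebraType (past X Y h k) -> bool).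
Proof.
have mG i : (i <= k)%N ->
    measurable_fun (setT : set (g_sigma_algebraType (past X Y h k)))
      (fun w => G (rotated_position (i%:R * h) w)).
  move=> ik; apply: measurableT_comp; first exact: measurable_capped_disc.
  apply: measurableT_comp; first exact: measurable_rotate.
  exact: (past_measurable_position BM ik).
elim: j => [|j IH] jk; first exact: mG.
by apply: measurable_and; [apply: IH; exact: ltnW|exact: mG].
Qed.

Let measurable_alive h k : measurable_fun setT (alive_walk h k).
Proof.
move=> _ B mB; rewrite setTI.
apply: (past_sub_measurable BM (h := h) (k := k)).
by have := @past_measurable_alive h k k (leqnn _) measurableT B mB; rewrite setTI.
Qed.

Lemma measurable_stopped_walk h k :
  measurable_fun setT (stopped_walk h k).
Proof.
elim: k => [|k IH]; first exact: measurable_rotated_position.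
apply: measurable_fun_ifT => //; first exact: measurable_alive.
exact: measurable_rotated_position.
Qed.

Lemma rotated_position_increment h k w :
  rotated_position (k.+1%:R * h) w =
  let z := rotated_position (k%:R * h) w in
  let dz := increment X Y h k w in
  (z.1 + (c * dz.1 + s * dz.2), z.2 + (- s * dz.1 + c * dz.2)).
Proof.
rewrite /rotated_position /rotate /position /increment /=.
move: (X _ w) (X _ w) (Y _ w) (Y _ w) => x x' y y'.
by congr (_, _); ring.
Qed.

Let C := 10240 / (A - a) ^+ 3 * 272.

Lemma stopped_walk_step h k : 0 < h ->
  (`|\int[P]_w (f (stopped_walk h k.+1 w))%:E -
     \int[P]_w (f (stopped_walk h k w))%:E| <= (C * (h * Num.sqrt h))%:E)%E.
Proof.
move=> h0.
pose S w := (alive_walk h k w, position X Y (k%:R * h) w).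
have mS : measurable_fun setT S.
  apply: measurable_fun_pair; first exact: measurable_alive.
  exact: measurable_position BM _.
have mD := measurable_increment BM h k.
pose Sf : {mfun T >-> (bool * (MR * MR))%type} := mfun_Sub (mem_set mS).
pose Df : {mfun T >-> (MR * MR)%type} := mfun_Sub (mem_set mD).
pose gam : probability (MR * MR)%type R := gauss2 h.
have indep A' B' : measurable A' -> measurable B' ->
    P (Sf @^-1` A' `&` Df @^-1` B') = (P (Sf @^-1` A') * gam B')%E.
  move=> mA mB; apply: (past_increment_indep_sigma BM h0) => //.
  have mp := past_measurable_position BM (leqnn k : (k <= k)%N) (h := h).
  have ma := @past_measurable_alive h k k (leqnn _).
  by have := measurable_fun_pair ma mp measurableT mA; rewrite setTI.
(* The change of the function in one step, as a function of the state (flag and position) and the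
   increment. A true flag of the walk already implies the test on [G]; the test makes the Taylor
   bound valid at every argument, reached or not. *)
pose phi (z : (bool * (MR * MR)) * (MR * MR)) : R :=
  if z.1.1 && G (rotate c s z.1.2) then
    f ((rotate c s z.1.2).1 + (c * z.2.1 + s * z.2.2),
       (rotate c s z.1.2).2 + (- s * z.2.1 + c * z.2.2)) - f (rotate c s z.1.2)
  else 0.
have phi_bound z : `|phi z| <= 8.
  rewrite /phi; case: ifP => _; last by rewrite normr0.
  apply: le_trans (ler_normB _ _) _.
  by rewrite (_ : 8 = 4 + 4 :> R) ?lerD//; lra.
have mphi : measurable_fun setT phi.
  have m11 : measurable_fun setT
      (fun z : (bool * (MR * MR)) * (MR * MR) => z.1.1).
    exact: (measurableT_comp measurable_fst measurable_fst).
  have m12 : measurable_fun setT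
      (fun z : (bool * (MR * MR)) * (MR * MR) => z.1.2).
    exact: (measurableT_comp measurable_snd measurable_fst).
  have mr : measurable_fun setT
      (fun z : (bool * (MR * MR)) * (MR * MR) => rotate c s z.1.2).
    by apply: (measurableT_comp (measurable_rotate c s)).
  have mr1 := measurableT_comp measurable_fst mr.
  have mr2 := measurableT_comp measurable_snd mr.
  have m2 : measurable_fun setT
      (fun z : (bool * (MR * MR)) * (MR * MR) => z.2).
    exact: measurable_snd.
  have m21 := measurableT_comp measurable_fst m2.
  have m22 := measurableT_comp measurable_snd m2.
  apply: measurable_fun_ifT => //.
    apply: measurable_and => //.
    by apply: measurableT_comp mr; exact: measurable_capped_disc.
  apply: measurable_funB; last by apply: measurableT_comp mr.
  apply: (measurableT_comp mf); apply: measurable_fun_pair.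
    apply: measurable_funD => //.
    by apply: measurable_funD; apply: measurable_funM.
  apply: measurable_funD => //.
  by apply: measurable_funD; apply: measurable_funM.
have s0 : 0 < Num.sqrt h by rewrite sqrtr_gt0.
have eps0 : 0 < A - a by rewrite subr_gt0.
have C0 : 0 <= C * (h * Num.sqrt h).
  apply: mulr_ge0; last by apply: mulr_ge0; exact: ltW.
  apply: mulr_ge0; last exact: ler0n.
  by apply: divr_ge0; [exact: ler0n|apply: exprn_ge0; exact: ltW].
have phi_step z : (`|\int[gam]_x (phi (z, x))%:E| <= (C * (h * Num.sqrt h))%:E)%E.
  case: z => bz z.
  have [Gz|nGz] := boolP (bz && G (rotate c s z)); last first.
    rewrite integral0_eq ?abse0 ?lee_fin//.
    by move=> x _; rewrite /phi /= (negbTE nGz).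
  have /andP[_ /andP[zx _]] := Gz.
  have [al [be [ka [mu H]]]] := cut_angle_taylor2 b (rotate c s z).2 aA zx cs1.
  apply: (gauss2_taylor_le h0 (M := 8) (al := al) (be := be) (ka := ka) (mu := mu)).
  - apply: (measurableT_comp mphi).
    by apply: measurable_fun_pair => //.
  - by move=> x; exact: phi_bound.
  - by apply: divr_ge0; [exact: ler0n|apply: exprn_ge0; exact: ltW].
  - move=> d1 d2; rewrite /phi /= Gz.
    exact: H.
have iS j : P.-integrable setT (fun w => (f (stopped_walk h j w))%:E).
  apply: (measurable_bounded_integrable (f := f \o stopped_walk h j)) => //.
  - by rewrite [ltLHS]probability_setT ltey.
  - by apply: measurableT_comp mf _; exact: measurable_stopped_walk.
  - exists 4; split; first exact: num_real.
    by move=> N MN x _ /=; exact: le_trans (f_bound _) (ltW MN).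
have phiE w : phi (Sf w, Df w) =
    f (stopped_walk h k.+1 w) - f (stopped_walk h k w).
  rewrite /phi /stopped_walk /= -/(alive_walk h k w).
  have [ak|nak] := boolP (alive_walk h k w); last by rewrite subrr.
  have Gk : G (rotate c s (position X Y (k%:R * h) w)) by exact: (alive_in ak).
  by rewrite Gk /= rotated_position_increment alive_stopped.
rewrite -integralB//.
apply: le_trans (normr_expectation_indep_le indep mphi phi_bound phi_step).
rewrite le_eqVlt; apply/orP; left; apply/eqP; congr (`|_|)%E.
by apply: eq_integral => w _; rewrite phiE EFinB.
Qed.

Lemma stopped_walk_expectation h k : 0 < h ->
  (`|\int[P]_w (f (stopped_walk h k w))%:E - (f (0, 0))%:E|
    <= (k%:R * (C * (h * Num.sqrt h)))%:E)%E.
Proof.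
move=> h0.
have fin j : (\int[P]_w (f (stopped_walk h j w))%:E)%E \is a fin_num.
  apply: integrable_fin_num => //.
  apply: (measurable_bounded_integrable (f := f \o stopped_walk h j)) => //.
  - by rewrite [ltLHS]probability_setT ltey.
  - by apply: measurableT_comp mf _; exact: measurable_stopped_walk.
  - exists 4; split; first exact: num_real.
    by move=> N MN x _ /=; exact: le_trans (f_bound _) (ltW MN).
elim: k => [|k IH].
  rewrite mul0r (eq_integral (cst (f (0, 0))%:E)); last first.
    move=> w _; rewrite /stopped_walk /= /rotated_position /rotate /position /=.
    by rewrite mul0r; have [W0 _ _ _] := BM; have [-> ->] := W0 w; rewrite !mulr0 addr0.
  by rewrite integral_cst//= probability_setT mule1 subee// abse0.
have := leeD (stopped_walk_step k h0) IH.
rewrite -(fineK (fin k)) -(fineK (fin k.+1)) -!EFinB !abse_EFin -!EFinD !lee_fin.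
move=> H; apply: le_trans (le_trans _ H) _.
  by rewrite -[X in `|X| <= _](subrKA (fine (\int[P]_w (f (stopped_walk h k w))%:E)%E)) ler_normD.
by rewrite -natr1 mulrDl mul1r addrC.
Qed.

End stopped_walk.

Section stopped_grid.
Context {R : realType}.

Lemma continuous_cut_angle (A b m : R) (x y : R -> R) : m < A ->
  continuous x -> continuous y ->
  continuous (fun t => cut_angle A b m (x t) (y t)).
Proof.
move=> mA cx cy t.
have ci : {for t, continuous (fun t => (A - Num.min (x t) m)^-1)}.
  apply: (@continuous_comp _ _ _ x (fun x : R => (A - Num.min x m)^-1)).
    exact: cx.
  exact: continuous_cut_inverse.
apply: cvgD.
  apply: (@continuous_comp _ _ _
    (fun t => (b - y t) / (A - Num.min (x t) m)) atan); last exact: continuous_atan.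
  by apply: cvgM; [apply: cvgB; [exact: cvg_cst|exact: cy]|exact: ci].
apply: (@continuous_comp _ _ _
  (fun t => (b + y t) / (A - Num.min (x t) m)) atan); last exact: continuous_atan.
by apply: cvgM; [apply: cvgD; [exact: cvg_cst|exact: cy]|exact: ci].
Qed.

(** A step of mesh [16^-n] costs a multiple of [64^-n]; the [32^n] steps leading to time [2^n] cost
    [2^-n] in all, while the horizon still tends to infinity. *)
Definition mesh (n : nat) : R := 16^-1 ^+ n.
Definition horizon (n : nat) : nat := 32 ^ n.

Lemma mesh_gt0 n : 0 < mesh n. Proof. by rewrite exprn_gt0. Qed.

Lemma horizon_mesh n : (horizon n)%:R * mesh n = 2 ^+ n.
Proof.
by rewrite /horizon /mesh natrX -exprMn; congr (_ ^+ _); field.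
Qed.

Lemma mesh_error n :
  (horizon n)%:R * (mesh n * Num.sqrt (mesh n)) = 2^-1 ^+ n.
Proof.
have -> : Num.sqrt (mesh n) = 4^-1 ^+ n.
  have -> : mesh n = (4^-1 ^+ n) ^+ 2.
    by rewrite /mesh exprAC; congr (_ ^+ _); field.
  by rewrite sqrtr_sqr ger0_norm// exprn_ge0.
by rewrite mulrA horizon_mesh -exprMn; congr (_ ^+ _); field.
Qed.

(** The outside of a closed region is open, so an outside time shortly after [s] has a whole
    neighbourhood of them, and every fine grid has a point in it. The grid walk has stopped by then,
    and it cannot stop before [s]. *)
Lemma stopped_grid_time (a r s : R) (g : R -> R * R) :
  continuous (fst \o g) -> continuous (snd \o g) ->
  0 <= s -> (forall t, 0 <= t -> t <= s -> capped_disc a r (g t)) ->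
  (forall e, 0 < e ->
     exists t, [/\ s <= t, t < s + e & ~~ capped_disc a r (g t)]) ->
  forall e, 0 < e -> \forall n \near \oo, exists t,
    [/\ s <= t, t < s + e &
     stopped (capped_disc a r) (fun j => g (j%:R * mesh n)) (horizon n) = g t].
Proof.
move=> cx cy s0 inG outG e e0.
have [t [st te Gt]] := outG _ e0.
have t0 : 0 <= t by exact: le_trans st.
have cn : continuous (fun t => (g t).1 ^+ 2 + (g t).2 ^+ 2).
  have -> : (fun t => (g t).1 ^+ 2 + (g t).2 ^+ 2) =
      (fun t => (fst \o g) t * (fst \o g) t + (snd \o g) t * (snd \o g) t).
    by apply/funext => u; rewrite !expr2.
  by move=> u; apply: cvgD; apply: cvgM; (exact: cx || exact: cy).
have nearG : \forall u \near t, ~~ capped_disc a r (g u).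
  move: Gt; rewrite negb_and -!ltNge => /orP[] H.
    apply: filterS (cvgr_gt _ (cx t) _ H) => u /= ua.
    by rewrite negb_and -!ltNge ua.
  apply: filterS (cvgr_gt _ (cn t) _ H) => u /= ua.
  by rewrite negb_and -!ltNge ua orbT.
have [del /= del0 Hdel] := (nbhs_ballP _ _).1 nearG.
pose del' := Num.min del (s + e - t).
have del'0 : 0 < del' by rewrite lt_min del0 subr_gt0.
have mesh0 : mesh n @[n --> \oo] --> 0.
  by apply: cvg_expr; rewrite ger0_norm// invf_lt1// ltr1n.
have two_gt n : n%:R < 2 ^+ n :> R by rewrite -natrX ltr_nat ltn_expl.
near=> n.
have hn : mesh n < del' by near: n; exact: cvgr_lt mesh0 _ del'0.
have Kn : s + e < n%:R by near: n; exact: nbhs_infty_gtr.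
have h0 := mesh_gt0 n.
have th0 : 0 <= t / mesh n by rewrite divr_ge0// ltW.
pose j := (Num.truncn (t / mesh n)).+1.
have /andP[jl jr] := truncn_itv th0.
have tj : t < j%:R * mesh n by rewrite -ltr_pdivrMr.
have jt : j%:R * mesh n <= t + mesh n.
  rewrite /j -natr1 mulrDl mul1r lerD2r.
  by rewrite -ler_pdivlMr.
have hn1 : mesh n < del by move: hn; rewrite lt_min => /andP[].
have hn2 : mesh n < s + e - t by move: hn; rewrite lt_min => /andP[].
have Gj : ~~ capped_disc a r (g (j%:R * mesh n)).
  apply: Hdel; rewrite /ball/= distrC ger0_norm; first lra.
  by rewrite subr_ge0 ltW.
have jK : (j <= horizon n)%N.
  rewrite -(ler_nat R) -(ler_pM2r h0) horizon_mesh.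
  by have := two_gt n; lra.
have [i ij [Gi ->]] := stopped_exit (g := fun j => g (j%:R * mesh n)) jK Gj.
exists (i%:R * mesh n); split => //.
  rewrite leNgt; apply: contra Gi => si; apply: inG; last exact: ltW.
  by rewrite mulr_ge0// ltW.
have : i%:R * mesh n <= j%:R * mesh n by rewrite ler_pM2r// ler_nat.
by lra.
Unshelve. all: by end_near. Qed.

End stopped_grid.

Section exit_angle.
Context {R : realType} {d : measure_display} {T : measurableType d}.
Local Notation MR := (measurableTypeR R).
Variables (P : probability T R) (X Y : R -> T -> R).
Hypothesis BM : planar_BM P X Y.

(** A countable condition, hence measurable, and an almost sure one; it forces the path out of every
    disc of radius at most 1 about the origin, in any rotated frame. *)
Definition leaves_disc := [set w | exists n : nat, 1 < X n%:R w ^+ 2].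

Lemma measurable_leaves_disc : measurable leaves_disc.
Proof.
rewrite (_ : leaves_disc = \bigcup_n [set w | 1 < X n%:R w ^+ 2]); last first.
  by apply/seteqP; split => w [n]; [exists n|move=> _; exists n].
apply: bigcupT_measurable => n.
have [_ _ mXY _] := BM; have [mX _] := mXY n%:R.
rewrite -[X in measurable X]setTI.
have : measurable_fun setT (fun w => 1 < X n%:R w ^+ 2).
  by apply: measurable_fun_ltr => //; exact: measurable_funX.
by move=> /(_ measurableT [set true]); apply.
Qed.

Lemma BM_increment_law (u v : R) (C : set R) : 0 <= u -> u < v -> measurable C ->
  P [set w | C (X v w - X u w)] = normal_prob 0 (Num.sqrt (v - u)) C.
Proof.
move=> u0 uv mC; have [_ _ _ fdd] := BM.
have := fdd 1%N (fun i => if i == 0%N then u else v) (fun=> C) (fun=> setT).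
rewrite big_nat1 /= probability_setT mule1 => <- //; last first.
  by move=> i; rewrite ltnS leqn0 => /eqP ->.
congr (P _); apply/seteqP; split => w /=.
  by move=> Cw i; rewrite /= ltnS leqn0 => /eqP ->.
by move=> /(_ 0%N); case.
Qed.

(** The density of [X n] is at most its peak, of order [1 / sqrt n], so the probability that [X n]
    lies in [[-1, 1]] tends to 0. *)
Lemma leaves_disc_as : P (~` leaves_disc) = 0%E.
Proof.
have [W0 _ mXY _] := BM.
apply/eqP; rewrite eq_le measure_ge0 andbT.
have bound (n : nat) : (P (~` leaves_disc) <=
    (2 * normal_peak (Num.sqrt n.+1%:R))%:E)%E.
  have n0 : (0 : R) < n.+1%:R by [].
  have s0 : Num.sqrt n.+1%:R != 0 :> R by rewrite gt_eqF// sqrtr_gt0.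
  apply: (@le_trans _ _ (P [set w | `[(-1)%R, 1%R]%classic (X n.+1%:R w - X 0 w)])).
    apply: le_measure; rewrite ?inE.
    - by apply: measurableC; exact: measurable_leaves_disc.
    - rewrite -[X in measurable X]setTI.
      have : measurable_fun setT (fun w => X n.+1%:R w - X 0 w).
        by apply: measurable_funB; [have [] := mXY n.+1%:R|have [] := mXY 0].
      by move=> /(_ measurableT `[(-1)%R, 1%R]%classic); apply.
    - move=> w /= nL; have [-> _] := W0 w; rewrite subr0 in_itv/= -ler_norml.
      rewrite leNgt; apply/negP => H; apply: nL; exists n.+1.
      by rewrite -real_normK ?num_real// exprn_egt1.
  rewrite BM_increment_law// subr0 /normal_prob.
  apply: (@le_trans _ _ (\int[lebesgue_measure]_(x in `[(-1)%R, 1%R])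
      (normal_peak (Num.sqrt n.+1%:R))%:E)%E).
    apply: ge0_le_integral => //.
    - by move=> x _; rewrite lee_fin normal_pdf_ge0.
    - apply/measurable_EFinP; apply: measurable_funTS.
      exact: measurable_normal_pdf.
    - by move=> x _; rewrite lee_fin normal_pdf_ub.
  rewrite integral_cst//= lebesgue_measure_itv/= lte_fin.
  rewrite ifT; last lra.
  by rewrite -EFinB -EFinM lee_fin opprK mulrC.
apply/lee_addgt0Pr => e e0; rewrite add0e.
have [n Hn] : exists n : nat, 4 / e ^+ 2 < n.+1%:R.
  by exists (Num.truncn (4 / e ^+ 2)); exact: truncnS_gt.
apply: le_trans (bound n) _; rewrite lee_fin /normal_peak.
have n0 : (0 : R) < n.+1%:R by [].
rewrite sqr_sqrtr ?(ltW n0)//.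
have e2 : 0 < 2 / e by rewrite divr_gt0.
have H1 : 2 / e <= Num.sqrt (n.+1%:R * pi *+ 2).
  rewrite -[leLHS]ger0_norm ?(ltW e2)// -sqrtr_sqr ler_wsqrtr//.
  rewrite expr_div_n (_ : 2 ^+ 2 = 4); last by ring.
  apply: le_trans (ltW Hn) _; have := @pi_ge2 R.
  by move: (n.+1%:R : R) (pi : R) n0 => z p z0 p2; nra.
rewrite ler_pdivrMr; last exact: lt_le_trans H1.
by rewrite -ler_pdivrMl// mulrC.
Qed.

Variables (c s A b a r : R).
Hypotheses (cs1 : c ^+ 2 + s ^+ 2 = 1) (aA : a < A) (a0 : 0 < a).
Hypotheses (r0 : 0 < r) (r1 : r <= 1).

Let m := a + (A - a) / 2.
Let f (z : MR * MR) : R := cut_angle A b m z.1 z.2.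
Let g := rotated_position X Y c s.
Let Z n w := stopped_walk X Y c s a r (mesh n) (horizon n) w.

(** The upper limit is measurable with no appeal to the exit point; on [leaves_disc] the sequence
    converges and the value is the angle at the exit point. *)
Definition limit_angle w : \bar R := limn_esup (fun n => (f (Z n w))%:E).

Let mA : m < A. Proof. by rewrite /m; move: aA => ?; lra. Qed.

Let f_bound z : `|f z| <= 4.
Proof.
by have := norm_angle_lt A b (Num.min z.1 m) z.2; have := @pihalf_lt2 R;
  rewrite /f /cut_angle; lra.
Qed.

Let mfZ n : measurable_fun setT (fun w => (f (Z n w))%:E).
Proof.
apply/measurable_EFinP; apply: measurableT_comp.
  exact: measurable_cut_angle mA.
exact: measurable_stopped_walk BM _ _ _ _ _ _.
Qed.

Let continuous_g w : continuous (fun t => (g t w).1) /\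
                     continuous (fun t => (g t w).2).
Proof.
have [_ cXY _ _] := BM; have [cX cY] := cXY w.
by split => t; apply: cvgD; apply: cvgM;
  by [exact: cvg_cst | exact: cX | exact: cY].
Qed.

Let limit_angle_exit w : leaves_disc w -> exists2 t, 0 <= t & [/\
  (forall u, 0 <= u -> u <= t -> capped_disc a r (g u w)),
  (g t w).1 = a \/ (g t w).1 ^+ 2 + (g t w).2 ^+ 2 = r ^+ 2,
  (f (Z n w))%:E @[n --> \oo] --> (f (g t w))%:E &
  f (g t w) = angle A b (g t w).1 (g t w).2].
Proof.
move=> [n Xn]; have [cx cy] := continuous_g w.
have [W0 _ _ _] := BM; have [X0 Y0] := W0 w.
have g10 : (g 0 w).1 = 0.
  by rewrite /g /rotated_position /rotate /position /= X0 Y0 !mulr0 addr0.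
have g20 : (g 0 w).2 = 0.
  by rewrite /g /rotated_position /rotate /position /= X0 Y0 !mulr0 addr0.
have [|t t0 [inG onG outG]] :=
    @first_exit R (fun t => (g t w).1) (fun t => (g t w).2) a r cx cy g10 g20 a0 r0.
  exists n%:R => //; rewrite negb_and; apply/orP; right; rewrite -ltNge /=.
  have /= -> := rotate_normsq (position X Y n%:R w) cs1.
  apply: (@le_lt_trans _ _ 1); first by rewrite expr_le1// ltW.
  by apply: lt_le_trans Xn _; rewrite lerDl sqr_ge0.
exists t => //; split.
- by move=> u u0 ut; have := inG u u0 ut; rewrite -surjective_pairing.
- exact: onG.
- apply: cvg_EFin; first by near=> k.
  have cf := @continuous_cut_angle R A b m _ _ mA cx cy.
  apply/cvgrPdist_lt => e e0.
  have near_t : \forall u \near t, `|f (g t w) - f (g u w)| < e.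
    by have /cvgrPdist_lt/(_ _ e0) := cf t.
  have [del /= del0 Hdel] := (nbhs_ballP _ _).1 near_t.
  have outG' : forall e, 0 < e ->
     exists u, [/\ t <= u, u < t + e & ~~ capped_disc a r (g u w)].
    by move=> e' /outG[u [? ? ?]]; exists u; split => //; rewrite (surjective_pairing (g u w)).
  have inG' : forall u, 0 <= u -> u <= t -> capped_disc a r (g u w).
    by move=> u u0 ut; have := inG u u0 ut; rewrite -surjective_pairing.
  have := stopped_grid_time cx cy t0 inG' outG' del0.
  apply: filterS => k [u [tu ud E]].
  rewrite /= /Z /stopped_walk E; apply: Hdel.
  by rewrite /ball/= distrC ger0_norm ?subr_ge0//; lra.
- have := inG t t0 (lexx _) => /andP[/= xa _].
  rewrite /f /cut_angle; congr angle; apply/min_idPl.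
  by apply: le_trans xa _; rewrite /m; move: aA => ?; lra.
Unshelve. all: by end_near. Qed.

Lemma measurable_limit_angle : measurable_fun setT limit_angle.
Proof. exact: measurable_fun_limn_esup. Qed.

Lemma limit_angleP w : leaves_disc w -> exists2 t, 0 <= t & [/\
  (forall u, 0 <= u -> u <= t -> capped_disc a r (g u w)),
  (g t w).1 = a \/ (g t w).1 ^+ 2 + (g t w).2 ^+ 2 = r ^+ 2 &
  limit_angle w = (angle A b (g t w).1 (g t w).2)%:E].
Proof.
move=> /limit_angle_exit[t t0 [inG onG cf fE]]; exists t => //; split => //.
by rewrite /limit_angle (cvg_limn_einf_sup cf).2 fE.
Qed.

(** The means along the grids have two limits: the mean of [limit_angle], by domination by the
    constant 4, and the value at the origin, since the accumulated error is a multiple of [2^-n]. *)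
Lemma integral_limit_angle : P.-integrable setT limit_angle /\
  (\int[P]_w limit_angle w = (angle A b 0 0)%:E)%E.
Proof.
have i4 : P.-integrable setT (cst (4 : R)%:E).
  exact: finite_measure_integrable_cst.
have [] := @dominated_convergence _ _ R P setT measurableT
  (fun n w => (f (Z n w))%:E) limit_angle (cst (4 : R)%:E) mfZ
  measurable_limit_angle _ i4 _.
- exists (~` leaves_disc); split.
  + by apply: measurableC; exact: measurable_leaves_disc.
  + exact: leaves_disc_as.
  + move=> w; apply: contra_not => Lw _.
    have [t t0 [_ _ cf _]] := limit_angle_exit Lw.
    by rewrite /limit_angle (cvg_limn_einf_sup cf).2.
- by apply/aeW => w n _; rewrite /= lee_fin f_bound.
- move=> iL _ cI; split => //.
have E0 : (f (0, 0))%:E = (angle A b 0 0)%:E.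
  rewrite /f /cut_angle /=; congr (angle _ _ _ _)%:E; apply/min_idPl.
  by rewrite /m; move: aA a0 => ? ?; lra.
rewrite -E0; apply/esym; apply: (cvg_unique _ _ cI) => //.
pose I n := (\int[P]_w (f (Z n w))%:E)%E.
have Ifin n : I n \is a fin_num.
  apply: integrable_fin_num => //; apply: le_integrable i4 => //.
  by move=> w _; rewrite /= lee_fin [leRHS]ger0_norm.
pose C := 10240 / (A - a) ^+ 3 * 272.
have IC n : `|fine (I n) - f (0, 0)| <= C * 2^-1 ^+ n.
  have := stopped_walk_expectation BM b r cs1 aA (horizon n) (mesh_gt0 n).
  rewrite -/m -/(f (0, 0)) -/(I n) -(fineK (Ifin n)) -EFinB abse_EFin lee_fin.
  by rewrite -[_ * (10240 / _ * _ * _)]mulrCA mesh_error.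
apply: cvg_EFin; first by near=> n; exact: Ifin.
apply/cvgrPdist_lt => e e0.
have : C * 2^-1 ^+ n @[n --> \oo] --> 0.
  rewrite -[X in _ --> X](mulr0 C); apply: cvgMr.
  by apply: cvg_expr; rewrite ger0_norm// invf_lt1// ltr1n.
move=> /cvgr_lt /(_ _ e0); apply: filterS => n.
by apply: le_lt_trans; rewrite distrC /=; exact: IC.
Unshelve. all: by end_near. Qed.

End exit_angle.

(** * Law of the maximal displacement *)

Section angle_values.
Context {R : realType}.
Implicit Types (A b x y : R).

(** Inscribed angles: the circle about the origin through the ends of the segment has squared radius
    [A ^+ 2 + b ^+ 2], and a point inside it sees the segment under a larger angle than its arc
    does. Tangents can be compared only for an acute angle, that is outside the circle having the
    segment as diameter; inside that one the angle is at least [pi / 2]. *)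
Lemma angle_ge A b x y : 0 < A -> 0 < b -> x < A ->
  x ^+ 2 + y ^+ 2 <= A ^+ 2 + b ^+ 2 -> atan (b / A) <= angle A b x y.
Proof.
move=> A0 b0 xA xy; rewrite /angle.
have p0 : 0 < A - x by rewrite subr_gt0.
set t1 := (b - y) / (A - x); set t2 := (b + y) / (A - x).
have tD : t1 + t2 = 2 * b / (A - x) by rewrite /t1 /t2; field; rewrite gt_eqF.
have tM : 1 - t1 * t2 = ((A - x) ^+ 2 + y ^+ 2 - b ^+ 2) / (A - x) ^+ 2.
  by rewrite /t1 /t2; field; rewrite gt_eqF.
have [D0|D0] := ltP 0 ((A - x) ^+ 2 + y ^+ 2 - b ^+ 2).
  have t12 : t1 * t2 < 1 by rewrite -subr_gt0 tM divr_gt0// exprn_gt0.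
  rewrite atanD// le_atan// tD tM.
  have -> : 2 * b / (A - x) / (((A - x) ^+ 2 + y ^+ 2 - b ^+ 2) / (A - x) ^+ 2) =
     2 * b * (A - x) / ((A - x) ^+ 2 + y ^+ 2 - b ^+ 2).
    by field; rewrite !gt_eqF.
  rewrite ler_pdivrMr// mulrAC ler_pdivlMr//.
  have : (A - x) ^+ 2 + y ^+ 2 - b ^+ 2 <= 2 * A * (A - x) by nra.
  by move=> H; have := ler_wpM2l (ltW b0) H; lra.
apply: ltW; apply: (lt_le_trans (atan_ltpi2 _)).
have c1 := cos_atan_gt0 t1; have c2 := cos_atan_gt0 t2.
have sn : 0 < sin (atan t1 + atan t2).
  rewrite sin_atanD tD; apply: mulr_gt0; last exact: mulr_gt0.
  by apply: divr_gt0 => //; exact: mulr_gt0.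
have cs : cos (atan t1 + atan t2) <= 0.
  rewrite cos_atanD tM; apply: mulr_le0_ge0.
    by apply: mulr_le0_ge0 => //; rewrite invr_ge0 exprn_ge0// ltW.
  by rewrite mulr_ge0 ?ltW.
have := norm_atanD t1 t2; rewrite ltr_norml => /andP[].
set th := _ + _ in sn cs * => thl thr.
rewrite leNgt; apply/negP => thpi.
have th0 : 0 < th.
  rewrite ltNge; apply/negP => th0.
  suff : 0 <= sin (- th) by rewrite sinN oppr_ge0 leNgt sn.
  by apply: sin_ge0_pi; rewrite oppr_ge0 th0/= lerNl ltW.
suff : 0 < cos th by rewrite ltNge cs.
apply: cos_gt0_pihalf; rewrite thpi andbT.
by apply: lt_trans th0; rewrite oppr_lt0 divr_gt0// pi_gt0.
Qed.

Lemma angle_circle A b x y : 0 < A -> x < A ->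
  x ^+ 2 + y ^+ 2 = A ^+ 2 + b ^+ 2 -> angle A b x y = atan (b / A).
Proof.
move=> A0 xA xy; rewrite /angle.
have p0 : 0 < A - x by rewrite subr_gt0.
set t1 := (b - y) / (A - x); set t2 := (b + y) / (A - x).
have tD : t1 + t2 = 2 * b / (A - x) by rewrite /t1 /t2; field; rewrite gt_eqF.
have tM : 1 - t1 * t2 = 2 * A / (A - x).
  have -> : 1 - t1 * t2 = (x ^+ 2 + y ^+ 2 + A ^+ 2 - b ^+ 2 - 2 * A * x) / (A - x) ^+ 2.
    by rewrite /t1 /t2; field; rewrite gt_eqF.
  by rewrite xy; field; rewrite gt_eqF.
have t12 : t1 * t2 < 1 by rewrite -subr_gt0 tM divr_gt0// mulr_gt0.
rewrite atanD// tD tM; congr atan; field.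
by rewrite !gt_eqF.
Qed.

Lemma angle00 A b : angle A b 0 0 = 2 * atan (b / A).
Proof. by rewrite /angle !subr0 addr0 mulr2n mulrDl mul1r. Qed.

Lemma angle_chord_ge A b x y (e : R) : 0 < e -> x < A ->
  e * (A - x) <= b - y -> e * (A - x) <= b + y -> 2 * atan e <= angle A b x y.
Proof.
move=> e0 xA h1 h2; rewrite /angle [2 * _]mulrDl mul1r.
by apply: lerD; apply: le_atan; rewrite ler_pdivlMr// subr_gt0.
Qed.

Lemma acos_atan (k : R) : 0 < k -> k <= 1 -> atan (Num.sqrt (1 - k ^+ 2) / k) = acos k.
Proof.
move=> k0 k1; set u := _ / k.
have kk : k ^+ 2 <= 1 by rewrite expr_le1// ltW.
have u0 : 0 <= u by rewrite divr_ge0 ?sqrtr_ge0// ltW.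
have -> : k = cos (atan u).
  rewrite cos_atan /u expr_div_n sqr_sqrtr ?subr_ge0//.
  have -> : 1 + (1 - k ^+ 2) / k ^+ 2 = (k^-1) ^+ 2 by field; rewrite gt_eqF.
  by rewrite sqrtr_sqr ger0_norm ?invrK// invr_ge0 ltW.
rewrite cosK// in_itv/=; apply/andP; split.
  by rewrite -(@atan0 R); exact: le_atan.
apply: (@le_trans _ _ (pi / 2)); first exact/ltW/atan_ltpi2.
by rewrite ler_pdivrMr// ler_peMr ?pi_ge0// ler1n.
Qed.

Lemma asin_acos x : -1 <= x <= 1 -> asin x = pi / 2 - acos x.
Proof.
move=> x1; have /andP[xl xr] := x1.
have h0 := acos_ge0 x1; have hp := acos_lepi x1.
have -> : x = sin (pi / 2 - acos x).
  by rewrite -cosBpihalf addrAC subrr sub0r cosN acosK// in_itv.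
have -> : acos (sin (pi / 2 - acos x)) = acos x.
  by rewrite -cosBpihalf addrAC subrr sub0r cosN acosK// in_itv.
by rewrite sinK// in_itv/=; apply/andP; split; lra.
Qed.

End angle_values.

(** * Properties of the paths and measurability of the maximum *)

Lemma near_ball (R : realType) (t : R) (Q : set R) : nbhs t Q ->
  exists2 e, 0 < e & forall u, `|t - u| < e -> Q u.
Proof. by move=> /nbhs_ballP[e /= e0 He]; exists e. Qed.

Section paths.
Context {R : realType} {d : measure_display} {T : measurableType d}.
Variables (X Y : R -> T -> R).
Hypothesis W0 : forall w, X 0 w = 0 /\ Y 0 w = 0.
Hypothesis cW : forall w, continuous (fun t => X t w) /\ continuous (fun t => Y t w).
Hypothesis mW : forall t, measurable_fun setT (X t) /\ measurable_fun setT (Y t).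

Let nsq t w := X t w ^+ 2 + Y t w ^+ 2.

Let cnsq w : continuous (fun t => nsq t w).
Proof.
have [cx cy] := cW w.
have -> : (fun t => nsq t w) = (fun t => X t w * X t w + Y t w * Y t w).
  by apply/funext => t; rewrite /nsq !expr2.
by move=> t; apply: cvgD; apply: cvgM; (exact: cx || exact: cy).
Qed.

Lemma uptoP w t : upto X Y w t <->
  0 <= t /\ forall u, 0 <= u -> u < t -> X u w ^+ 2 + Y u w ^+ 2 < 1.
Proof.
split=> [[t0 tE]|[t0 H]]; split => //.
  move=> u u0 ut; rewrite ltNge; apply/negP => nu.
  have : (exit_time X Y w <= u%:E)%E by apply: ereal_inf_lbound; exists u.
  by move=> /(le_trans tE); rewrite lee_fin leNgt ut.
apply: le_ereal_inf_tmp => _ [u [u0 nu] <-]; rewrite lee_fin leNgt.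
by apply/negP => /(H u u0); rewrite ltNge nu.
Qed.

Lemma upto0 w : upto X Y w 0.
Proof. by apply/uptoP; split => // u u0; rewrite ltNge u0. Qed.

Lemma continuous_le_left (f : R -> R) (t M : R) : continuous f -> 0 < t ->
  (forall u, 0 <= u -> u < t -> f u <= M) -> f t <= M.
Proof.
move=> cf t0 H; rewrite leNgt; apply/negP => Mt.
have [e e0 He] := near_ball (cvgr_gt _ (cf t) _ Mt).
pose u := Num.max 0 (t - e / 2).
have ut : u < t by rewrite gt_max t0/= ltrBlDr ltrDl divr_gt0.
have u0 : 0 <= u by rewrite le_max lexx.
have : t - e / 2 <= u by rewrite le_max lexx orbT.
move=> tu; have : M < f u by apply: He; rewrite gtr0_norm ?subr_gt0//; lra.
by rewrite ltNge H.
Qed.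

Lemma upto_norm w t : upto X Y w t -> X t w ^+ 2 + Y t w ^+ 2 <= 1.
Proof.
move=> /uptoP[t0 H]; move: t0; rewrite le_eqVlt => /predU1P[<-|t0].
  by have [-> ->] := W0 w; rewrite expr0n addr0.
apply: (@continuous_le_left (fun t => nsq t w)) => // u u0 ut.
by apply: ltW; exact: H.
Qed.

Lemma max_horiz_ge0 w : (0 <= max_horiz X Y w)%E.
Proof.
apply: ereal_sup_ubound; exists 0; first exact: upto0.
by have [-> _] := W0 w.
Qed.

Lemma max_horiz_le1 w : (max_horiz X Y w <= 1)%E.
Proof.
apply: ge_ereal_sup => _ [t /upto_norm nt <-]; rewrite lee_fin.
have : 0 <= Y t w ^+ 2 by exact: sqr_ge0.
by nra.
Qed.

Lemma upto_le_max_horiz w t : upto X Y w t -> ((X t w)%:E <= max_horiz X Y w)%E.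
Proof. by move=> ut; apply: ereal_sup_ubound; exists t. Qed.

Lemma max_horiz_gtP (a : R) w : (a%:E < max_horiz X Y w)%E <->
  exists2 t, upto X Y w t & a < X t w.
Proof.
split; first by move=> /ereal_sup_gt[_ [t ut <-]]; rewrite lte_fin => aX; exists t.
by move=> [t ut aX]; apply: lt_le_trans (upto_le_max_horiz ut); rewrite lte_fin.
Qed.

Let ratgt (a : R) (q : rat) : set T := [set w | a < X (ratr q) w].

(** A strict bound on a compact time interval amounts to a bound by [1 - 1 / n.+1] for some [n];
    being nonstrict, the latter may be tested at rational times and extends to all times by
    continuity. *)
Let stays (n : nat) (q : rat) : set T :=
  ~` \bigcup_(p : rat) (if 0 <= (ratr p : R) <= ratr q then
      [set w | 1 - n.+1%:R^-1 < nsq (ratr p) w] else set0).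

Let staysP n q w : stays n q w <-> forall p : rat, 0 <= (ratr p : R) <= ratr q ->
  nsq (ratr p) w <= 1 - n.+1%:R^-1.
Proof.
split=> [H p pq|H [p _]].
  by rewrite leNgt; apply/negP => Hp; apply: H; exists p => //; rewrite pq.
by case: ifP => // pq /=; rewrite ltNge H.
Qed.

Let max_horiz_gt_rat (a : R) w : 0 <= a -> (a%:E < max_horiz X Y w)%E <->
  (\bigcup_(q : rat) \bigcup_n
     (if 0 <= (ratr q : R) then ratgt a q `&` stays n q else set0)) w.
Proof.
move=> a0; split.
- move=> /max_horiz_gtP[t /uptoP[t0 H] aX].
  have {}t0 : 0 < t.
    by rewrite lt_def t0 andbT; apply: contraTneq aX => ->; rewrite (W0 w).1 -leNgt.
  have [e e0 He] := near_ball (cvgr_gt _ ((cW w).1 t) _ aX).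
  (* [t] may be the exit time itself, with norm 1; a rational time strictly before it keeps the norm
     below 1 on a closed interval. *)
  pose t' := Num.max 0 (t - e).
  have t't : t' < t by rewrite gt_max t0/= ltrBlDr ltrDl.
  have [q] := rat_in_itvoo t't; rewrite in_itv/= gt_max => /andP[/andP[q0 qe] qt].
  have [|k] := @EVT_max R (fun t => nsq t w) 0 (ratr q) (ltW q0).
    exact: continuous_subspaceT.
  rewrite in_itv/= => /andP[k0 kq] Hk.
  have k1 : nsq k w < 1 by apply: H => //; exact: le_lt_trans qt.
  have [n Hn] : exists n : nat, (1 - nsq k w)^-1 < n.+1%:R.
    by exists (Num.truncn (1 - nsq k w)^-1); exact: truncnS_gt.
  exists q => //; exists n => //; rewrite (ltW q0); split.
    by apply: He; rewrite gtr0_norm ?subr_gt0//; lra.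
  apply/staysP => p /andP[p0 pq].
  apply: (@le_trans _ _ (nsq k w)).
    by apply: Hk; rewrite in_itv/= p0.
  have : n.+1%:R^-1 <= 1 - nsq k w.
    rewrite -[leRHS]invrK lef_pV2 ?posrE ?invr_gt0 ?subr_gt0//; exact: ltW.
  by rewrite lerBrDr addrC -lerBrDr.
- move=> [q _ [n _]]; case: ifP => // q0 [aX /staysP Hs].
  apply/max_horiz_gtP; exists (ratr q) => //; apply/uptoP; split => // u u0 uq.
  apply: (@le_lt_trans _ _ (1 - n.+1%:R^-1)); last by rewrite ltrBlDr ltrDl invr_gt0.
  rewrite leNgt; apply/negP => Hu.
  have [e e0 He] := near_ball (cvgr_gt _ (@cnsq w u) _ Hu).
  have ue : u < Num.min (u + e) (ratr q) by rewrite lt_min uq andbT ltrDl.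
  have [p] := rat_in_itvoo ue; rewrite in_itv/= lt_min => /andP[up /andP[pe pq]].
  have : nsq (ratr p) w <= 1 - n.+1%:R^-1.
    by apply: Hs; rewrite (ltW pq) andbT; exact: le_trans (ltW up).
  apply/negP; rewrite -ltNge; apply: He.
  by rewrite distrC gtr0_norm ?subr_gt0//; lra.
Qed.

Let measurable_gt (f : T -> R) (a : R) : measurable_fun setT f ->
  measurable [set w | a < f w].
Proof.
move=> mf; rewrite -[X in measurable X]setTI.
have : measurable_fun setT (fun w => a < f w) by exact: measurable_fun_ltr.
by move=> /(_ measurableT [set true]); apply.
Qed.

Lemma measurable_max_horiz : measurable_fun setT (max_horiz X Y).
Proof.
move=> _; apply: (measurability _ (ErealGenOInfty.measurableE R)) => //.
move=> _ [_ [a ->] <-]; rewrite setTI.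
have [a0|a0] := ltP a 0.
  rewrite (_ : _ @^-1` _ = setT)//; apply/seteqP; split => // w _ /=.
  rewrite in_itv/= andbT; apply: lt_le_trans (max_horiz_ge0 w).
  by rewrite lte_fin.
rewrite [X in measurable X](_ : _ = \bigcup_(q : rat) \bigcup_n
     (if 0 <= (ratr q : R) then ratgt a q `&` stays n q else set0)); last first.
  apply/seteqP; split => w.
    by rewrite /= in_itv/= andbT => /max_horiz_gt_rat; apply.
  by move=> /(max_horiz_gt_rat _ a0) /=; rewrite in_itv/= andbT.
apply: bigcupT_measurable_rat => q; apply: bigcupT_measurable => n.
case: ifP => // _; apply: measurableI; first by apply: measurable_gt; have [] := mW (ratr q).
apply: measurableC; apply: bigcupT_measurable_rat => p; case: ifP => // _.
apply: measurable_gt; have [mX mY] := mW (ratr p).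
by apply: measurable_funD; exact: measurable_funX.
Qed.

End paths.

Lemma ge0_approx (R : realType) (h : R -> R) (a : R) : {for a, continuous h} ->
  (forall e, 0 < e -> exists2 x, `|a - x| < e & 0 <= h x) -> 0 <= h a.
Proof.
move=> ch H; rewrite leNgt; apply/negP => ha.
have [e e0 He] := near_ball (cvgr_lt _ ch _ ha).
by have [x /He hx] := H e e0; rewrite leNgt hx.
Qed.

Section maximum_law.
Context {R : realType} {d : measure_display} {T : measurableType d}.
Variables (P : probability T R) (X Y : R -> T -> R).
Hypothesis BM : planar_BM P X Y.
Variables (c s : R).
Hypothesis cs1 : c ^+ 2 + s ^+ 2 = 1.

Definition component (c s : R) (t : R) (w : T) : R := c * X t w + s * Y t w.

Let U := component c s.
Let V := component (- s) c.

Lemma component_start w : U 0 w = 0 /\ V 0 w = 0.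
Proof.
have [W0 _ _ _] := BM; have [X0 Y0] := W0 w.
by rewrite /U /V /component X0 Y0 !mulr0 addr0.
Qed.

Lemma component_continuous w : continuous (fun t => U t w) /\ continuous (fun t => V t w).
Proof.
have [_ cW _ _] := BM; have [cX cY] := cW w.
by split => t; apply: cvgD; apply: cvgM;
  by [exact: cvg_cst | exact: cX | exact: cY].
Qed.

Lemma component_measurable t : measurable_fun setT (U t) /\ measurable_fun setT (V t).
Proof.
have [_ _ mW _] := BM; have [mX mY] := mW t.
by split; apply: measurable_funD; apply: measurable_funM.
Qed.

Let M := max_horiz U V.

Let mM : measurable_fun setT M.
Proof.
exact: measurable_max_horiz component_start component_continuous component_measurable.
Qed.

Let measurable_gtM (a : R) : measurable [set w | (a%:E < M w)%E].
Proof.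
rewrite -[X in measurable X]setTI.
by have := mM measurableT (emeasurable_itv `]a%:E, +oo[);
  rewrite (_ : _ @^-1` _ = [set w | (a%:E < M w)%E])//;
  apply/seteqP; split => w /=; rewrite in_itv/= andbT.
Qed.

Let measurable_geM (a : R) : measurable [set w | (a%:E <= M w)%E].
Proof.
rewrite -[X in measurable X]setTI.
by have := mM measurableT (emeasurable_itv `[a%:E, +oo[);
  rewrite (_ : _ @^-1` _ = [set w | (a%:E <= M w)%E])//;
  apply/seteqP; split => w /=; rewrite in_itv/= andbT.
Qed.

Lemma le_integral_leaves_disc (f g : T -> \bar R) :
  P.-integrable setT f -> P.-integrable setT g ->
  (forall w, leaves_disc X w -> (f w <= g w)%E) ->
  (\int[P]_w f w <= \int[P]_w g w)%E.
Proof.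
move=> fi gi fg.
have mN : measurable (~` leaves_disc X).
  by apply: measurableC; exact: measurable_leaves_disc BM.
have N0 := leaves_disc_as BM.
rewrite (negligible_integral mN measurableT fi N0).
rewrite (negligible_integral mN measurableT gi N0).
rewrite setDE setCK setTI; apply: le_integral.
- by have := measurable_leaves_disc BM.
- by apply: integrableS fi => //; exact: measurable_leaves_disc BM.
- by apply: integrableS gi => //; exact: measurable_leaves_disc BM.
- by move=> w; rewrite inE => /fg.
Qed.

Lemma integral_affine_indic (al be : R) (E : set T) : measurable E ->
  P.-integrable setT (fun w => (al + be * \1_E w)%:E) /\
  (\int[P]_w (al + be * \1_E w)%:E = (al + be * fine (P E))%:E)%E.
Proof.
move=> mE.
have i1 : P.-integrable setT (fun w : T => al%:E).
  exact: finite_measure_integrable_cst.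
have i2 : P.-integrable setT (fun w : T => (\1_E w)%:E).
  by apply: integrable_indic => //; rewrite ltey_eq fin_num_measure.
have i3 := integrableZl measurableT be i2.
have fE : (fun w => (al + be * \1_E w)%:E) =
    (fun w => al%:E + be%:E * (\1_E w)%:E)%E by apply/funext => w; rewrite EFinD EFinM.
rewrite fE; split; first exact: integrableD.
rewrite integralD//= integral_cst//= [X in (_ * X)%E]probability_setT mule1.
rewrite integralZl// (_ : \int[P]_x (\1_E x)%:E = (fine (P E))%:E)%E//.
by rewrite integral_indic// setIT fineK// fin_num_measure.
Qed.

(* The segment is the chord [{x = k * r}] of a disc of radius [r < 1], with
   [a < k * r]: a path whose maximum stays below [a] leaves this disc through
   the arc, from which the chord is seen under the angle [acos k]. *)
Lemma tail_ge_lower (a k : R) : 0 < a -> a < k -> k < 1 ->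
  acos k <= fine (P [set w | (a%:E <= M w)%E]) * (pi - acos k).
Proof.
move=> a0 ak k1; have k0 : 0 < k by exact: lt_trans ak.
have kk1 : k ^+ 2 < 1 by rewrite expr_lt1// ltW.
pose r := (a / k + 1) / 2; pose A := k * r; pose b := r * Num.sqrt (1 - k ^+ 2).
have akk : a / k < 1 by rewrite ltr_pdivrMr// mul1r.
have r1 : r < 1 by rewrite /r; lra.
have akr : a / k < r by rewrite /r; lra.
have r0 : 0 < r by apply: lt_trans akr; rewrite divr_gt0.
have aA : a < A by rewrite /A mulrC -ltr_pdivrMr.
have A0 : 0 < A by exact: lt_trans aA.
have rAb : A ^+ 2 + b ^+ 2 = r ^+ 2.
  by rewrite /A /b !exprMn sqr_sqrtr ?subr_ge0 ?(ltW kk1)//; ring.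
have al : atan (b / A) = acos k.
  rewrite -(acos_atan k0 (ltW k1)) /b /A; congr atan; field.
  by rewrite !gt_eqF.
have [iL EL] := integral_limit_angle BM b cs1 aA a0 r0 (ltW r1).
set E := [set w | _]; have mE : measurable E by exact: measurable_geM.
have [iF EF] := integral_affine_indic (acos k) (pi - acos k) mE.
have := le_integral_leaves_disc iL iF.
rewrite EL EF angle00 al lee_fin => H.
suff : 2 * acos k <= acos k + (pi - acos k) * fine (P E) by lra.
apply: H => w /(limit_angleP BM b cs1 aA a0 r0 (ltW r1)) [t t0 [inG onG ->]].
rewrite lee_fin indicE.
have [Ew|nEw] := boolP (w \in E).
  by rewrite mulr1 subrKC (le_trans (ler_norm _))// ltW// norm_angle_lt.
rewrite mulr0 addr0.
(* This is the use of [r < 1]: up to [t] the path stays in the open unit disc, so its abscissa at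
   [t] counts in the maximum. *)
have utw : upto U V w t.
  apply/uptoP; split => // u u0 ut.
  have /andP[_ /= nu] := inG u u0 (ltW ut).
  by apply: le_lt_trans nu _; rewrite expr_lt1// ltW.
have Uta : U t w < a.
  rewrite ltNge; apply/negP => aU; move/negP: nEw; apply; rewrite inE /E /=.
  by apply: le_trans (upto_le_max_horiz utw); rewrite lee_fin.
case: onG => [Ua|nr].
  by move: Uta; rewrite [U t w]Ua ltxx.
by rewrite (@angle_circle R A b) ?al// ?nr//; exact: lt_trans aA.
Qed.

(* The segment is slightly longer than the chord [{x = a}] and at distance
   [del ^+ 2] from it: it is seen under an angle at least [pi - 2 * atan del]
   from the chord, and at least [al] from the rest of the unit disc. *)
Lemma tail_gt_upper (a del : R) : 0 < a -> a < 1 -> 0 < del ->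
  let al := atan ((Num.sqrt (1 - a ^+ 2) + del) / (a + del ^+ 2)) in
  is_true (fine (P [set w | (a%:E < M w)%E]) * (pi - 2 * atan del - al) <= al).
Proof.
move=> a0 a1 del0 al.
have aa1 : a ^+ 2 < 1 by rewrite expr_lt1// ltW.
pose b0 := Num.sqrt (1 - a ^+ 2); pose b := b0 + del; pose A := a + del ^+ 2.
have b00 : 0 < b0 by rewrite sqrtr_gt0 subr_gt0.
have b00E : b0 ^+ 2 = 1 - a ^+ 2 by rewrite sqr_sqrtr// subr_ge0 ltW.
have d20 : 0 < del ^+ 2 by rewrite exprn_gt0.
have aA : a < A by rewrite /A ltrDl.
have A0 : 0 < A by exact: lt_trans aA.
have bb : 0 < b by rewrite /b addr_gt0.
have nAb : 1 <= A ^+ 2 + b ^+ 2 by rewrite /A /b; nra.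
(* Product one is the limit case of [atanD]: the cosine of the sum vanishes, and in the range of the
   sum this leaves only [pi / 2]. *)
have at1 : 2 * atan del^-1 = pi - 2 * atan del.
  have : atan del + atan del^-1 = pi / 2.
    apply/eqP; rewrite eq_le; apply/andP; split.
      rewrite leNgt; apply/negP => H.
      have c0 : cos (atan del + atan del^-1) = 0.
        by rewrite cos_atanD divff ?gt_eqF// subrr mul0r.
      have : `|atan del + atan del^-1| < pi by exact: norm_atanD.
      rewrite ltr_norml => /andP[_ H2].
      suff : cos (atan del + atan del^-1) < cos (pi / 2) by rewrite c0 cos_pihalf ltxx.
      have p0 := @pi_gt0 R.
      by rewrite ltr_cos// in_itv/=; apply/andP; split; lra.
    rewrite leNgt; apply/negP => H.
    have : 0 < cos (atan del + atan del^-1).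
      apply: cos_gt0_pihalf; rewrite H andbT.
      have := le_atan (ltW del0); have dv0 : 0 <= del^-1 by rewrite invr_ge0 ltW.
      have := le_atan dv0; rewrite atan0.
      by have := @pi_gt0 R; lra.
    by rewrite cos_atanD divff ?gt_eqF// subrr mul0r ltxx.
  by lra.
have [iL EL] := integral_limit_angle BM b cs1 aA a0 ltr01 (lexx _).
set E := [set w | _]; have mE : measurable E by exact: measurable_gtM.
have [iF EF] := integral_affine_indic al (pi - 2 * atan del - al) mE.
have := le_integral_leaves_disc iF iL.
rewrite EL EF angle00 -/al lee_fin => H.
suff : al + (pi - 2 * atan del - al) * fine (P E) <= 2 * al.
  by rewrite mulrC; lra.
apply: H => w /(limit_angleP BM b cs1 aA a0 ltr01 (lexx _)) [t t0 [inG onG ->]].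
rewrite lee_fin indicE.
have /andP[/= gxa gn] := inG t t0 (lexx _).
have [Ew|nEw] := boolP (w \in E); last first.
  rewrite mulr0 addr0; apply: angle_ge => //.
    exact: le_lt_trans aA.
  by apply: le_trans nAb; move: gn; rewrite expr1n.
rewrite mulr1 subrKC -at1.
move: Ew; rewrite inE /E /= => /max_horiz_gtP[u /uptoP[u0 Hu] aU].
(* The path exceeds [a] at [u] without having left the unit disc earlier, so the exit from the
   region at [t < u] took place on the chord. *)
have tu : t < u.
  rewrite ltNge; apply/negP => ut; have /andP[/= Ua _] := inG u u0 ut.
  by move: aU; rewrite ltNge Ua.
have nt1 := Hu t t0 tu.
case: onG => [Ua|nr]; last by move: nt1; rewrite [X in X < _]nr expr1n ltxx.
have Vb : `|(rotated_position X Y c s t w).2| <= b0.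
  rewrite -(@ler_pXn2r _ 2) ?nnegrE ?(ltW b00)// real_normK ?num_real// b00E.
  have : (rotated_position X Y c s t w).1 ^+ 2 +
    (rotated_position X Y c s t w).2 ^+ 2 <= 1 := ltW nt1.
  by rewrite Ua; lra.
move: Vb; rewrite ler_norml => /andP[V1 V2].
have e0 : 0 < del^-1 by rewrite invr_gt0.
rewrite /= in Ua V1 V2; rewrite Ua; apply: angle_chord_ge => //.
  have -> : del^-1 * (A - a) = del by rewrite /A; field; rewrite gt_eqF.
  by rewrite /b; lra.
have -> : del^-1 * (A - a) = del by rewrite /A; field; rewrite gt_eqF.
by rewrite /b; lra.
Qed.

Definition tail (a : R) : R := acos a / (pi - acos a).

Let acos_bound (a : R) : 0 < a -> a < 1 -> 0 < acos a /\ acos a < pi / 2.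
Proof.
move=> a0 a1; split.
  by apply: acos_gt0; rewrite a1 andbT; apply: le_trans (ltW a0); rewrite lerN10.
rewrite -acos_atan ?(ltW a1)//; exact: atan_ltpi2.
Qed.

Let tail_fine (a : R) (E : set T) : 0 < a -> a < 1 -> measurable E ->
  acos a <= fine (P E) * (pi - acos a) -> fine (P E) * (pi - acos a) <= acos a ->
  P E = (tail a)%:E.
Proof.
move=> a0 a1 mE h1 h2; rewrite -(fineK (fin_num_measure P _ mE)); congr EFin.
have [al0 al1] := acos_bound a0 a1.
have p0 := @pi_gt0 R.
have d0 : 0 < pi - acos a by lra.
apply: (mulIf (lt0r_neq0 d0)); rewrite /tail divfK ?gt_eqF//.
by apply/eqP; rewrite eq_le h1 h2.
Qed.

Let fineP_mono (E F : set T) : measurable E -> measurable F -> E `<=` F ->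
  fine (P E) <= fine (P F).
Proof.
move=> mE mF EF; apply: fine_le; rewrite ?fin_num_measure//.
by apply: le_measure; rewrite ?inE.
Qed.

Let tail_ge_lim (a : R) : 0 < a -> a < 1 ->
  acos a <= fine (P [set w | (a%:E <= M w)%E]) * (pi - acos a).
Proof.
move=> a0 a1; rewrite -subr_ge0.
set p := fine _.
apply: (@ge0_approx R (fun a => p * (pi - acos a) - acos a)).
  have ca : {for a, continuous (@acos R)}.
    by apply: continuous_acos; rewrite a1 andbT; apply: lt_trans a0; rewrite ltrN10.
  apply: cvgB => //; apply: cvgMr; apply: cvgB => //; exact: cvg_cst.
move=> e e0; have ae : a < Num.min 1 (a + e) by rewrite lt_min a1 ltrDl.
have : a < (a + Num.min 1 (a + e)) / 2 < Num.min 1 (a + e).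
  by apply/andP; split; lra.
move: ((a + _) / 2) => k /andP[ak]; rewrite lt_min => /andP[k1 ke].
exists k; first by rewrite distrC gtr0_norm ?subr_gt0//; lra.
by rewrite subr_ge0; exact: tail_ge_lower.
Qed.

Let tail_gt_lim (a : R) : 0 < a -> a < 1 ->
  fine (P [set w | (a%:E < M w)%E]) * (pi - acos a) <= acos a.
Proof.
move=> a0 a1; rewrite -subr_ge0.
set p := fine _.
pose al (del : R) := atan ((Num.sqrt (1 - a ^+ 2) + del) / (a + del ^+ 2)).
have al0 : al 0 = acos a.
  by rewrite /al expr0n/= !addr0 acos_atan// ltW.
have cal : {for 0, continuous al}.
  apply: (@continuous_comp _ _ _
    (fun del => (Num.sqrt (1 - a ^+ 2) + del) / (a + del ^+ 2)) atan); last first.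
    exact: continuous_atan.
  apply: cvgM; first by apply: cvgD; [exact: cvg_cst|exact: cvg_id].
  apply: cvgV; first by rewrite expr0n/= addr0 gt_eqF.
  by apply: cvgD; [exact: cvg_cst|exact: sqr_continuous].
have := @ge0_approx R (fun del => al del - p * (pi - 2 * atan del - al del)) 0.
rewrite al0 atan0 mulr0 subr0; apply.
  apply: cvgB => //; apply: cvgMr; apply: cvgB => //.
  apply: cvgB; first exact: cvg_cst.
  by apply: cvgMr; exact: continuous_atan.
move=> e e0; exists (e / 2).
  by rewrite sub0r normrN gtr0_norm ?divr_gt0//; lra.
by rewrite subr_ge0; apply: tail_gt_upper => //; rewrite divr_gt0.
Qed.

(** The upper bound is known for [M > k] only; letting [k] increase to [a] transfers it to [M >= a],
    the bound being continuous. With the next lemma, [M] has no atom in [(0, 1)]. *)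
Lemma max_horiz_tail_ge (a : R) : 0 < a -> a < 1 ->
  P [set w | (a%:E <= M w)%E] = (tail a)%:E.
Proof.
move=> a0 a1; apply: tail_fine => //; first exact: tail_ge_lim.
rewrite -subr_ge0; set p := fine _.
apply: (@ge0_approx R (fun a => acos a - p * (pi - acos a))).
  have ca : {for a, continuous (@acos R)}.
    by apply: continuous_acos; rewrite a1 andbT; apply: lt_trans a0; rewrite ltrN10.
  apply: cvgB => //; apply: cvgMr; apply: cvgB => //; exact: cvg_cst.
move=> e e0; have ae : Num.max 0 (a - e) < a by rewrite gt_max a0 ltrBlDr ltrDl.
have : Num.max 0 (a - e) < (a + Num.max 0 (a - e)) / 2 < a.
  by apply/andP; split; lra.
move: ((a + _) / 2) => k /andP[]; rewrite gt_max => /andP[k0 ke] ka.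
exists k; first by rewrite gtr0_norm ?subr_gt0//; lra.
have k1 : k < 1 by exact: lt_trans a1.
rewrite subr_ge0; apply: le_trans (tail_gt_lim k0 k1).
have [_ al1] := acos_bound k0 k1; have p0 := @pi_gt0 R.
rewrite ler_pM2r; last lra.
apply: fineP_mono; [exact: measurable_geM|exact: measurable_gtM|].
by move=> w /=; apply: lt_le_trans; rewrite lte_fin.
Qed.

Lemma max_horiz_tail_gt (a : R) : 0 < a -> a < 1 ->
  P [set w | (a%:E < M w)%E] = (tail a)%:E.
Proof.
move=> a0 a1; apply: tail_fine => //; last exact: tail_gt_lim.
rewrite -subr_ge0; set p := fine _.
apply: (@ge0_approx R (fun a => p * (pi - acos a) - acos a)).
  have ca : {for a, continuous (@acos R)}.
    by apply: continuous_acos; rewrite a1 andbT; apply: lt_trans a0; rewrite ltrN10.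
  apply: cvgB => //; apply: cvgMr; apply: cvgB => //; exact: cvg_cst.
move=> e e0; have ae : a < Num.min 1 (a + e) by rewrite lt_min a1 ltrDl.
have : a < (a + Num.min 1 (a + e)) / 2 < Num.min 1 (a + e).
  by apply/andP; split; lra.
move: ((a + _) / 2) => k /andP[ak]; rewrite lt_min => /andP[k1 ke].
have k0 : 0 < k by exact: lt_trans ak.
exists k; first by rewrite distrC gtr0_norm ?subr_gt0//; lra.
rewrite subr_ge0; apply: le_trans (tail_ge_lim k0 k1) _.
have [_ al1] := acos_bound k0 k1; have p0 := @pi_gt0 R.
rewrite ler_pM2r; last lra.
apply: fineP_mono; [exact: measurable_geM|exact: measurable_gtM|].
by move=> w /=; apply: lt_le_trans; rewrite lte_fin.
Qed.

Lemma max_horiz_cdf (a : R) : 0 < a -> a < 1 ->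
  P [set w | (M w < a%:E)%E] = ((2 * asin a) / (pi - acos a))%:E.
Proof.
move=> a0 a1.
rewrite (_ : [set w | _] = ~` [set w | (a%:E <= M w)%E]); last first.
  by apply/seteqP; split => w /=; rewrite ltNge => /negP.
rewrite probability_setC// max_horiz_tail_ge// -EFinB; congr EFin.
have [_ al1] := acos_bound a0 a1; have p0 := @pi_gt0 R.
rewrite asin_acos; last by apply/andP; split; lra.
by rewrite /tail; field; rewrite gt_eqF//; lra.
Qed.

Lemma measurable_maximum : measurable_fun setT M.
Proof. exact: mM. Qed.

Lemma maximum_bounds w : (0 <= M w)%E /\ (M w <= 1)%E.
Proof.
by split; [exact: max_horiz_ge0 component_start w|
  exact: max_horiz_le1 component_start component_continuous w].
Qed.

End maximum_law.

(** * Mean of the maximal displacement *)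

Section sine_taylor.
Context {R : realType}.
Implicit Types (u x : R).

Lemma is_derive_monomial (k : nat) (al u : R) :
  is_derive u (1 : R) (fun x : R => al * x ^+ k : R) (al * (k%:R * u ^+ k.-1)).
Proof.
have -> : (fun x : R => al * x ^+ k : R) = al \*: ((@id R) ^+ k).
  by apply/funext => x /=; rewrite fctE.
have D := @is_deriveX R R id k u 1 1 (is_derive_id u 1).
have := @is_deriveZ R R R (id ^+ k) al u 1 _ D.
by rewrite /GRing.scale /= mulr1.
Qed.

Lemma is_derive_bigsum (n : nat) (f df : nat -> R -> R) u :
  (forall k, is_derive u (1 : R) (f k) (df k u)) ->
  is_derive u (1 : R) (fun x => \sum_(k < n) f k x) (\sum_(k < n) df k u).
Proof.
move=> H.
have -> : (fun x => \sum_(k < n) f k x) = \sum_(k < n) f k.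
  by apply/funext => x; rewrite fct_sumE.
exact: is_derive_sum.
Qed.

Lemma ge0_of_derive (f df : R -> R) : f 0 = 0 ->
  (forall x, is_derive x (1 : R) f (df x)) -> (forall x, 0 <= x -> 0 <= df x) ->
  forall x, 0 <= x -> 0 <= f x.
Proof.
move=> f0 Hf df0 x; rewrite le_eqVlt => /predU1P[<-|x0]; first by rewrite f0.
have [|c] := @MVT R f df 0 x x0 (fun z _ => Hf z).
  apply: continuous_subspaceT => z; apply: differentiable_continuous.
  by apply/derivable1_diffP; have := Hf z; exact: @ex_derive.
rewrite in_itv/= => /andP[c0 _]; rewrite f0 !subr0 => ->.
by rewrite mulr_ge0 ?df0// ltW.
Qed.

Definition sin_poly n u : R := \sum_(k < n) (-1) ^+ k / (k.*2.+1)`!%:R * u ^+ k.*2.+1.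
Definition cos_poly n u : R := \sum_(k < n) (-1) ^+ k / (k.*2)`!%:R * u ^+ k.*2.
Definition sinc_poly n u : R := \sum_(k < n) (-1) ^+ k / (k.*2.+1)`!%:R * u ^+ k.*2.
(** Taylor polynomial of the sine integral [Si], the primitive of [sin u / u]. *)
Definition sinint_poly n u : R :=
  \sum_(k < n) (-1) ^+ k / (k.*2.+1)`!%:R / k.*2.+1%:R * u ^+ k.*2.+1.

Lemma is_derive_sin_poly n u : is_derive u (1 : R) (sin_poly n) (cos_poly n u).
Proof.
pose df k x : R := (-1) ^+ k / (k.*2)`!%:R * x ^+ k.*2.
apply: (@is_derive_bigsum n (fun k x => (-1) ^+ k / (k.*2.+1)`!%:R * x ^+ k.*2.+1) df).
move=> k.
apply: (is_derive_eq (is_derive_monomial k.*2.+1 ((-1) ^+ k / (k.*2.+1)`!%:R) u)).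
rewrite /df factS natrM /= mulrA; congr (_ * _).
by rewrite [_%:R * _]mulrC invfM mulrA divfK ?pnatr_eq0.
Qed.

Lemma is_derive_cos_poly n u : is_derive u (1 : R) (cos_poly n.+1) (- sin_poly n u).
Proof.
pose df k x : R := if k is k'.+1 then
  - ((-1) ^+ k' / (k'.*2.+1)`!%:R * x ^+ k'.*2.+1) else 0.
apply: is_derive_eq.
  apply: (@is_derive_bigsum n.+1 (fun k x => (-1) ^+ k / (k.*2)`!%:R * x ^+ k.*2) df).
  case=> [|k].
    apply: (is_derive_eq (is_derive_monomial 0 ((-1) ^+ 0 / (0.*2)`!%:R) u)).
    by rewrite mul0r mulr0.
  apply: (is_derive_eq
    (is_derive_monomial k.+1.*2 ((-1) ^+ k.+1 / (k.+1.*2)`!%:R) u)).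
  rewrite /df doubleS factS natrM /= exprS mulrA -mulNr; congr (_ * _).
  by rewrite mulN1r mulNr [_%:R * _]mulrC invfM mulrA mulNr divfK ?pnatr_eq0.
rewrite big_ord_recl /= add0r -sumrN; apply: eq_bigr => i _.
by rewrite add0n.
Qed.

Lemma is_derive_sinint_poly n u :
  is_derive u (1 : R) (sinint_poly n) (sinc_poly n u).
Proof.
pose df k x : R := (-1) ^+ k / (k.*2.+1)`!%:R * x ^+ k.*2.
apply: (@is_derive_bigsum n
  (fun k x => (-1) ^+ k / (k.*2.+1)`!%:R / k.*2.+1%:R * x ^+ k.*2.+1) df).
move=> k.
apply: (is_derive_eq (is_derive_monomial k.*2.+1
  ((-1) ^+ k / (k.*2.+1)`!%:R / k.*2.+1%:R) u)).
by rewrite /df /= mulrA; congr (_ * _); rewrite divfK.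
Qed.

Lemma sinc_polyE n u : u * sinc_poly n u = sin_poly n u.
Proof.
rewrite /sinc_poly big_distrr/=; apply: eq_bigr => k _.
by rewrite exprS mulrCA.
Qed.

Lemma sin_poly0 n : sin_poly n 0 = 0.
Proof. by rewrite /sin_poly big1// => k _; rewrite expr0n/= mulr0. Qed.

Lemma cos_poly0 n : cos_poly n.+1 0 = 1.
Proof.
rewrite /cos_poly big_ord_recl expr0 fact0 divr1 mul1r expr0 big1 ?addr0//.
by move=> k _; rewrite lift0 doubleS expr0n/= mulr0.
Qed.

(** Repeated integration of [cos <= 1] from 0: each remainder has the previous one as its
    derivative, up to the sign that the factor [(-1) ^+ n.+1] records. *)
Lemma taylor_sign n u : 0 <= u ->
  0 <= (-1) ^+ n.+1 * (cos u - cos_poly n.+1 u) /\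
  0 <= (-1) ^+ n.+1 * (sin u - sin_poly n.+1 u).
Proof.
have dsin m x : is_derive x (1 : R) (fun x => (-1) ^+ m * (sin x - sin_poly m x))
    ((-1) ^+ m * (cos x - cos_poly m x)).
  apply: is_deriveZ; apply: is_deriveB; exact: is_derive_sin_poly.
have dcos m x : is_derive x (1 : R) (fun x => (-1) ^+ m.+1 * (cos x - cos_poly m.+1 x))
    ((-1) ^+ m * (sin x - sin_poly m x)).
  apply: is_derive_eq.
    apply: is_deriveZ; apply: is_deriveB; exact: is_derive_cos_poly.
  by rewrite /GRing.scale /= exprS; ring.
have sin_of_cos m : (forall x, 0 <= x -> 0 <= (-1) ^+ m * (cos x - cos_poly m x)) ->
    forall x, 0 <= x -> 0 <= (-1) ^+ m * (sin x - sin_poly m x).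
  by move=> H; apply: (ge0_of_derive _ (dsin m)) => //; rewrite sin0 sin_poly0 subrr mulr0.
have cos_n x m : 0 <= x -> 0 <= (-1) ^+ m.+1 * (cos x - cos_poly m.+1 x).
  elim: m x => [x _|m IH x x0].
    rewrite expr1 /cos_poly big_ord1 fact0 expr0 divr1 mul1r expr0 mulN1r opprB subr_ge0.
    exact: cos_le1.
  apply: (ge0_of_derive _ (dcos m.+1)) x0; first by rewrite cos0 cos_poly0 subrr mulr0.
  by apply: sin_of_cos => z z0; exact: IH.
move=> u0; split; first exact: cos_n.
by apply: sin_of_cos u0 => z z0; exact: cos_n.
Qed.

Lemma sin_le_poly n u : ~~ odd n.+1 = false -> 0 <= u -> sin u <= sin_poly n.+1 u.
Proof.
move=> on u0; have [_] := taylor_sign n u0.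
by rewrite -signr_odd (negbFE on) expr1 mulN1r opprB subr_ge0.
Qed.

Lemma sin_ge_poly n u : odd n.+1 = false -> 0 <= u -> sin_poly n.+1 u <= sin u.
Proof.
move=> on u0; have [_] := taylor_sign n u0.
by rewrite -signr_odd on expr0 mul1r subr_ge0.
Qed.

End sine_taylor.

Section numerics.
Context {R : realType}.

(* Horner form of [\sum_k (-1)^k w(2k+1) q^k / (2k+1)!]; the index [p] runs
   through the even numbers from 2. *)
Fixpoint sine_horner (w : nat -> R) (q : R) (n p : nat) : R :=
  if n is n'.+1 then
    w p.-1 - q / (p%:R * p.+1%:R) * sine_horner w q n' p.+2
  else 0.

Lemma sine_hornerE w q n m :
  \sum_(k < n) (-1) ^+ k / ((m + k).*2.+1)`!%:R * w (m + k).*2.+1 * q ^+ k =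
  (m.*2.+1)`!%:R^-1 * sine_horner w q n m.*2.+2 :> R.
Proof.
elim: n m => [|n IH] m; first by rewrite big_ord0 mulr0.
rewrite big_ord_recl /= addn0 !expr0 mulr1 mul1r mulrBr; congr (_ + _).
have -> : m.*2.+4 = m.+1.*2.+2 by rewrite doubleS.
have -> : (m.*2.+1)`!%:R^-1 * (q / (m.*2.+2%:R * m.*2.+3%:R) * sine_horner w q n m.+1.*2.+2)
   = q * ((m.+1.*2.+1)`!%:R^-1 * sine_horner w q n m.+1.*2.+2) :> R.
  rewrite doubleS [in RHS]factS [in RHS]factS !natrM !invfM; ring.
rewrite -IH mulr_sumr -sumrN; apply: eq_bigr => i _.
by rewrite /bump leq0n add1n -addSnnS !exprS; ring.
Qed.

Lemma sin_poly_horner n u : sin_poly n u = u * sine_horner (fun=> 1) (u ^+ 2) n 2.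
Proof.
have := sine_hornerE (fun=> 1) (u ^+ 2) n 0; rewrite invr1 mul1r => <-.
rewrite /sin_poly mulr_sumr; apply: eq_bigr => k _.
by rewrite mulr1 add0n exprS -exprM -mul2n; ring.
Qed.

Lemma sinint_poly_horner n u :
  sinint_poly n u = u * sine_horner (fun k => k%:R^-1) (u ^+ 2) n 2.
Proof.
have := sine_hornerE (fun k => k%:R^-1) (u ^+ 2) n 0; rewrite invr1 mul1r => <-.
rewrite /sinint_poly mulr_sumr; apply: eq_bigr => k _.
by rewrite add0n exprS -exprM -mul2n; ring.
Qed.

(** The bounds are 3.1415926535 and 3.1415926537 for [pi], with their squares rounded outwards to
    ten decimals, all written with short numerals. *)
Definition pi_lo : R := 3 + 1415 / 10 ^+ 4 + 9265 / 10 ^+ 8 + 35 / 10 ^+ 10.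
Definition pi_hi : R := 3 + 1415 / 10 ^+ 4 + 9265 / 10 ^+ 8 + 37 / 10 ^+ 10.
Definition pi2_lo : R := 9 + 8696 / 10 ^+ 4 + 440 / 10 ^+ 8 + 5 / 10 ^+ 10.
Definition pi2_hi : R := 9 + 8696 / 10 ^+ 4 + 440 / 10 ^+ 8 + 18 / 10 ^+ 10.

(** [pi] is located by the sign of the sine: were [pi] at most [pi_lo], the sine there would be
    nonpositive, but twelve Taylor terms, a lower bound, are already positive. *)
Lemma pi_gt_decimal : pi_lo < pi.
Proof.
set x := pi_lo; rewrite ltNge; apply/negP => px.
have x0 : 0 <= x by rewrite /x /pi_lo; lra.
have := @sin_ge_poly R 11 x erefl x0.
have : sin x <= 0.
  have -> : x = (x - pi) + pi by rewrite subrK.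
  rewrite sinDpi oppr_le0 sin_ge0_pi// subr_ge0 px/=.
  by have := @pi_ge2 R; rewrite /x /pi_lo; lra.
move=> s0 s1; have := le_trans s1 s0; rewrite leNgt => /negP; apply.
by rewrite sin_poly_horner /= /x /pi_lo; lra.
Qed.

Lemma pi_lt_decimal : pi < pi_hi.
Proof.
set x := pi_hi; rewrite ltNge; apply/negP => px.
have x0 : 0 <= x by rewrite /x /pi_hi; lra.
have := @sin_le_poly R 10 x erefl x0.
have : 0 <= sin x by rewrite sin_ge0_pi// x0.
move=> s0 s1; have := le_trans s0 s1; rewrite leNgt => /negP; apply.
by rewrite sin_poly_horner /= /x /pi_hi; lra.
Qed.

(* With the sine integral [Si] in place of its Taylor polynomial and [p = pi],
   this is the closed form [pi (Si pi - Si (pi / 2)) - 1] of the mean. *)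
Definition sinint_gap (n : nat) (p : R) : R :=
  p * (sinint_poly n p - sinint_poly n (p / 2)) - 1.

Let w (k : nat) : R := k%:R^-1.

(** From [p = 4] on the factor [q / (p (p + 1))] is at most 1, so the terms of the sum alternate and
    decrease. The bound 20 is [4 * 5], and it exceeds [pi ^+ 2]. *)
Lemma sine_horner_bounds q n p : 0 <= q -> q <= 20 -> (3 < p)%N ->
  0 <= sine_horner w q n p /\ sine_horner w q n p <= w p.-1.
Proof.
move=> q0 q20; elim: n p => [p p3|n IH p p3] /=.
  by rewrite lexx /w invr_ge0 ler0n.
have [h0 h1] := IH p.+2 (leqW (leqW p3)).
have p0 : 0 < p%:R * p.+1%:R :> R by rewrite mulr_gt0// ltr0n; case: p p3 {IH h0 h1}.
have qp : q / (p%:R * p.+1%:R) <= 1.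
  rewrite ler_pdivrMr// mul1r; apply: le_trans q20 _.
  by rewrite -natrM ler_nat; case: p p3 {IH h0 h1 p0} => [|[|[|[|p]]]]//= _; nia.
have qp0 : 0 <= q / (p%:R * p.+1%:R) by rewrite divr_ge0// ltW.
have ww : w p.+1 <= w p.-1.
  rewrite /w lef_pV2 ?posrE ?ltr0n//; last by case: p p3 {IH h0 h1 p0 qp qp0} => [|[]].
  by rewrite ler_nat; lia.
rewrite /= in h1.
have k1 := mulr_ge0 qp0 h0; have := ler_pM qp0 h0 qp h1; rewrite mul1r => k2.
rewrite gerBl k1 subr_ge0; split=> //; exact: le_trans ww.
Qed.

(* Interval evaluation: the two bounds of the argument alternate. *)
Fixpoint alt_horner (x y : R) (n p : nat) : R :=
  if n is n'.+1 then w p.-1 - x / (p%:R * p.+1%:R) * alt_horner y x n' p.+2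
  else 0.

(** The bounds may be multiplied because the inner value, of index at least 4, is nonnegative by the
    previous lemma. *)
Lemma sine_horner_alt (l q u : R) n p : 0 <= l -> l <= q -> q <= u -> q <= 20 ->
  (1 < p)%N ->
  alt_horner u l n p <= sine_horner w q n p /\ sine_horner w q n p <= alt_horner l u n p.
Proof.
move=> l0 lq qu q20; elim: n p => [p _|n IH p p1] //=.
have [h1 h2] := IH p.+2 (leqW (leqW p1)).
have q0 : 0 <= q by exact: le_trans lq.
have [h0 _] := @sine_horner_bounds q n p.+2 q0 q20 p1.
have p0 : 0 < p%:R * p.+1%:R :> R by rewrite mulr_gt0// ltr0n; exact: ltnW.
have h0' : 0 <= alt_horner l u n p.+2 by exact: le_trans h2.
set D := p%:R * p.+1%:R in p0 *; set H := sine_horner _ _ _ _ in h0 h1 h2 *.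
have k1 : q / D * H <= u / D * alt_horner l u n p.+2.
  by apply: ler_pM => //; [rewrite divr_ge0// ltW|rewrite ler_pM2r ?invr_gt0].
have k2 : l / D * alt_horner u l n p.+2 <= q / D * H.
  apply: (@le_trans _ _ (l / D * H)).
    by rewrite ler_wpM2l// divr_ge0// ltW.
  by rewrite ler_wpM2r// ler_pM2r ?invr_gt0.
by split; lra.
Qed.

(** An odd number of Taylor terms will bound the mean from above and an even number from below; nine
    and ten terms enclose it in an interval of length [10^-7]. *)
Lemma sinint_gap_bounds :
  sinint_gap 9 pi < 5116 / 10 ^+ 4 + 555 / 10 ^+ 7 /\
  5116 / 10 ^+ 4 + 554 / 10 ^+ 7 < sinint_gap 10 pi.
Proof.
have gapE n : sinint_gap n pi = pi ^+ 2 * sine_horner w (pi ^+ 2) n 2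
   - pi ^+ 2 / 4 * sine_horner w (pi ^+ 2 / 4) n 2 * 2 - 1.
  rewrite /sinint_gap !sinint_poly_horner expr_div_n (_ : 2 ^+ 2 = 4); last by ring.
  set y := sine_horner _ _ _ _; set y' := sine_horner _ (_ / 4) _ _.
  by move: y y' (pi : R) => y y' z; field.
rewrite !gapE.
have sq_mono (x y : R) : 0 <= x -> x < y -> x ^+ 2 <= y ^+ 2.
  by move=> x0 xy; apply: lerXn2r; rewrite ?nnegrE ?(ltW xy)// (le_trans x0)// ltW.
have pl := pi_gt_decimal; have pu := pi_lt_decimal.
have p0 : 0 <= pi_lo by rewrite /pi_lo; lra.
have ql : pi2_lo <= pi ^+ 2.
  by apply: le_trans (sq_mono _ _ p0 pl); rewrite /pi2_lo /pi_lo; lra.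
have qu : pi ^+ 2 <= pi2_hi.
  apply: le_trans (sq_mono _ _ (pi_ge0 R) pu) _.
  by rewrite /pi2_hi /pi_hi; lra.
move: (pi ^+ 2) ql qu => q ql qu.
have l0 : 0 <= pi2_lo by rewrite /pi2_lo; lra.
have u20 : pi2_hi <= 20 by rewrite /pi2_hi; lra.
have q20 : q <= 20 by exact: le_trans u20.
have q0 : 0 <= q by exact: le_trans ql.
have l40 : 0 <= pi2_lo / 4 by lra.
have ql4 : pi2_lo / 4 <= q / 4 by lra.
have qu4 : q / 4 <= pi2_hi / 4 by lra.
have q40 : q / 4 <= 20 by lra.
split.
- have [_ h1] := @sine_horner_alt _ _ _ 9 2 l0 ql qu q20 erefl.
  have [h2 _] := @sine_horner_alt _ _ _ 9 2 l40 ql4 qu4 q40 erefl.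
  have a1 : 0 <= alt_horner pi2_lo pi2_hi 9 2 by rewrite /= /w /= /pi2_lo /pi2_hi; lra.
  have a2 : 0 <= alt_horner (pi2_hi / 4) (pi2_lo / 4) 9 2.
    by rewrite /= /w /= /pi2_lo /pi2_hi; lra.
  have k1 : q * sine_horner w q 9 2 <= pi2_hi * alt_horner pi2_lo pi2_hi 9 2.
    apply: (@le_trans _ _ (q * alt_horner pi2_lo pi2_hi 9 2)).
      exact: ler_wpM2l.
    exact: ler_wpM2r.
  have k2 : pi2_lo / 4 * alt_horner (pi2_hi / 4) (pi2_lo / 4) 9 2 <=
      q / 4 * sine_horner w (q / 4) 9 2 by exact: ler_pM.
  have : pi2_hi * alt_horner pi2_lo pi2_hi 9 2 -
      pi2_lo / 4 * alt_horner (pi2_hi / 4) (pi2_lo / 4) 9 2 * 2 - 1 <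
      5116 / 10 ^+ 4 + 555 / 10 ^+ 7.
    by rewrite /= /w /= /pi2_lo /pi2_hi; lra.
  by apply: le_lt_trans; rewrite lerD2r lerB// ler_wpM2r.
- have [h1 _] := @sine_horner_alt _ _ _ 10 2 l0 ql qu q20 erefl.
  have [_ h2] := @sine_horner_alt _ _ _ 10 2 l40 ql4 qu4 q40 erefl.
  have a1 : 0 <= alt_horner pi2_hi pi2_lo 10 2 by rewrite /= /w /= /pi2_lo /pi2_hi; lra.
  have a2 : 0 <= alt_horner (pi2_lo / 4) (pi2_hi / 4) 10 2.
    by rewrite /= /w /= /pi2_lo /pi2_hi; lra.
  have k1 : pi2_lo * alt_horner pi2_hi pi2_lo 10 2 <= q * sine_horner w q 10 2.
    exact: ler_pM.
  have k2 : q / 4 * sine_horner w (q / 4) 10 2 <=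
      pi2_hi / 4 * alt_horner (pi2_lo / 4) (pi2_hi / 4) 10 2.
    apply: (@le_trans _ _ (q / 4 * alt_horner (pi2_lo / 4) (pi2_hi / 4) 10 2)).
      by apply: ler_wpM2l => //; exact: le_trans ql4.
    exact: ler_wpM2r.
  have : 5116 / 10 ^+ 4 + 554 / 10 ^+ 7 < pi2_lo * alt_horner pi2_hi pi2_lo 10 2 -
      pi2_hi / 4 * alt_horner (pi2_lo / 4) (pi2_hi / 4) 10 2 * 2 - 1.
    by rewrite /= /w /= /pi2_lo /pi2_hi; lra.
  by move/lt_le_trans; apply; rewrite lerD2r lerB// ler_wpM2r.
Qed.

End numerics.

Section mean_maximum.
Context {R : realType}.

Definition mean_integrand (t : R) : R := (1 - 2 * t / (pi / 2 + t)) * cos t.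

Lemma sin_acos_complement (t : R) : 0 <= t -> t <= pi / 2 -> acos (sin t) = pi / 2 - t.
Proof.
move=> t0 t1; have p0 := pi_gt0 R.
rewrite -[in LHS](subKr (pi / 2) t) sinB sin_pihalf cos_pihalf mul1r mul0r subr0.
by rewrite cosK// in_itv/=; apply/andP; split; lra.
Qed.

Lemma mean_integrandE (t : R) : 0 <= t -> t <= pi / 2 ->
  mean_integrand t = tail (sin t) * cos t.
Proof.
move=> t0 t1; have p0 := pi_gt0 R.
rewrite /tail sin_acos_complement// /mean_integrand; congr (_ * _).
by field; rewrite ?andbT; lra.
Qed.

Lemma tail_continuous : {within `[0%R, 1%R], continuous (@tail R)}.
Proof.
have p0 := pi_gt0 R.
have tail_at (F : set_system R) : Filter F -> forall y : R, acos y <= pi / 2 ->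
    acos x @[x --> F] --> acos y -> tail x @[x --> F] --> tail y.
  move=> FF y hy cy; apply: cvgM => //; apply: cvgV; first by apply/lt0r_neq0; lra.
  by apply: cvgB => //; exact: cvg_cst.
have acos_half y : 0 <= y -> y <= 1 -> acos y <= pi / 2 :> R.
  rewrite le_eqVlt => /predU1P[<- _|y0 y1]; first by rewrite acos0.
  by rewrite -acos_atan// ltW// atan_ltpi2.
apply/continuous_within_itvP; first exact: ltr01.
split.
- move=> x; rewrite in_itv/= => /andP[x0 x1].
  apply: tail_at; first by apply: acos_half; exact: ltW.
  by apply: continuous_acos; apply/andP; split; lra.
- apply: tail_at; first exact: acos_half.
  apply: cvg_at_right_filter; apply: continuous_acos; apply/andP; split; lra.
- apply: tail_at; first exact: acos_half.
  (* At the endpoint 1 continuity is read off the arctangent form of [acos]. *)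
  have -> : acos 1 = atan (Num.sqrt (1 - 1 ^+ 2) / 1) :> R by rewrite acos_atan.
  apply: cvg_trans (_ : atan (Num.sqrt (1 - x ^+ 2) / x) @[x --> 1^'-] --> _).
    apply: near_eq_cvg; near=> x; rewrite acos_atan//.
  apply: cvg_at_left_filter.
  apply: (@continuous_comp _ _ _ (fun x : R => Num.sqrt (1 - x ^+ 2) / x) atan).
    apply: cvgM; last by apply: cvgV => //; exact: oner_neq0.
    apply: (@continuous_comp _ _ _ (fun x : R => 1 - x ^+ 2) Num.sqrt).
      by apply: cvgB; [exact: cvg_cst|rewrite expr2; apply: cvgM].
    exact: sqrt_continuous.
  exact: continuous_atan.
Unshelve. all: by end_near. Qed.

Lemma integral_tail :
  (\int[lebesgue_measure]_(a in `[0%R, 1%R]) (tail a)%:E =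
   \int[lebesgue_measure]_(t in `[0%R, (pi / 2)%R]) (mean_integrand t)%:E :> \bar R)%E.
Proof.
have p0 := pi_gt0 R.
have dsin : (@sin R)^`()%classic = cos by apply/funext => x; rewrite derive1E derive_val.
have := @integration_by_substitution_increasing R sin tail 0 (pi / 2).
rewrite sin0 sin_pihalf => -> //.
- apply: eq_integral => t; rewrite inE/= in_itv/= => /andP[t0 t1]; congr EFin.
  by rewrite mean_integrandE// dsin.
- by rewrite divr_ge0// ltW.
- move=> x y; rewrite !in_itv/= => /andP[x0 x1] /andP[y0 y1] xy.
  by rewrite ltr_sin// in_itv/=; apply/andP; split; lra.
- by rewrite dsin => x _; exact: continuous_cos.
- rewrite dsin; apply: cvgP; apply: cvg_at_right_filter; exact: continuous_cos.
- rewrite dsin; apply: cvgP; apply: cvg_at_left_filter; exact: continuous_cos.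
- split; first by move=> x _; exact: ex_derive.
  + by apply: cvg_at_right_filter; exact: continuous_sin.
  + by apply: cvg_at_left_filter; exact: continuous_sin.
- exact: tail_continuous.
Qed.

End mean_maximum.

Section expected_maximum.
Context {R : realType} {d : measure_display} {T : measurableType d}.
Variables (P : probability T R) (X Y : R -> T -> R).
Hypothesis BM : planar_BM P X Y.
Variables (c s : R).
Hypothesis cs1 : c ^+ 2 + s ^+ 2 = 1.

Let M := max_horiz (component X Y c s) (component X Y (- s) c).

Lemma fin_maximum w : M w = (fine (M w))%:E.
Proof.
have [M0 M1] := maximum_bounds BM c s w; rewrite fineK//.
by rewrite ge0_fin_numE//; apply: le_lt_trans M1 (ltry _).
Qed.

Lemma integral_maximum : (\int[P]_w M w)%E =
  (\int[lebesgue_measure]_(t in `[0%R, (pi / 2)%R]) (mean_integrand t)%:E)%E.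
Proof.
have mZ : measurable_fun setT (fun w => fine (M w)).
  by apply: (measurableT_comp (fine_measurable measurableT)); exact: (measurable_maximum BM c s).
pose Z : {RV P >-> R} := mfun_Sub (mem_set mZ).
have ZE w : Z w = fine (M w) by [].
transitivity ('E_P[Z])%E.
  by rewrite unlock; apply: eq_integral => w _; rewrite -fin_maximum.
rewrite ge0_expectation_ccdf; last first.
  by move=> w; rewrite ZE fine_ge0//; exact: (maximum_bounds BM c s w).1.
have ccdfE r : ccdf Z r = P [set w | (r%:E < M w)%E].
  rewrite /ccdf /distribution /pushforward; congr (P _); apply/seteqP.
  by split=> w /=; rewrite in_itv/= andbT fin_maximum lte_fin.
have mtail : measurable_fun (`[0%R, 1%R] : set R) (fun a : R => (tail a)%:E).
  apply/measurable_EFinP; apply: subspace_continuous_measurable_fun => //.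
  exact: tail_continuous.
rewrite -integral_tail -integral_itv_obnd_cbnd; last first.
  by apply: measurable_funTS; exact: ccdf_measurable.
rewrite -[RHS]integral_itv_obnd_cbnd; last first.
  by apply: measurable_funS mtail => //; exact: subset_itv_oc_cc.
rewrite [LHS]integral_mkcond [RHS]integral_mkcond.
apply: eq_integral => r _; rewrite !patchE !mem_setE !in_itv/= andbT.
case: ifPn => r0 //=; rewrite ccdfE; have [r1|r1] := ltP r 1.
  by rewrite ltW// (max_horiz_tail_gt BM cs1).
rewrite [LHS](_ : _ = 0%E); last first.
  rewrite -(measure0 P); congr (P _); apply/seteqP; split=> w //=.
  rewrite ltNge => /negP; apply.
  by apply: (le_trans (maximum_bounds BM c s w).2); rewrite lee_fin.
case: ifPn => // r1'; have -> : r = 1 by apply/eqP; rewrite eq_le r1'.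
by rewrite /tail acos1 mul0r.
Qed.

End expected_maximum.

Section mean_value.
Context {R : realType}.

Definition mean_value : R :=
  fine (\int[lebesgue_measure]_(t in `[0%R, (pi / 2)%R]) (mean_integrand t)%:E)%E.

Let continuous_of_derive (f df : R -> R) :
  (forall x, is_derive x (1 : R) f (df x)) -> continuous f.
Proof.
move=> H x; apply: differentiable_continuous; apply/derivable1_diffP.
by have := H x; exact: @ex_derive.
Qed.

(** With [v = pi / 2 + t] one has [1 - 2 t / v = pi / v - 1] and [cos t = sin v], so the integrand
    of the mean is [pi sin v / v - cos t]. Here [sinc_poly] replaces [sin v / v], which makes the
    primitive explicit. *)
Let comparison (n : nat) (t : R) : R := pi * sinc_poly n (pi / 2 + t) - cos t.

Let continuous_shift (f : R -> R) : continuous f ->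
  continuous (fun t => f (pi / 2 + t)).
Proof.
move=> cf t; apply: (@continuous_comp _ _ _ (fun t => pi / 2 + t) f); last exact: cf.
by apply: cvgD => //; exact: cvg_cst.
Qed.

Let continuous_comparison n : continuous (comparison n).
Proof.
move=> t; apply: cvgB; last exact: continuous_cos.
apply: cvgM; first exact: cvg_cst.
apply: (continuous_shift (f := sinc_poly n)).
pose df (k : nat) (u : R) : R := (-1) ^+ k / (k.*2.+1)`!%:R * (k.*2%:R * u ^+ k.*2.-1).
apply: (@continuous_of_derive _ (fun u => \sum_(k < n) df k u)) => u.
apply: (@is_derive_bigsum _ n (fun k u => (-1) ^+ k / (k.*2.+1)`!%:R * u ^+ k.*2) df).
by move=> k; exact: is_derive_monomial.
Qed.

Let integral_comparison n :
  (\int[lebesgue_measure]_(t in `[0%R, (pi / 2)%R]) (comparison n t)%:E)%E =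
  (sinint_gap n pi)%:E.
Proof.
pose F (t : R) : R := pi * sinint_poly n (pi / 2 + t) - sin t.
have dF t : is_derive t (1:R) F (comparison n t).
  have dS : is_derive t (1:R) (fun t => sinint_poly n (pi / 2 + t)) (sinc_poly n (pi / 2 + t)).
    have dI : is_derive t (1:R) (cst (pi / 2) + id : R -> R) 1.
      by apply: is_derive_eq; exact: add0r.
    rewrite -[sinc_poly _ _]mulr1; apply: is_derive1_comp dI.
    exact: is_derive_sinint_poly.
  have -> : F = (pi \*: (fun t => sinint_poly n (pi / 2 + t))) - sin by [].
  apply: is_derive_eq; by [].
have cF := continuous_of_derive dF.
rewrite (@continuous_FTC2 _ (comparison n) F).
- rewrite /F -EFinB /sinint_gap addr0 sin0 sin_pihalf; congr EFin.
  by rewrite -splitr; ring.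
- by rewrite divr_gt0// pi_gt0.
- by apply: continuous_subspaceT; exact: continuous_comparison.
- split.
  + by move=> x _; exact: ex_derive.
  + by apply: cvg_at_right_filter; exact: cF.
  + by apply: cvg_at_left_filter; exact: cF.
- by move=> x _; rewrite derive1E derive_val.
Qed.

Let integrable_comparison n :
  lebesgue_measure.-integrable `[0, pi / 2]%classic (EFin \o comparison n).
Proof.
apply: continuous_compact_integrable; first exact: segment_compact.
by apply: continuous_subspaceT; exact: continuous_comparison.
Qed.

Let integrable_mean_integrand :
  lebesgue_measure.-integrable `[0, pi / 2]%classic (EFin \o @mean_integrand R).
Proof.
apply: continuous_compact_integrable; first exact: segment_compact.
have p0 := pi_gt0 R.
have q0 : 0 < pi / 2 :> R by rewrite divr_gt0.
apply: (@continuous_in_subspaceT _ _ _ (@mean_integrand R)) => t.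
rewrite inE/= in_itv/= => /andP[t0 _].
apply: cvgM; last exact: continuous_cos.
apply: cvgB; first exact: cvg_cst.
apply: cvgM; first by apply: cvgM => //; exact: cvg_cst.
apply: cvgV; first by apply/lt0r_neq0; lra.
by apply: cvgD => //; exact: cvg_cst.
Qed.

Lemma mean_value_bounds : sinint_gap 10 pi <= mean_value /\ mean_value <= sinint_gap 9 pi.
Proof.
have p0 := pi_gt0 R.
have gapE n : sinint_gap n pi = \int[lebesgue_measure]_(t in `[0%R, (pi / 2)%R]) comparison n t.
  by rewrite /Rintegral integral_comparison.
have sE (t : R) : 0 <= t -> t <= pi / 2 ->
    mean_integrand t = pi / (pi / 2 + t) * sin (pi / 2 + t) - cos t.
  move=> t0 t1; have -> : sin (pi / 2 + t) = cos t by rewrite addrC sinDpihalf.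
  by rewrite /mean_integrand; field; lra.
have cE n (t : R) : 0 <= t ->
    comparison n t = pi / (pi / 2 + t) * sin_poly n (pi / 2 + t) - cos t.
  move=> t0; rewrite /comparison -sinc_polyE; field; lra.
rewrite !gapE /mean_value; split; apply: le_Rintegral => // t;
  rewrite /= in_itv/= => /andP[t0 t1]; rewrite cE// sE// lerD2r;
  apply: ler_wpM2l; rewrite ?divr_ge0//; try lra.
  by apply: sin_ge_poly => //; lra.
by apply: sin_le_poly => //; lra.
Qed.

Lemma mean_value_approx : 5116 / 10 ^+ 4 + 554 / 10 ^+ 7 < mean_value /\
  mean_value < 5116 / 10 ^+ 4 + 555 / 10 ^+ 7.
Proof.
have [h1 h2] := @sinint_gap_bounds R; have [k1 k2] := mean_value_bounds.
by split; [exact: lt_le_trans k1|exact: le_lt_trans h1].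
Qed.

End mean_value.

(** * Perimeter of a planar convex set *)

Section planar_vectors.
Context {R : realType}.
Implicit Types (p q : R * R) (a b t : R).

Definition dot p q : R := p.1 * q.1 + p.2 * q.2.
Definition dir a : R * R := (cos a, sin a).
Definition tang a : R * R := (- sin a, cos a).

Lemma dotBl p q v : dot (p - q) v = dot p v - dot q v.
Proof. by rewrite /dot/=; ring. Qed.

Lemma tang_decomp a b p :
  dot p (tang b) = cos (b - a) * dot p (tang a) - sin (b - a) * dot p (dir a).
Proof.
rewrite -[b in LHS](subrK a) /dot/=; move: (b - a) => c; rewrite sinD cosD; ring.
Qed.

Lemma dir_decomp a b p :
  dot p (dir b) = cos (b - a) * dot p (dir a) + sin (b - a) * dot p (tang a).
Proof.
rewrite -[b in LHS](subrK a) /dot/=; move: (b - a) => c; rewrite sinD cosD; ring.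
Qed.

Lemma dist2_sqr p q : dist2 p q ^+ 2 = (p.1 - q.1) ^+ 2 + (p.2 - q.2) ^+ 2.
Proof. by rewrite sqr_sqrtr// addr_ge0 ?sqr_ge0. Qed.

Lemma dist2_tang_dir a p q :
  dist2 p q ^+ 2 = dot (p - q) (dir a) ^+ 2 + dot (p - q) (tang a) ^+ 2.
Proof.
rewrite dist2_sqr /dot/=.
transitivity (((p.1 - q.1) ^+ 2 + (p.2 - q.2) ^+ 2) * (cos a ^+ 2 + sin a ^+ 2)).
  by rewrite cos2Dsin2 mulr1.
ring.
Qed.

Lemma dist2_ge0 p q : 0 <= dist2 p q. Proof. exact: sqrtr_ge0. Qed.

Lemma dot_tang_le_dist a p q : `|dot (p - q) (tang a)| <= dist2 p q.
Proof.
rewrite -ler_sqr ?nnegrE ?dist2_ge0// real_normK ?num_real//.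
by rewrite (dist2_tang_dir a) lerDr sqr_ge0.
Qed.

Lemma tangD2pi a : tang (a + 2 * pi) = tang a.
Proof. by rewrite /tang mulr_natl sinD2pi cosD2pi. Qed.

Lemma dirD2pi a : dir (a + 2 * pi) = dir a.
Proof. by rewrite /dir mulr_natl sinD2pi cosD2pi. Qed.

Lemma unit_vector_dir (u v : R) : u ^+ 2 + v ^+ 2 = 1 ->
  exists2 a, 0 <= a <= 2 * pi & dir a = (u, v).
Proof.
move=> uv1; have u11 : -1 <= u <= 1.
  by rewrite -ler_norml -(@ler_sqr _ `|u|) ?nnegrE// real_normK ?num_real// expr1n -uv1 lerDl sqr_ge0.
have v2 : 1 - u ^+ 2 = v ^+ 2 by rewrite -uv1; ring.
have a0 := acos_ge0 u11; have ap := acos_lepi u11; have p0 := pi_gt0 R.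
have ce := acosK (x := u); rewrite in_itv/= u11 in ce.
have [v0|v0] := leP 0 v.
  exists (acos u); first by apply/andP; split; lra.
  by rewrite /dir ce// sin_acos// v2 sqrtr_sqr ger0_norm.
exists (- acos u + 2 * pi); first by apply/andP; split; lra.
by rewrite dirD2pi /dir cosN sinN ce// sin_acos// v2 sqrtr_sqr ltr0_norm// opprK.
Qed.

Lemma continuous_dir : continuous (dir : R -> R * R).
Proof.
move=> a.
exact: (cvg_pair (@continuous_cos R a) (@continuous_sin R a)).
Qed.

Lemma continuous_dot (T : topologicalType) (f g : T -> R * R) :
  continuous f -> continuous g -> continuous (fun x => dot (f x) (g x)).
Proof.
move=> cf cg x.
have c1 (h : T -> R * R) : continuous h -> h y @[y --> x] --> h x by exact.
have f1 : (f y).1 @[y --> x] --> (f x).1 by apply: cvg_comp (c1 _ cf) _; exact: cvg_fst.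
have f2 : (f y).2 @[y --> x] --> (f x).2 by apply: cvg_comp (c1 _ cf) _; exact: cvg_snd.
have g1 : (g y).1 @[y --> x] --> (g x).1 by apply: cvg_comp (c1 _ cg) _; exact: cvg_fst.
have g2 : (g y).2 @[y --> x] --> (g x).2 by apply: cvg_comp (c1 _ cg) _; exact: cvg_snd.
by apply: cvgD; apply: cvgM.
Qed.

Lemma support_point (C : set (R * R)) (v : R * R) : compact C -> C !=set0 ->
  exists x, C x /\ forall y, C y -> dot y v <= dot x v.
Proof.
move=> compactC C0.
have cf : continuous (fun x : R * R => dot x v).
  by apply: continuous_dot => x; [exact: cvg_id|exact: cvg_cst].
have [x /set_mem Cx xmax] := compact_EVT_max C0 compactC (continuous_subspaceT cf).
by exists x; split => // y /mem_set; exact: xmax.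
Qed.

End planar_vectors.

Section faces.
Context {R : realType}.
Variable C : set (R * R).
Hypotheses (compactC : compact C) (convexC : convex_set2 C).
Implicit Types (a b s t : R) (x y : R * R).

Definition face (a : R) (x : R * R) : Prop :=
  C x /\ forall y, C y -> dot y (dir a) <= dot x (dir a).

Lemma face_exists a : C !=set0 -> exists x, face a x.
Proof. exact: support_point. Qed.

Lemma face_le a b x y : face a x -> face b y -> dot (y - x) (dir a) <= 0.
Proof. by move=> [_ h] [Cy _]; rewrite dotBl subr_le0; exact: h. Qed.

Lemma face_segment a x y s t : face a x -> face a y ->
  dot x (tang t) <= s -> s <= dot y (tang t) ->
  exists2 z, face a z & dot z (tang t) = s.
Proof.
move=> fx fy xs sy; have [xy|xy] := eqVneq (dot x (tang t)) (dot y (tang t)).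
  by exists x => //; apply/eqP; rewrite eq_le xs xy sy.
have d0 : 0 < dot y (tang t) - dot x (tang t).
  by rewrite subr_gt0 lt_neqAle xy (le_trans xs).
pose l := (dot y (tang t) - s) / (dot y (tang t) - dot x (tang t)).
have l0 : 0 <= l by apply: divr_ge0; [rewrite subr_ge0|exact: ltW].
have l1 : l <= 1 by rewrite ler_pdivrMr// mul1r lerB.
have comb v : dot (l * x.1 + (1 - l) * y.1, l * x.2 + (1 - l) * y.2) v =
    l * dot x v + (1 - l) * dot y v by rewrite /dot/=; ring.
exists (l * x.1 + (1 - l) * y.1, l * x.2 + (1 - l) * y.2); last first.
  rewrite comb /l; field; exact: lt0r_neq0.
split=> [|z Cz]; first by apply: convexC => //; [exact: fx.1|exact: fy.1].
rewrite comb; have := ler_wpM2l l0 (fx.2 z Cz).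
have l1' : 0 <= 1 - l by rewrite subr_ge0.
have := ler_wpM2l l1' (fy.2 z Cz); lra.
Qed.

(** The normal bundle of [C] over an arc of directions. Its compactness allows extremal angles to be
    chosen among those whose face satisfies a closed condition. *)
Definition face_graph a b : set (R * (R * R)) :=
  [set z | (a <= z.1 <= b) /\ face z.1 z.2].

Lemma compact_face_graph a b : compact (face_graph a b).
Proof.
apply: (@subclosed_compact _ _ (`[a, b] `*` C)); last first.
- by move=> [u x] [/= ub [Cx _]]; split => //=; rewrite in_itv.
- by apply: compact_setX => //; exact: segment_compact.
have -> : face_graph a b = (`[a, b] `*` C) `&`
    \bigcap_(y in C) [set z : R * (R * R) | dot y (dir z.1) <= dot z.2 (dir z.1)].
  apply/seteqP; split=> [[u x] [/= ub [Cx h]]|[u x] [[/= ub Cx] h]].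
    by split; [split => //=; rewrite in_itv|move=> y Cy /=; exact: h].
  by split=> /=; [move: ub; rewrite in_itv|split => // y /h].
have cfst : continuous (fun z : R * (R * R) => dir z.1).
  move=> z; apply: continuous_comp; [exact: cvg_fst|exact: continuous_dir].
apply: closedI.
  apply: compact_closed; first exact: norm_hausdorff.
  by apply: compact_setX => //; exact: segment_compact.
apply: closed_bigI => y Cy.
have -> : [set z : R * (R * R) | dot y (dir z.1) <= dot z.2 (dir z.1)] =
    (fun z : R * (R * R) => dot (z.2 - y) (dir z.1)) @^-1` [set u | 0 <= u].
  by apply/seteqP; split=> z /=; rewrite dotBl subr_ge0.
apply: preimage_closed; last exact: closed_ge.
move=> z _; apply: continuous_dot => // {}z.
by apply: cvgB; [exact: cvg_snd|exact: cvg_cst].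
Qed.

Definition face_slice a b t (D : set R) : set (R * (R * R)) :=
  face_graph a b `&` [set z | D (dot z.2 (tang t))].

Lemma compact_face_slice a b t D : closed D -> compact (face_slice a b t D).
Proof.
move=> cD; apply: (@subclosed_compact _ _ (face_graph a b)).
- apply: closedI.
    by apply: compact_closed; [exact: norm_hausdorff|exact: compact_face_graph].
  apply: (@preimage_closed _ _ (fun z : R * (R * R) => dot z.2 (tang t)) D) => // z _.
  by apply: continuous_dot => {}z; [exact: cvg_snd|exact: cvg_cst].
- exact: compact_face_graph.
- exact: subIsetl.
Qed.

Let slice_angles a b t D : closed D -> compact [set z.1 | z in face_slice a b t D].
Proof.
move=> cD; apply: continuous_compact; last exact: compact_face_slice.
by apply: continuous_subspaceT => z; exact: cvg_fst.
Qed.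

(* The angles having a face point below level [s] and those having one above
   level [s] form two compact sets covering [[a, b]]; at a common angle the
   whole face is convex. *)
Lemma face_between_attains a b t s p q : C !=set0 -> a <= b -> face a p -> face b q ->
  dot p (tang t) <= s -> s <= dot q (tang t) ->
  exists phi z, [/\ a <= phi <= b, face phi z & dot z (tang t) = s].
Proof.
move=> C0 ab fp fq ps sq.
pose lo := [set z.1 | z in face_slice a b t [set u | u <= s]].
have lo0 : lo !=set0 by exists a, (a, p) => //; split => //; split; rewrite //= lexx ab.
have cid : continuous (@id R) by move=> u; exact: cvg_id.
have [phi /set_mem phi_lo phi_max] := compact_EVT_max lo0
  (slice_angles (closed_le (y := s))) (continuous_subspaceT cid).
have [[u x] [[/= /andP[aphi phib] fx] xs] /= phiE] := phi_lo.
subst u.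
pose hi := [set z.1 | z in face_slice phi b t [set u | s <= u]].
have hi0 : hi !=set0 by exists b, (b, q) => //; split => //; split; rewrite //= lexx phib.
have [psi /set_mem psi_hi psi_min] := compact_EVT_min hi0
  (slice_angles (closed_ge (y := s))) (continuous_subspaceT cid).
have [[u y] [[/= /andP[phipsi psib] fy] sy] /= psiE] := psi_hi.
subst u.
have [psiphi|phi_psi] := leP psi phi.
  have e : psi = phi by apply/eqP; rewrite eq_le psiphi.
  rewrite e in fy; have [z fz zs] := face_segment fx fy xs sy.
  by exists phi, z; split => //; apply/andP.
(* A face point at an angle strictly between [phi] and [psi] lies below or above the level [s],
   against the maximality of [phi] or the minimality of [psi]. *)
have [z fz] := face_exists ((phi + psi) / 2) C0.
have [zs|/ltW sz] := leP (dot z (tang t)) s.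
- suff /mem_set/phi_max : lo ((phi + psi) / 2) by rewrite /= => h; exfalso; lra.
  exists ((phi + psi) / 2, z) => //; split => //; split => //=.
  by apply/andP; split; lra.
- suff /mem_set/psi_min : hi ((phi + psi) / 2) by rewrite /= => h; exfalso; lra.
  exists ((phi + psi) / 2, z) => //; split => //; split => //=.
  by apply/andP; split; lra.
Qed.

(** Less than a half turn apart, the normals [a] and [b] of [x] generate every direction between
    them with nonnegative coefficients, so [x] lies on the face at [th] along with [q]. Two distinct
    points of that face leave no room for normals on one of the two sides of [th]. *)
Lemma face_overlap a th b x q : a <= th -> th <= b -> b - a < pi ->
  face a x -> face b x -> face th q ->
  [/\ dot (x - q) (dir th) = 0, (dot (x - q) (tang th) < 0 -> b = th) &
      (0 < dot (x - q) (tang th) -> a = th)].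
Proof.
move=> ath thb ba fa fb fq.
have da : 0 <= dot (x - q) (dir a) by rewrite dotBl subr_ge0; exact: fa.2 fq.1.
have db : 0 <= dot (x - q) (dir b) by rewrite dotBl subr_ge0; exact: fb.2 fq.1.
have dth : dot (x - q) (dir th) <= 0 by exact: face_le fq fa.
have [ab|ab] := eqVneq a b.
  have e : a = th by apply/eqP; rewrite eq_le ath ab thb.
  by rewrite -ab e; split => //; apply/eqP; rewrite eq_le dth -e da.
move: da db dth; rewrite (dir_decomp th a) (dir_decomp th b).
set D := dot _ (dir th); set U := dot _ (tang th) => da db dth.
have sba : 0 < sin (b - a).
  by apply: sin_gt0_pi; rewrite subr_gt0 lt_neqAle ab (le_trans ath).
have sb : 0 <= sin (b - th) by apply: sin_ge0_pi; apply/andP; split; lra.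
have sa : 0 <= sin (th - a) by apply: sin_ge0_pi; apply/andP; split; lra.
have D0 : D = 0.
  apply/eqP; rewrite eq_le dth -(pmulr_rge0 _ sba).
  (* This is [sin (b - a) dir th = sin (b - th) dir a + sin (th - a) dir b], paired with [x - q]. *)
  have -> : sin (b - a) * D = sin (b - th) * (cos (a - th) * D + sin (a - th) * U)
     + sin (th - a) * (cos (b - th) * D + sin (b - th) * U).
    rewrite -(opprB th a) cosN sinN (_ : b - a = (b - th) + (th - a)); last by ring.
    by rewrite sinD; ring.
  by rewrite addr_ge0// mulr_ge0.
move: da db; rewrite D0 !mulr0 !add0r => da db; split=> // U0.
- apply/eqP; rewrite eq_le thb andbT leNgt; apply/negP => bth.
  have : 0 < sin (b - th) by apply: sin_gt0_pi; apply/andP; split; lra.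
  by move=> s0; move: db; rewrite leNgt pmulr_rlt0// U0.
- apply/eqP; rewrite eq_le ath /= leNgt; apply/negP => bth.
  have : 0 < sin (th - a) by apply: sin_gt0_pi; apply/andP; split; lra.
  by move=> s0; move: da; rewrite leNgt -(opprB th a) sinN mulNr oppr_lt0 mulr_gt0.
Qed.

(** The boundary point moves counterclockwise with its normal: the support inequalities at [a] and
    at [b], for a turn below [pi / 2], determine the sign of the tangential component. *)
Lemma face_tang_ge0 a b x p : face a p -> face b x -> a < b -> b - a < pi / 2 ->
  0 <= dot (x - p) (tang a).
Proof.
move=> fp fx ab bap; have p0 := pi_gt0 R.
have h1 : dot (x - p) (dir a) <= 0 by exact: face_le fp fx.
have h2 : 0 <= dot (x - p) (dir b) by rewrite dotBl subr_ge0; exact: fx.2 fp.1.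
have c0 : 0 < cos (b - a) by apply: cos_gt0_pihalf; apply/andP; split; lra.
have s0 : 0 < sin (b - a) by apply: sin_gt0_pi; apply/andP; split; lra.
rewrite (dir_decomp a) in h2; rewrite -(pmulr_rge0 _ s0).
have := mulr_ge0_le0 (ltW c0) h1; lra.
Qed.

Lemma face_tang_le0 a b x q : face b q -> face a x -> a < b -> b - a < pi / 2 ->
  dot (x - q) (tang b) <= 0.
Proof.
move=> fq fx ab bap; have p0 := pi_gt0 R.
have h1 : dot (x - q) (dir b) <= 0 by exact: face_le fq fx.
have h2 : 0 <= dot (x - q) (dir a) by rewrite dotBl subr_ge0; exact: fx.2 fq.1.
have c0 : 0 < cos (b - a) by apply: cos_gt0_pihalf; apply/andP; split; lra.
have s0 : 0 < sin (b - a) by apply: sin_gt0_pi; apply/andP; split; lra.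
rewrite (dir_decomp b) -(opprB b a) cosN sinN in h2; rewrite -(pmulr_rle0 _ s0).
have := mulr_ge0_le0 (ltW c0) h1; lra.
Qed.

(* The two tangential conditions only matter for points of the extreme faces,
   which two consecutive pieces share. *)
Definition boundary_piece a b p q : set (R * R) :=
  [set x | [/\ exists2 phi, a <= phi <= b & face phi x,
               0 <= dot (x - p) (tang a) & dot (x - q) (tang b) <= 0]].

Lemma boundary_piece_tang a b p q x : a < b -> b - a < pi / 2 ->
  face a p -> face b q -> boundary_piece a b p q x ->
  dot p (tang ((a + b) / 2)) <= dot x (tang ((a + b) / 2)) <= dot q (tang ((a + b) / 2)).
Proof.
move=> ab bap fp fq [[phi _ fx] xp xq]; have p0 := pi_gt0 R.
rewrite -subr_ge0 -dotBl -[X in _ && X]subr_le0 -dotBl.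
have c0 : 0 < cos ((b - a) / 2) by apply: cos_gt0_pihalf; apply/andP; split; lra.
have s0 : 0 < sin ((b - a) / 2) by apply: sin_gt0_pi; apply/andP; split; lra.
rewrite (tang_decomp a _ (x - p)) (tang_decomp b _ (x - q)).
rewrite (_ : (a + b) / 2 - a = (b - a) / 2); last by field.
rewrite (_ : (a + b) / 2 - b = - ((b - a) / 2)); last by field.
rewrite cosN sinN mulNr opprK.
have h1 := mulr_ge0_le0 (ltW s0) (face_le fp fx).
have h2 := mulr_ge0_le0 (ltW s0) (face_le fq fx).
have k1 := mulr_ge0 (ltW c0) xp; have k2 := mulr_ge0_le0 (ltW c0) xq.
by apply/andP; split; lra.
Qed.

(** The normals at [x] and at [y] give opposite linear inequalities on [x - y]. They bound its
    component along the middle normal by [tan ((b - a) / 2)] times the tangential one, and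
    [1 + tan^2 = 1 / cos^2] yields the constant. *)
Lemma boundary_piece_lipschitz a b p q x y : a < b -> b - a < pi / 2 ->
  boundary_piece a b p q x -> boundary_piece a b p q y ->
  cos ((b - a) / 2) * dist2 x y <= `|dot (x - y) (tang ((a + b) / 2))|.
Proof.
move=> ab bap [[phi phiab fx] _ _] [[psi psiab fy] _ _]; have p0 := pi_gt0 R.
set m := (a + b) / 2; set c := cos _; set U := dot _ _.
have c0 : 0 < c by apply: cos_gt0_pihalf; apply/andP; split; lra.
have s0 : 0 < sin ((b - a) / 2) by apply: sin_gt0_pi; apply/andP; split; lra.
have cc z : a <= z <= b -> c <= cos (z - m).
  move=> /andP[az zb].
  have -> : cos (z - m) = cos `|z - m| by have [_|_] := ger0P (z - m); rewrite // -[LHS]cosN.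
  have zm : `|z - m| <= (b - a) / 2 by rewrite ler_norml /m; apply/andP; split; lra.
  have := normr_ge0 (z - m) => zm0.
  by rewrite leNgt ltr_cos -?leNgt// in_itv/=; apply/andP; split; lra.
have ss z : a <= z <= b -> `|sin (z - m)| <= sin ((b - a) / 2).
  move=> /andP[az zb]; rewrite ler_norml -sinN.
  by rewrite !leNgt !ltr_sin -?leNgt ?in_itv/= /m; repeat (apply/andP; split); lra.
have h1 : 0 <= dot (x - y) (dir phi) by rewrite dotBl subr_ge0; exact: fx.2 fy.1.
have h2 : dot (x - y) (dir psi) <= 0 by exact: face_le fy fx.
rewrite (dir_decomp m phi) -/U in h1.
rewrite (dir_decomp m psi) -/U in h2.
have cD : c * `|dot (x - y) (dir m)| <= sin ((b - a) / 2) * `|U|.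
  set D := dot _ (dir m) in h1 h2 *.
  have sU z : a <= z <= b -> `|sin (z - m) * U| <= sin ((b - a) / 2) * `|U|.
    by move=> zab; rewrite normrM ler_wpM2r// ss.
  have [D0|D0] := ger0P D.
    apply: le_trans (sU _ psiab); apply: (@le_trans _ _ (cos (psi - m) * D)).
      by rewrite ler_wpM2r// cc.
    by rewrite -normrN; apply: le_trans (ler_norm _); lra.
  apply: le_trans (sU _ phiab); apply: (@le_trans _ _ (cos (phi - m) * - D)).
    by rewrite ler_wpM2r ?cc// oppr_ge0 ltW.
  by apply: le_trans (ler_norm _); lra.
rewrite -ler_sqr ?nnegrE ?mulr_ge0 ?dist2_ge0 ?(ltW c0)//.
rewrite exprMn (dist2_tang_dir m) -/U real_normK ?num_real// mulrDr.
have e1 : c ^+ 2 + sin ((b - a) / 2) ^+ 2 = 1 by rewrite cos2Dsin2.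
have : (c * `|dot (x - y) (dir m)|) ^+ 2 <= (sin ((b - a) / 2) * `|U|) ^+ 2.
  by rewrite ler_sqr ?nnegrE ?mulr_ge0 ?(ltW c0) ?(ltW s0).
rewrite !exprMn !real_normK ?num_real// -lerBrDr => h.
have e2 : sin ((b - a) / 2) ^+ 2 = 1 - c ^+ 2 by apply/eqP; rewrite eq_sym subr_eq addrC e1.
by move: h; rewrite e2 mulrBl mul1r.
Qed.

End faces.

(** * Upper and lower bounds for the one-dimensional Hausdorff measure *)

Section hausdorff.
Context {R : realType}.
Implicit Types (E U : set (R * R)) (delta : R).

Lemma diam2_ge0 U : (0 <= diam2 U)%E.
Proof. by apply: ereal_sup_ubound; left. Qed.

Lemma dist2_le_diam2 U p q : U p -> U q -> ((dist2 p q)%:E <= diam2 U)%E.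
Proof. by move=> Up Uq; apply: ereal_sup_ubound; right; exists p => //; exists q. Qed.

Lemma diam2_le U (e : R) : 0 <= e -> (forall p q, U p -> U q -> dist2 p q <= e) ->
  (diam2 U <= e%:E)%E.
Proof.
move=> e0 Ue; apply/ereal_supP => _ [->|[p Up [q Uq <-]]]; rewrite lee_fin//.
exact: Ue.
Qed.

(** The finite cover is continued by empty sets, whose diameter is 0 by convention. *)
Lemma hausdorff1_delta_le_cover (I : finType) (U : I -> set (R * R)) (e : I -> R)
    E delta : 0 <= delta -> E `<=` \bigcup_i U i ->
  (forall i, (diam2 (U i) <= (e i)%:E)%E) -> (forall i, e i <= delta) ->
  (hausdorff1_delta E delta <= (\sum_i e i)%:E)%E.
Proof.
move=> d0 EU Ue ed.
have diam0 : (diam2 (set0 : set (R * R)) <= 0%:E)%E by apply: diam2_le.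
pose V n := if insub n is Some k then U (@enum_val I predT k) else set0.
apply: (@le_trans _ _ (\sum_(0 <= i <oo) diam2 (V i))%E).
  apply: ereal_inf_lbound; exists V => //; split=> [x /EU[i _ Ux]|n].
    exists (enum_rank i) => //; rewrite /V insubT//= => h.
    by rewrite (_ : Sub _ _ = enum_rank i) ?enum_rankK//; exact: val_inj.
  rewrite /V; case: insubP => [k _ _|_].
    by apply: le_trans (Ue _) _; rewrite lee_fin.
  by apply: le_trans diam0 _; rewrite lee_fin.
rewrite (nneseries_split 0 #|I|); last by move=> k _; exact: diam2_ge0.
rewrite add0n [X in (_ + X)%E]eseries0 ?adde0; last first.
  move=> i Ii _; rewrite /V insubN -?leqNgt//.
  by apply/eqP; rewrite eq_le diam0 diam2_ge0.
rewrite big_mkord -sumEFin [leRHS](reindex _ (onW_bij _ (@enum_val_bij I)))/=.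
apply: lee_sum => k _; rewrite /V valK; exact: Ue.
Qed.

(** At scale [rho / 2] a covering set meets at most one slice, so its diameter is charged to a
    single index and the projected lengths add up. *)
Lemma hausdorff1_ge_slices (I : finType) (A : I -> set (R * R)) (t a b : I -> R)
    E (rho : R) : 0 < rho -> (forall i, A i `<=` E) ->
  (forall i j x y, i != j -> A i x -> A j y -> rho <= dist2 x y) ->
  (forall i s, a i <= s -> s <= b i -> exists2 x, A i x & dot x (tang (t i)) = s) ->
  ((\sum_i (b i - a i))%:E <= hausdorff1 E)%E.
Proof.
move=> rho0 AE sepA projA; have rho20 : 0 < rho / 2 by rewrite divr_gt0.
apply: (@le_trans _ _ (hausdorff1_delta E (rho / 2))); last first.
  by apply: ereal_sup_ubound; exists (rho / 2).
apply/ereal_infP => _ [U [EU Ud] <-].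
pose S i n := [set dot x (tang (t i)) | x in U n `&` A i].
pose m i n : \bar R := if `[< S i n !=set0 >] then diam2 (U n) else 0%E.
have m0 i n : (0 <= m i n)%E by rewrite /m; case: ifP => // _; exact: diam2_ge0.
pose w n := fine (diam2 (U n)).
have wE n : diam2 (U n) = (w n)%:E.
  rewrite fineK// ge0_fin_numE ?diam2_ge0//.
  exact: le_lt_trans (Ud n) (ltry _).
have Sw i n s s' : S i n s -> S i n s' -> s - w n <= s'.
  move=> [x [Ux _] <-] [y [Uy _] <-]; have := dist2_le_diam2 Ux Uy.
  rewrite wE lee_fin lerBlDr -lerBlDl -dotBl; apply: le_trans.
  exact: le_trans (ler_norm _) (dot_tang_le_dist _ _ _).
(* The interval spanned by the projection: it is measurable whatever [U n] is, and its length is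
   still at most the diameter. *)
pose J i n : set R := if `[< S i n !=set0 >] then `[inf (S i n), sup (S i n)]%classic else set0.
have SJ i n : S i n `<=` J i n.
  move=> s Ss; rewrite /J ifT; last by apply/asboolP; exists s.
  rewrite /= in_itv/=; apply/andP; split.
    by apply: ge_inf => //; exists (s - w n) => s' Ss'; exact: Sw Ss Ss'.
  apply: ub_le_sup => //; exists (s + w n) => s' Ss'.
  by rewrite -lerBlDr; exact: Sw Ss' Ss.
have Jm i n : (lebesgue_measure (J i n) <= m i n)%E.
  rewrite /J /m; case: ifPn => [/asboolP S0|_]; last by rewrite measure0.
  rewrite lebesgue_measure_itv/= lte_fin; case: ifPn => _; last exact: diam2_ge0.
  rewrite wE -EFinB lee_fin lerBlDr; apply: ge_sup => // s Ss.
  rewrite -lerBlDl; apply: lb_le_inf => // s' Ss'.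
  exact: Sw Ss Ss'.
have len i : ((b i - a i)%:E <= \sum_(0 <= n <oo) m i n)%E.
  have [ba|ab] := leP (b i) (a i).
    by apply: le_trans (nneseries_ge0 _); rewrite ?lee_fin ?subr_le0.
  apply: (@le_trans _ _ (lebesgue_measure (`[a i, b i] : set R))).
    by rewrite lebesgue_measure_itv/= lte_fin ab.
  apply: le_trans (lee_nneseries (fun n _ _ => measure_ge0 _ _) (fun n _ => Jm i n)).
  apply: measure_sigma_subadditive => //.
    by move=> n; rewrite /J; case: ifP.
  move=> s; rewrite /= in_itv/= => /andP[as_ sb].
  have [x Ax xs] := projA i s as_ sb; have [n _ Ux] := EU _ (AE _ _ Ax).
  by exists n => //; apply: SJ; exists x.
rewrite -sumEFin; apply: (@le_trans _ _ (\sum_i \sum_(0 <= n <oo) m i n)%E).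
  exact: lee_sum.
rewrite -nneseries_sum//; apply: lee_nneseries => [n _ _|n _]; first exact: sume_ge0.
have [[i [s Si]]|none] := pselect (exists i, S i n !=set0).
  rewrite (bigD1 i)//= big1 ?adde0; last first.
    move=> j ji; rewrite /m; case: ifPn => // /asboolP[_ [y [Uy Ay] _]].
    case: Si => x [Ux Ax] _.
    have := le_trans (dist2_le_diam2 Ux Uy) (Ud n).
    rewrite eq_sym in ji; rewrite lee_fin => /(le_trans (sepA _ _ _ _ ji Ax Ay)).
    by move=> h; exfalso; lra.
  by rewrite /m; case: ifP => // _; exact: diam2_ge0.
rewrite big1 ?diam2_ge0// => i _; rewrite /m; case: ifPn => // /asboolP Si.
by exfalso; apply: none; exists i.
Qed.

End hausdorff.

Section circumscribed_polygon.
Context {R : realType}.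
Variables (C : set (R * R)) (o : R * R) (N : nat) (p : nat -> R * R).
Hypotheses (compactC : compact C) (convexC : convex_set2 C).
Hypothesis interior_o : forall a x, face C a x -> dot (o - x) (dir a) < 0.
Hypothesis N5 : (4 < N)%N.

Let al : R := 2 * pi / N%:R.
Let th (j : nat) : R := j%:R * al.
Let mid (j : nat) : R := (th j + th j.+1) / 2.

Hypotheses (face_p : forall j, face C (th j) (p j)) (p_cyclic : p N = p 0).

Let N0 : 0 < N%:R :> R. Proof. by rewrite ltr0n; exact: ltn_trans N5. Qed.

Let al_gt0 : 0 < al.
Proof. by rewrite /al divr_gt0// mulr_gt0// pi_gt0. Qed.

Let al_lt : al < pi / 2.
Proof.
rewrite /al ltr_pdivrMr//; have p0 := pi_gt0 R.
have : 5 <= N%:R :> R by rewrite ler_nat.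
move=> h; have := ler_wpM2l (ltW (divr_gt0 p0 (ltr0Sn R 1))) h; lra.
Qed.

Let thS j : th j.+1 = th j + al.
Proof. by rewrite /th -natr1 mulrDl mul1r. Qed.

Let thN : th N = 2 * pi.
Proof. by rewrite /th /al mulrC divfK// lt0r_neq0. Qed.

Let th_mono i j : (i <= j)%N -> th i <= th j.
Proof. by move=> ij; rewrite ler_wpM2r ?ler_nat// ltW. Qed.

Let th_lt j : th j < th j.+1. Proof. by rewrite thS ltrDl. Qed.

Let midE j : mid j = th j + al / 2. Proof. by rewrite /mid thS; lra. Qed.
Let midSE j : mid j = th j.+1 - al / 2. Proof. by rewrite /mid thS; lra. Qed.

Let cos_half : 0 < cos (al / 2).
Proof. by have := al_gt0; have := al_lt => h1 h2; apply: cos_gt0_pihalf; apply/andP; split; lra. Qed.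

Definition side_length (j : nat) : R := dot (p j.+1 - p j) (tang (mid j)).

(* Summation by parts, since the tangents at the angles [th j -+ al / 2] differ
   by [2 sin (al / 2)] times the direction at angle [th j]. *)
Lemma sum_side_length :
  \sum_(j < N) side_length j = 2 * sin (pi / N%:R) * \sum_(j < N) dot (p j) (dir (th j)).
Proof.
have -> : pi / N%:R = al / 2 by rewrite /al; field; exact: lt0r_neq0.
pose F j := dot (p j) (tang (th j - al / 2)).
have -> : \sum_(j < N) side_length j =
    \sum_(j < N) (F j.+1 - F j) + \sum_(j < N) 2 * sin (al / 2) * dot (p j) (dir (th j)).
  rewrite -big_split; apply: eq_bigr => j _ /=.
  rewrite /side_length dotBl {1}midSE midE /F.
  rewrite (tang_decomp (th j) (th j + _) (p j)) (tang_decomp (th j) (th j - _) (p j)).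
  rewrite (addrC (th j) (al / 2)) (addrC (th j) (- _)) !addrK cosN sinN; ring.
rewrite -(big_mkord xpredT (fun j => F j.+1 - F j)) telescope_sumr// /F p_cyclic thN.
rewrite (_ : th 0 - al / 2 = - (al / 2)); last by rewrite /th mul0r sub0r.
by rewrite [2 * pi - _]addrC tangD2pi subrr add0r -mulr_sumr.
Qed.

Let face_dir a b x : dir a = dir b -> face C a x -> face C b x.
Proof. by rewrite /face => ->. Qed.

Let dirB2pi (a : R) : dir (a - 2 * pi) = dir a.
Proof. by rewrite -[in RHS](subrK (2 * pi) a) dirD2pi. Qed.

Let tangB2pi (a : R) : tang (a - 2 * pi) = tang a.
Proof. by rewrite -[in RHS](subrK (2 * pi) a) tangD2pi. Qed.

(** Consecutive pieces share a marked point; trimming their projections by [eta] at both ends makes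
    them disjoint, at a cost [2 eta] per side that can be made arbitrarily small. *)
Let in_slice (eta : R) (j : nat) (x : R * R) :=
  [/\ exists2 phi, th j <= phi <= th j.+1 & face C phi x,
      dot (p j) (tang (mid j)) + eta <= dot x (tang (mid j)) &
      dot x (tang (mid j)) <= dot (p j.+1) (tang (mid j)) - eta].

Let face_tang_sign (q x : R * R) (a b : R) : dot (x - q) (dir a) = 0 ->
  `|b - a| = al / 2 ->
  (dot (x - q) (tang b) < 0 -> dot (x - q) (tang a) < 0) /\
  (0 < dot (x - q) (tang b) -> 0 < dot (x - q) (tang a)).
Proof.
move=> D0 ba; rewrite (tang_decomp a) D0 mulr0 subr0.
have -> : cos (b - a) = cos (al / 2).
  by rewrite -ba; have [_|_] := ger0P (b - a); rewrite // -[LHS]cosN.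
by rewrite pmulr_rlt0// pmulr_rgt0.
Qed.

(* A common point would have a normal in each of two arcs, hence would lie on
   the face at the angle separating them, on both sides of its marked point. *)
Lemma slices_disjoint eta j k x : 0 < eta -> (j < k)%N -> (k < N)%N ->
  in_slice eta j x -> in_slice eta k x -> False.
Proof.
move=> eta0 jk kN [[phi /andP[phi1 phi2] fphi] xj1 xj2] [[psi /andP[psi1 psi2] fpsi] xk1 xk2].
have p0 := pi_gt0 R; have al0 := al_gt0.
have thj0 : 0 <= th j by rewrite mulr_ge0// ltW.
have thk : th k.+1 <= 2 * pi by rewrite -thN; exact: th_mono.
have jk' := th_mono jk.
have nj1 : `|mid j - th j.+1| = al / 2.
  by rewrite midSE addrC addKr normrN gtr0_norm// divr_gt0.
have nj0 i : `|mid i - th i| = al / 2.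
  by rewrite midE addrC addKr gtr0_norm// divr_gt0.
(* Below a half turn the arc from [phi] to [psi] is used. Above it the complementary arc through
   [2 pi] is, which forces [k] to be the last index and [j] the first. At exactly a half turn [x]
   would have opposite normals, against the interior point. *)
have [close|far|opposite] := ltgtP (psi - phi) pi.
- have [D0 Tneg _] := face_overlap phi2 (le_trans jk' psi1) close fphi fpsi (face_p j.+1).
  have psiE : psi = th j.+1.
    by apply: Tneg; apply: (face_tang_sign D0 nj1).1; rewrite dotBl; lra.
  have kj : k = j.+1.
    apply/eqP; rewrite eqn_leq jk andbT leqNgt; apply/negP => /th_mono; have := th_lt j.+1.
    by move: psi1; rewrite psiE; lra.
  have T1 : dot (x - p j.+1) (tang (th j.+1)) < 0.
    by apply: (face_tang_sign D0 nj1).1; rewrite dotBl; lra.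
  have T2 : 0 < dot (x - p j.+1) (tang (th j.+1)).
    by rewrite -kj in D0 *; apply: (face_tang_sign D0 (nj0 k)).2; rewrite dotBl; lra.
  by have := lt_trans T1 T2; rewrite ltxx.
- have e1 : psi - 2 * pi <= th k.+1 - 2 * pi by lra.
  have e2 : th k.+1 - 2 * pi <= phi by lra.
  have e3 : phi - (psi - 2 * pi) < pi by lra.
  have [D0 Tneg _] := face_overlap e1 e2 e3 (face_dir (esym (dirB2pi psi)) fpsi) fphi
    (face_dir (esym (dirB2pi _)) (face_p k.+1)).
  rewrite dirB2pi in D0; rewrite tangB2pi in Tneg.
  have nk1 : `|mid k - th k.+1| = al / 2.
    by rewrite midSE addrC addKr normrN gtr0_norm// divr_gt0.
  have T1 : dot (x - p k.+1) (tang (th k.+1)) < 0.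
    by apply: (face_tang_sign D0 nk1).1; rewrite dotBl; lra.
  have phiE := Tneg T1.
  have kN' : k.+1 = N.
    apply/eqP; rewrite eqn_leq kN /= leqNgt; apply/negP => /th_mono; rewrite thN.
    by have := th_lt k.+1; lra.
  have j0 : j = 0%N.
    case: (j) phi1 => // i; rewrite thS phiE => h; exfalso.
    have : 0 <= th i by rewrite mulr_ge0// ltW.
    lra.
  rewrite kN' p_cyclic thN in D0 T1.
  have e0 : dir (2 * pi) = dir (th 0) :> R * R by rewrite /th mul0r -[2 * pi]add0r dirD2pi.
  have e0' : tang (2 * pi) = tang (th 0) :> R * R by rewrite /th mul0r -[2 * pi]add0r tangD2pi.
  rewrite e0 in D0; rewrite e0' in T1.
  have T2 : 0 < dot (x - p 0) (tang (th 0)).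
    by apply: (face_tang_sign D0 (nj0 0%N)).2; move: xj1; rewrite j0 dotBl; lra.
  by have := lt_trans T1 T2; rewrite ltxx.
- have h1 := interior_o fphi; have h2 := interior_o fpsi.
  move: h2; rewrite (_ : psi = phi + pi); last by lra.
  rewrite /dot/= cosDpi sinDpi; move: h1; rewrite /dot/=; lra.
Qed.

Let C0 : C !=set0. Proof. by exists (p 0); exact: (face_p 0).1. Qed.

Let compact_in_slice eta j : compact [set x | in_slice eta j x].
Proof.
pose D := `[dot (p j) (tang (mid j)) + eta, dot (p j.+1) (tang (mid j)) - eta]%classic.
have -> : [set x | in_slice eta j x] =
    [set z.2 | z in face_slice C (th j) (th j.+1) (mid j) D].
  apply/seteqP; split=> [x [[phi phij fx] h1 h2]|_ [[phi x] [[/= phij fx] h]] <-].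
    by exists (phi, x) => //; split => //; rewrite /D /= in_itv/= h1.
  by move: h; rewrite /D /= in_itv/= => /andP[h1 h2]; split => //; exists phi.
apply: continuous_compact.
  by apply: continuous_subspaceT => z; exact: cvg_snd.
by apply: compact_face_slice => //; exact: itv_closed.
Qed.

(** The pairs of points from distinct slices form a compact set, on which the distance attains a
    minimum; disjointness makes it positive. *)
Let slices_apart eta : 0 < eta -> exists2 rho : R, 0 < rho &
  forall (j k : 'I_N) x y, j != k -> in_slice eta j x -> in_slice eta k y ->
    rho <= dist2 x y.
Proof.
move=> eta0.
pose B : set ((R * R) * (R * R)) := \big[setU/set0]_(jk : 'I_N * 'I_N | jk.1 != jk.2)
  ([set x | in_slice eta jk.1 x] `*` [set x | in_slice eta jk.2 x]).
have inB (j k : 'I_N) x y : j != k -> in_slice eta j x -> in_slice eta k y -> B (x, y).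
  by move=> jk xj yk; rewrite /B (bigD1 (j, k)) //=; left.
have compactB : compact B.
  by apply: bigsetU_compact => -[j k] /= jk; apply: compact_setX; exact: compact_in_slice.
have [B0|B0] := pselect (B !=set0); last first.
  exists 1 => // j k x y jk xj yk; exfalso; apply: B0.
  by exists (x, y); exact: inB xj yk.
have cdist : continuous (fun z : (R * R) * (R * R) => dist2 z.1 z.2).
  have -> : (fun z : (R * R) * (R * R) => dist2 z.1 z.2) =
      (fun z => Num.sqrt (dot (z.1 - z.2) (z.1 - z.2))).
    by apply/funext => z; rewrite /dist2 /dot /= !expr2.
  move=> z; apply: continuous_comp; last exact: sqrt_continuous.
  by apply: continuous_dot => {}z; apply: cvgB; [exact: cvg_fst|exact: cvg_snd|exact: cvg_fst|exact: cvg_snd].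
have [[x0 y0] /set_mem Bxy min_xy] := compact_EVT_min B0 compactB (continuous_subspaceT cdist).
exists (dist2 x0 y0); last first.
  by move=> j k x y jk xj yk; apply: (min_xy (x, y)); rewrite inE; exact: inB xj yk.
rewrite lt_neqAle dist2_ge0 andbT eq_sym; apply/eqP => d0.
have [j [k [jk xj yk]]] : exists j k : 'I_N, [/\ j != k, in_slice eta j x0 & in_slice eta k y0].
  move: Bxy; rewrite /B -bigcup_seq_cond => -[[j k] /= jk [xj yk]].
  by exists j, k; split => //; case/andP: jk.
have xy : x0 = y0.
  have := dist2_sqr x0 y0; rewrite d0 expr0n /= => /esym/eqP.
  rewrite paddr_eq0 ?sqr_ge0// !sqrf_eq0 !subr_eq0 => /andP[/eqP e1 /eqP e2].
  by rewrite [x0]surjective_pairing [y0]surjective_pairing e1 e2.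
rewrite -{}xy in yk.
have := jk; rewrite neq_ltn => /orP[jk'|kj'].
  exact: (slices_disjoint eta0 jk' (ltn_ord k) xj yk).
exact: (slices_disjoint eta0 kj' (ltn_ord j) yk xj).
Qed.

Lemma hausdorff1_ge_sides (E : set (R * R)) : (forall a x, face C a x -> E x) ->
  ((\sum_(j < N) side_length j)%:E <= hausdorff1 E)%E.
Proof.
move=> faceE; apply/lee_addgt0Pr => e e0.
pose eta := e / (2 * N%:R).
have eta0 : 0 < eta by rewrite divr_gt0// mulr_gt0.
have [rho rho0 apart] := slices_apart eta0.
rewrite -leeBlDr// -EFinB.
apply: le_trans (hausdorff1_ge_slices (I := 'I_N) (A := fun j => [set x | in_slice eta j x])
  (t := fun j => mid j) (a := fun j => dot (p j) (tang (mid j)) + eta)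
  (b := fun j => dot (p j.+1) (tang (mid j)) - eta) rho0 _ apart _) => //.
- rewrite lee_fin le_eqVlt; apply/orP; left; apply/eqP.
  have -> : e = \sum_(j < N) (2 * eta).
    by rewrite sumr_const card_ord -mulr_natr /eta; field; exact: lt0r_neq0.
  by rewrite -sumrB; apply: eq_bigr => j _; rewrite /side_length dotBl; ring.
- by move=> j x [[phi _ /faceE]].
- move=> j s s1 s2.
  have ps : dot (p j) (tang (mid j)) <= s by lra.
  have sp : s <= dot (p j.+1) (tang (mid j)) by lra.
  have [phi [z [phij fz zs]]] := face_between_attains compactC convexC C0
    (ltW (th_lt j)) (face_p j) (face_p j.+1) ps sp.
  by exists z => //; split; [exists phi| rewrite zs|rewrite zs].
Qed.

(** A point of the face at [th j] lying behind the marked point [p j] is claimed by the preceding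
    arc, which for [j = 0] is the last one. At an angle strictly inside an arc, monotonicity
    excludes this case. *)
Let boundary_piece_cover x a : 0 <= a <= 2 * pi -> face C a x ->
  exists j : 'I_N, boundary_piece C (th j) (th j.+1) (p j) (p j.+1) x.
Proof.
wlog a2pi : a / a < 2 * pi => [H|].
  move=> /andP[a0]; rewrite le_eqVlt => /predU1P[aE|a2] fa; last by apply: (H a); rewrite ?a0 ?ltW.
  apply: (H 0); rewrite ?lexx ?mulr_ge0 ?pi_ge0// ?mulr_gt0 ?pi_gt0//.
  by move: fa; rewrite aE; apply: face_dir; rewrite -[2 * pi]add0r dirD2pi.
move=> /andP[a0 _] fa.
have al0 := al_gt0; have alp := al_lt.
have [/= ja aj] := andP (truncn_itv (divr_ge0 a0 (ltW al0))).
move: (Num.trunc _) ja aj => j; rewrite ler_pdivlMr// ltr_pdivrMr// -/(th j) -/(th j.+1) => ja aj.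
have jN : (j < N)%N.
  rewrite ltnNge; apply/negP => /th_mono; rewrite thN; lra.
have aj' : th j.+1 - a < pi / 2 by rewrite thS; lra.
have below : dot (x - p j.+1) (tang (th j.+1)) <= 0.
  exact: face_tang_le0 (face_p j.+1) fa aj aj'.
have [xj|xj] := leP 0 (dot (x - p j) (tang (th j))).
  exists (Ordinal jN); split => //=; exists a => //; apply/andP; split => //; exact: ltW.
have ajE : a = th j.
  apply/eqP; rewrite eq_le ja andbT leNgt; apply/negP => ja'.
  have := face_tang_ge0 (face_p j) fa ja'; rewrite leNgt xj => h.
  by apply: (notF (h _)); rewrite ltrBlDl; apply: lt_le_trans aj _; rewrite thS lerD2l ltW.
have [i [iN [fi xi]]] : exists i, (i < N)%N /\ face C (th i.+1) x /\
    dot (x - p i.+1) (tang (th i.+1)) < 0.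
  rewrite ajE in fa; case: j jN fa xj {ja aj aj' below ajE} => [_|i iN]; last first.
    by exists i; split => //; exact: ltnW.
  rewrite -p_cyclic /th mul0r => f0 x0; exists N.-1.
  rewrite prednK; last by case: (N) N5.
  split; first by case: (N) N5.
  have e0 : dir (th N) = dir 0 :> R * R by rewrite thN -[2 * pi]add0r dirD2pi.
  have e0' : tang (th N) = tang 0 :> R * R by rewrite thN -[2 * pi]add0r tangD2pi.
  by rewrite -/(th N) e0'; split => //; exact: face_dir (esym e0) f0.
exists (Ordinal iN); split => /=.
- by exists (th i.+1) => //; rewrite lexx ltW.
- by apply: face_tang_ge0 fi _ _ => //; rewrite thS addrC addKr.
- exact: ltW.
Qed.

Let subdivide (m : nat) (v u : R) : (0 < m)%N -> 0 <= u -> u <= m%:R * v ->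
  exists i : 'I_m, i%:R * v <= u <= i.+1%:R * v.
Proof.
elim: m => // m IH _ u0 um; have [mu|um'] := leP (m%:R * v) u.
  by exists ord_max; rewrite mu.
have m0 : (0 < m)%N.
  by case: m um' {IH um} => //; rewrite mul0r ltNge u0.
by have [i ui] := IH m0 u0 (ltW um'); exists (widen_ord (leqnSn m) i).
Qed.

(** Each piece is cut into [M] cells by equal steps of its tangential projection. The Lipschitz
    bound gives a cell of side [j] diameter at most [side_length j / c / M], so a large [M] meets
    any [delta] while the total remains [L / c]. *)
Lemma hausdorff1_le_sides (E : set (R * R)) :
  (forall x, E x -> exists2 a, 0 <= a <= 2 * pi & face C a x) ->
  (hausdorff1 E <= ((\sum_(j < N) side_length j) / cos (pi / N%:R))%:E)%E.
Proof.
move=> faceE.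
have half : pi / N%:R = al / 2 by rewrite /al; field; exact: lt0r_neq0.
rewrite half; set c := cos _; set L := \sum_(j < N) _.
have al0 := al_gt0; have alp := al_lt.
have mE j : mid j = (th j + th j.+1) / 2 by [].
have thB j : th j.+1 - th j = al by rewrite thS addrC addKr.
have alj j : th j.+1 - th j < pi / 2 by rewrite thB.
have side_ge0 j : 0 <= side_length j.
  have := boundary_piece_tang (th_lt j) (alj j) (face_p j) (face_p j.+1)
    (x := p j); rewrite -mE /side_length dotBl => h.
  suff /h/andP[_] : boundary_piece C (th j) (th j.+1) (p j) (p j.+1) (p j) by rewrite subr_ge0.
  split; last first.
  - exact: face_tang_le0 (face_p j.+1) (face_p j) (th_lt j) (alj j).
  - by rewrite dotBl subrr.
  - by exists (th j) => //; rewrite lexx ltW.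
apply/ereal_supP => _ [delta /= d0 <-].
pose M := (Num.trunc (L / c / delta)).+1.
have M0 : 0 < M%:R :> R by rewrite ltr0n.
have LM : L / c <= delta * M%:R.
  by rewrite -ler_pdivrMl// mulrC ltW// /M truncnS_gt.
pose a j := dot (p j) (tang (mid j)).
pose U (ji : 'I_N * 'I_M) := boundary_piece C (th ji.1) (th ji.1.+1) (p ji.1) (p ji.1.+1) `&`
  [set x | a ji.1 + ji.2%:R * (side_length ji.1 / M%:R) <= dot x (tang (mid ji.1)) <=
           a ji.1 + ji.2.+1%:R * (side_length ji.1 / M%:R)].
pose e (ji : 'I_N * 'I_M) := side_length ji.1 / c / M%:R.
have LE : L / c = \sum_ji e ji.
  rewrite -(pair_bigA _ (fun (j : 'I_N) (_ : 'I_M) => side_length j / c / M%:R))/=.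
  rewrite /L mulr_suml; apply: eq_bigr => j _.
  by rewrite [RHS]sumr_const card_ord -[RHS]mulr_natr divfK// lt0r_neq0.
rewrite LE; apply: (hausdorff1_delta_le_cover (U := U)); first exact: ltW.
- move=> x /faceE[phi phi02 fphi].
  have [j xj] := boundary_piece_cover phi02 fphi.
  have /andP[] := boundary_piece_tang (th_lt j) (alj j) (face_p j) (face_p j.+1) xj.
  rewrite -mE -/(a j) => ax xb.
  have [|||i ui] := @subdivide M (side_length j / M%:R) (dot x (tang (mid j)) - a j).
  - by [].
  - by rewrite subr_ge0.
  - by rewrite mulrC divfK ?lt0r_neq0// /side_length dotBl lerD2r.
  exists (j, i) => //; split => //=; have /andP[u1 u2] := ui.
  by apply/andP; split; lra.
- move=> ji; apply: diam2_le; first by rewrite /e !divr_ge0// ltW.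
  move=> x y [xj /= /andP[x1 x2]] [yj /= /andP[y1 y2]].
  have := boundary_piece_lipschitz (th_lt ji.1) (alj ji.1) xj yj.
  rewrite thB -/c -mE => h.
  rewrite /e mulrAC ler_pdivlMr// mulrC; apply: le_trans h _.
  have Sji : ji.2.+1%:R * (side_length ji.1 / M%:R) =
    ji.2%:R * (side_length ji.1 / M%:R) + side_length ji.1 / M%:R.
    by rewrite -natr1 mulrDl mul1r.
  by rewrite dotBl ler_norml; apply/andP; split; lra.
- move=> [j i]; rewrite /e/= ler_pdivrMr//; apply: le_trans LM.
  rewrite ler_pM2r ?invr_gt0// /L (bigD1 j)//= lerDl; exact: sumr_ge0.
Qed.

End circumscribed_polygon.

(** * Supporting lines at boundary points *)

Section convex_boundary.
Context {R : realType}.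
Implicit Types (K : set (R * R)) (x y o : R * R).

Lemma closure2P K x : closure K x <->
  forall e, 0 < e -> exists2 y, K y & `|x.1 - y.1| < e /\ `|x.2 - y.2| < e.
Proof.
split=> [Kx e e0|H A /nbhs_ballP[e /= e0 eA]].
  by have [y [Ky [y1 y2]]] := Kx _ (nbhsx_ballx x e e0); exists y.
by have [y Ky [y1 y2]] := H e e0; exists y; split => //; apply: eA.
Qed.

Lemma interior2P K x : interior K x <->
  exists2 e, 0 < e & forall y, `|x.1 - y.1| < e -> `|x.2 - y.2| < e -> K y.
Proof.
split=> [/nbhs_ballP[e /= e0 eK]|[e e0 H]].
  by exists e => // y y1 y2; apply: eK.
by apply/nbhs_ballP; exists e => // y [y1 y2]; exact: H.
Qed.

Lemma closure_convex K : convex_set2 K -> convex_set2 (closure K).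
Proof.
move=> cK x y l /closure2P Kx /closure2P Ky l0 l1; apply/closure2P => e e0.
have [x' Kx' [x1 x2]] := Kx e e0; have [y' Ky' [y1 y2]] := Ky e e0.
exists (l * x'.1 + (1 - l) * y'.1, l * x'.2 + (1 - l) * y'.2); first exact: cK.
have comb (a b c d : R) : `|a - b| < e -> `|c - d| < e ->
    `|l * a + (1 - l) * c - (l * b + (1 - l) * d)| < e.
  move=> ab cd; rewrite (_ : _ - _ = l * (a - b) + (1 - l) * (c - d)); last by ring.
  have l1' : 0 <= 1 - l by rewrite subr_ge0.
  apply: le_lt_trans (ler_normD _ _) _.
  rewrite !normrM (ger0_norm l0) (ger0_norm l1').
  move: l0; rewrite le_eqVlt => /predU1P[<-|l0]; first by rewrite mul0r subr0 mul1r add0r.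
  have := ler_wpM2l l1' (ltW cd); have : l * `|a - b| < l * e by rewrite ltr_pM2l.
  by rewrite mulrBl mul1r => h1 h2; lra.
by split; apply: comb.
Qed.

Lemma compact_closure2 K (B : R) : (forall x, K x -> `|x.1| <= B /\ `|x.2| <= B) ->
  compact (closure K).
Proof.
move=> KB; pose Q : set (R * R) := `[- B, B]%classic `*` `[- B, B]%classic.
have cQ : compact Q by apply: compact_setX; exact: segment_compact.
apply: (subclosed_compact (@closed_closure _ K) cQ).
have <- : closure Q = Q.
  by symmetry; apply/closure_id; apply: compact_closed cQ; exact: norm_hausdorff.
by apply: closure_subset => x /KB[x1 x2]; split; rewrite /= in_itv/= -ler_norml.
Qed.

Lemma shifted_dir_dot x (e a : R) :
  dot (x.1 + e * cos a, x.2 + e * sin a) (dir a) = dot x (dir a) + e.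
Proof.
transitivity (dot x (dir a) + e * (cos a ^+ 2 + sin a ^+ 2)).
  by rewrite /dot/=; ring.
by rewrite cos2Dsin2 mulr1.
Qed.

Lemma interior_shift K x (a : R) : interior K x ->
  exists2 e, 0 < e & K (x.1 + e * cos a, x.2 + e * sin a).
Proof.
move=> /interior2P[e e0 H]; exists (e / 2); first by rewrite divr_gt0.
have small (u v : R) : `|v| <= 1 -> `|u - (u + e / 2 * v)| < e.
  move=> v1; rewrite opprD addNKr normrN normrM gtr0_norm ?divr_gt0//.
  have e2 : 0 <= e / 2 by rewrite divr_ge0// ltW.
  by have := ler_wpM2l e2 v1; lra.
by apply: H; apply: small; [exact: cos_max|exact: sin_max].
Qed.

Lemma face_boundary2 K a x : face (closure K) a x -> boundary2 K x.
Proof.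
move=> [Kx xmax]; split => // /(interior_shift a)[e e0 /(@subset_closure _ K)/xmax].
by rewrite shifted_dir_dot gerDl leNgt e0.
Qed.

Lemma face_interior K o a x : interior K o -> face (closure K) a x ->
  dot (o - x) (dir a) < 0.
Proof.
move=> /(interior_shift a)[e e0 /(@subset_closure _ K) Ko] [_ /(_ _ Ko)].
by rewrite shifted_dir_dot dotBl; lra.
Qed.

Lemma separation (C : set (R * R)) y : compact C -> convex_set2 C -> C !=set0 -> ~ C y ->
  exists2 a, 0 <= a <= 2 * pi & forall w, C w -> dot (w - y) (dir a) <= 0.
Proof.
move=> compactC convexC C0 Cy.
pose f w := dot (w - y) (w - y).
have cf : continuous f.
  by apply: continuous_dot => w; apply: cvgB; [exact: cvg_id|exact: cvg_cst|exact: cvg_id|exact: cvg_cst].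
have [z /set_mem Cz zmin] := compact_EVT_min C0 compactC (continuous_subspaceT cf).
pose u := y.1 - z.1; pose v := y.2 - z.2.
have n0 : 0 < u ^+ 2 + v ^+ 2.
  rewrite lt_neqAle addr_ge0 ?sqr_ge0// andbT eq_sym; apply/eqP => /eqP.
  rewrite paddr_eq0 ?sqr_ge0// !sqrf_eq0 !subr_eq0 => /andP[/eqP e1 /eqP e2].
  by apply: Cy; rewrite [y]surjective_pairing e1 e2 -surjective_pairing.
have s0 : 0 < Num.sqrt (u ^+ 2 + v ^+ 2) by rewrite sqrtr_gt0.
have [|a a02 aE] := @unit_vector_dir R (u / Num.sqrt (u ^+ 2 + v ^+ 2)) (v / Num.sqrt (u ^+ 2 + v ^+ 2)).
  by rewrite !expr_div_n sqr_sqrtr ?(ltW n0)// -mulrDl divff// lt0r_neq0.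
exists a => // w Cw.
have -> : dot (w - y) (dir a) = ((w.1 - y.1) * u + (w.2 - y.2) * v) / Num.sqrt (u ^+ 2 + v ^+ 2).
  by rewrite aE /dot/=; ring.
rewrite pmulr_lle0 ?invr_gt0//.
suff : (w.1 - z.1) * u + (w.2 - z.2) * v <= 0.
  move=> h; rewrite (_ : _ + _ = (w.1 - z.1) * u + (w.2 - z.2) * v - (u ^+ 2 + v ^+ 2)); first lra.
  by rewrite /u /v; ring.
rewrite leNgt; apply/negP; set g := _ + _ => g0.
pose q := (w.1 - z.1) ^+ 2 + (w.2 - z.2) ^+ 2.
have q0 : 0 <= q by rewrite addr_ge0// sqr_ge0.
(* Small enough for [t q < 2 g], so that moving from the nearest point [z] towards [w] lowers the
   squared distance by [t (2 g - t q) > 0]; the [+ 1] covers [q = 0]. *)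
pose t := Num.min 1 (g / (q + 1)).
have t0 : 0 < t by rewrite lt_min ltr01 divr_gt0// ltr_wpDl.
have t1 : t <= 1 by rewrite ge_min lexx.
have tq : t * (q + 1) <= g.
  by rewrite -ler_pdivlMr ?ltr_wpDl// ge_min lexx orbT.
have Ct := convexC w z t Cw Cz (ltW t0) t1.
have := zmin _ (mem_set Ct).
have -> : f (t * w.1 + (1 - t) * z.1, t * w.2 + (1 - t) * z.2) = f z - t * (2 * g - t * q).
  by rewrite /f /dot /g /q /u /v /=; ring.
have : 0 < t * (2 * g - t * q) by rewrite mulr_gt0//; lra.
lra.
Qed.

(** A point [w] near [x] equals [(z + e o') / (1 + e)], with [z] a point of [K] near the extension
    of the segment beyond [x], and [o'] close enough to [o] to lie in [K]. *)
Lemma convex_extension_out K o x (e : R) : convex_set2 K -> interior K o -> 0 < e ->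
  closure K (x.1 + e * (x.1 - o.1), x.2 + e * (x.2 - o.2)) -> interior K x.
Proof.
move=> cK /interior2P[r r0 Ko] e0 /closure2P Ky.
have e1 : 0 < 1 + e by rewrite addr_gt0.
have er0 : 0 < e * r / 2 by rewrite divr_gt0// mulr_gt0.
have [z Kz [/= z1 z2]] := Ky _ er0.
apply/interior2P; exists (e * r / 2 / (1 + e)); first by rewrite divr_gt0.
move=> w; rewrite 2!(ltr_pdivlMr _ _ e1) => w1 w2.
pose o' := ((1 + e) * w.1 - z.1) / e; pose o'' := ((1 + e) * w.2 - z.2) / e.
have near_o (a b c ww : R) : `|a + e * (a - b) - c| < e * r / 2 ->
    `|a - ww| * (1 + e) < e * r / 2 -> `|b - ((1 + e) * ww - c) / e| < r.
  move=> h1 h2.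
  rewrite (_ : b - _ = ((1 + e) * (a - ww) - (a + e * (a - b) - c)) / e); last first.
    by field; exact: lt0r_neq0.
  rewrite normrM (gtr0_norm (_ : 0 < e^-1)) ?invr_gt0// ltr_pdivrMr//.
  apply: le_lt_trans (ler_normB _ _) _; rewrite normrM (gtr0_norm e1); lra.
have Ko' : K (o', o'') by apply: Ko; [exact: near_o z1 w1|exact: near_o z2 w2].
have l0 : 0 <= (1 + e)^-1 by rewrite invr_ge0 ltW.
have l1 : (1 + e)^-1 <= 1 by rewrite invf_le1// lerDl ltW.
have := cK z (o', o'') _ Kz Ko' l0 l1.
congr K; rewrite [RHS]surjective_pairing /o' /o''/=.
by congr pair; field; rewrite ?lt0r_neq0.
Qed.

(** For [0 < e <= 1] the point [x + e (x - o)] is outside the closure and can be separated from it.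
    The pairs of some [e] in [[0, 1]] and a separating angle form a compact set [F]; its least [e]
    can only be 0, and the angle that comes with it supports the closure at [x]. *)
Lemma boundary2_face K o (B : R) x : convex_set2 K ->
  (forall x, K x -> `|x.1| <= B /\ `|x.2| <= B) -> interior K o -> boundary2 K x ->
  exists2 a, 0 <= a <= 2 * pi & face (closure K) a x.
Proof.
move=> cK KB Ko [Kx nKx]; have compactC := compact_closure2 KB.
have C0 : closure K !=set0 by exists x.
pose Q : set (R * R) := `[0, 1]%classic `*` `[0, 2 * pi]%classic.
have compactQ : compact Q by apply: compact_setX; exact: segment_compact.
pose F : set (R * R) := Q `&`
  \bigcap_(w in closure K) [set z : R * R |
     dot (w - (x + (z.1 * (x.1 - o.1), z.1 * (x.2 - o.2)))) (dir z.2) <= 0].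
have compactF : compact F.
  apply: (subclosed_compact _ compactQ); last exact: subIsetl.
    apply: closedI; first by apply: compact_closed compactQ; exact: norm_hausdorff.
    apply: closed_bigI => w _.
    apply: (@preimage_closed _ _ (fun z : R * R =>
      dot (w - (x + (z.1 * (x.1 - o.1), z.1 * (x.2 - o.2)))) (dir z.2)) [set u | u <= 0]).
      move=> z _; apply: continuous_dot => {}z.
        apply: cvgB; first exact: cvg_cst.
        apply: cvgD; first exact: cvg_cst.
        have c1 : (fun z : R * R => z.1 * (x.1 - o.1)) z' @[z' --> z] --> z.1 * (x.1 - o.1).
          by apply: cvgM; [exact: cvg_fst|exact: cvg_cst].
        have c2 : (fun z : R * R => z.1 * (x.2 - o.2)) z' @[z' --> z] --> z.1 * (x.2 - o.2).
          by apply: cvgM; [exact: cvg_fst|exact: cvg_cst].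
        exact: cvg_pair c1 c2.
      by apply: continuous_comp; [exact: cvg_snd|exact: continuous_dir].
    exact: closed_le.
have inF e : 0 < e -> e <= 1 -> exists a, F (e, a).
  move=> e0 e1.
  have ny : ~ closure K (x.1 + e * (x.1 - o.1), x.2 + e * (x.2 - o.2)).
    by move=> /(convex_extension_out cK Ko e0).
  have [a a02 ha] := separation compactC (closure_convex cK) C0 ny.
  by exists a; split; [split; rewrite /= in_itv//= (ltW e0) e1|move=> w /ha].
have cfst : continuous (fun z : R * R => z.1) by move=> z; exact: cvg_fst.
have F0 : F !=set0 by have [a Fa] := inF 1 ltr01 (lexx _); exists (1, a).
have [[e a] /set_mem Fea emin] := compact_EVT_min F0 compactF
  (continuous_subspaceT cfst).
have [[/= e01 a02] h] := Fea.
have e0 : e = 0.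
  apply/eqP; rewrite eq_le; move: e01; rewrite in_itv/= => /andP[-> e1]; rewrite andbT.
  rewrite leNgt; apply/negP => e0.
  have [||b Fb] := inF (e / 2); [by rewrite divr_gt0|by lra|].
  by have := emin _ (mem_set Fb); rewrite /=; lra.
exists a; first by move: a02; rewrite in_itv.
split=> // w Cw; have /= := h w Cw.
by rewrite e0 !mul0r (_ : (0, 0) = 0 :> R * R)// addr0 dotBl subr_le0.
Qed.

Lemma perimeter2_bounds K (B : R) (N : nat) (h : nat -> R) : convex_set2 K ->
  (forall x, K x -> `|x.1| <= B /\ `|x.2| <= B) -> interior K !=set0 -> (4 < N)%N ->
  (forall j x, K x -> dot x (dir (j%:R * (2 * pi / N%:R))) <= h j) ->
  (forall j e, 0 < e -> exists2 x, K x & h j - e < dot x (dir (j%:R * (2 * pi / N%:R)))) ->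
  ((2 * sin (pi / N%:R) * \sum_(j < N) h j)%:E <= perimeter2 K)%E /\
  (perimeter2 K <= (2 * sin (pi / N%:R) * (\sum_(j < N) h j) / cos (pi / N%:R))%:E)%E.
Proof.
move=> cK KB [ctr Ko] N5 hub hsup.
have compactC := compact_closure2 KB.
have cC := closure_convex cK.
have C0 : closure K !=set0 by exists ctr; apply: subset_closure; exact: interior_subset.
have [q Hq] := choice (fun v => support_point v compactC C0).
pose th (j : nat) : R := j%:R * (2 * pi / N%:R).
pose p j := q (dir (th j)).
have face_p j : face (closure K) (th j) (p j) by exact: Hq.
have N0 : N%:R != 0 :> R by rewrite pnatr_eq0 -lt0n; exact: ltn_trans N5.
have pN : p N = p 0.
  congr q; rewrite /th mul0r (_ : N%:R * _ = 2 * pi); last by rewrite mulrC divfK.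
  by rewrite -[2 * pi]add0r dirD2pi.
have hp j : dot (p j) (dir (th j)) = h j.
  apply/eqP; rewrite eq_le; apply/andP; split.
    have cl : closed [set x : R * R | dot x (dir (th j)) <= h j].
      apply: (@preimage_closed _ _ (fun x : R * R => dot x (dir (th j))) [set u | u <= h j]).
        by move=> x _; apply: continuous_dot => {}x; [exact: cvg_id|exact: cvg_cst].
      exact: closed_le.
    have : closure K (p j) by exact: (face_p j).1.
    by move/(closure_subset (hub j)); move/closure_id: cl => <-.
  apply/ler_addgt0Pr => e e0; have [x Kx hx] := hsup j e e0.
  by have := (face_p j).2 x (subset_closure Kx); rewrite -/(th j) in hx; lra.
have interior_o a x : face (closure K) a x -> dot (ctr - x) (dir a) < 0.
  exact: face_interior.
have sumE : 2 * sin (pi / N%:R) * \sum_(j < N) h j = \sum_(j < N) side_length N p j.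
  rewrite (sum_side_length N5 pN); congr (_ * _).
  by apply: eq_bigr => j _; rewrite -hp.
rewrite sumE; split.
- apply: (hausdorff1_ge_sides compactC cC interior_o N5 face_p pN) => a x.
  exact: face_boundary2.
- apply: (hausdorff1_le_sides N5 face_p pN) => x.
  exact: boundary2_face cK KB Ko.
Qed.

End convex_boundary.

(** * Nondegeneracy of the hull of the stopped path *)

Section null_cross_product.
Context {R : realType}.
Local Notation MR := (measurableTypeR R).

Lemma normal_prob_set1 (m s a : R) : normal_prob m s [set a] = 0%E.
Proof.
apply: (@normal_prob_dominates R m s [set a]) => //.
move=> A mA Aa; apply/eqP; rewrite eq_le measure_ge0 andbT.
by rewrite -(lebesgue_measure_set1 a); apply: le_measure => //; rewrite inE.
Qed.

Let set1XE (z : MR * MR) : [set z] = [set z.1] `*` [set z.2].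
Proof. by apply/seteqP; case: z => a b; split=> [_ ->//|[u v] /= [-> ->]]. Qed.

Let measurable_point (z : MR * MR) : measurable [set z].
Proof. by rewrite set1XE; exact: measurableX. Qed.

Lemma gauss2_point (h : R) (z : MR * MR) : gauss2 h [set z] = 0%E.
Proof.
by rewrite set1XE gauss2X//; rewrite normal_prob_set1 mul0e.
Qed.

Lemma gauss2_line (h : R) (z : MR * MR) : z != (0, 0) ->
  gauss2 h [set u | z.1 * u.2 - z.2 * u.1 = 0] = 0%E.
Proof.
case: z => a b /=; have [-> b0|a0 _] := eqVneq a 0.
  have {}b0 : b != 0 by apply: contraNneq b0 => ->.
  have -> : [set u : MR * MR | 0 * u.2 - b * u.1 = 0] = [set 0] `*` setT.
    apply/seteqP; split=> [[u v] /=|[u v] /= [-> _]]; last by rewrite mul0r mulr0 subr0.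
    by move/eqP; rewrite mul0r sub0r oppr_eq0 mulf_eq0 (negbTE b0) => /eqP.
  by rewrite gauss2X//; rewrite normal_prob_set1 mul0e.
apply: integral0_eq => x _ /=.
have -> : xsection [set u : MR * MR | a * u.2 - b * u.1 = 0] x = [set b * x / a].
  apply/seteqP; split=> y /=; rewrite /xsection/= inE/=.
    by move/eqP; rewrite subr_eq0 => /eqP <-; rewrite mulrAC divff// mul1r.
  by move=> ->; rewrite mulrC divfK// subrr.
exact: normal_prob_set1.
Qed.

Context {d : measure_display} {T : measurableType d}.
Variables (P : probability T R) (X Y : R -> T -> R).
Hypothesis BM : planar_BM P X Y.

(** Given a nonzero first increment, collinearity puts the second one on a fixed line through the
    origin, a null set; the first increment is 0 with probability 0. *)
Lemma increments_not_collinear (h : R) : 0 < h ->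
  P [set w | (increment X Y h 0 w).1 * (increment X Y h 1 w).2 -
             (increment X Y h 0 w).2 * (increment X Y h 1 w).1 = 0] = 0%E.
Proof.
move=> h0.
pose S : {mfun T >-> (MR * MR)%type} := mfun_Sub (mem_set (measurable_increment BM h 0)).
pose D : {mfun T >-> (MR * MR)%type} := mfun_Sub (mem_set (measurable_increment BM h 1)).
have lawS A : measurable A -> distribution P S A = gauss2 h A.
  move=> mA; have := past_increment_indep_sigma BM h0 (k := 0) (E := setT)
    (sub_sigma_algebra (past_setT _ _ _ _)) mA.
  by rewrite setTI probability_setT mul1e.
have indep A C : measurable A -> measurable C ->
    P (S @^-1` A `&` D @^-1` C) = (P (S @^-1` A) * gauss2 h C)%E.
  move=> mA mC; apply: (past_increment_indep_sigma BM h0) => //.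
  by have := past_measurable_increment (X := X) (Y := Y) (h := h) (ltn0Sn 0) measurableT mA; rewrite setTI.
pose Z : set ((MR * MR) * (MR * MR)) := [set z | z.1.1 * z.2.2 - z.1.2 * z.2.1 = 0].
have mZ : measurable Z.
  have m1 := @measurable_fst _ _ (MR * MR)%type (MR * MR)%type.
  have m2 := @measurable_snd _ _ (MR * MR)%type (MR * MR)%type.
  have mf : measurable_fun setT
      (fun z : (MR * MR) * (MR * MR) => z.1.1 * z.2.2 - z.1.2 * z.2.1).
    by apply: measurable_funB; apply: measurable_funM;
      do ?[exact: (measurableT_comp measurable_fst m1)|exact: (measurableT_comp measurable_snd m2)
          |exact: (measurableT_comp measurable_snd m1)|exact: (measurableT_comp measurable_fst m2)].
  by have := mf measurableT [set 0] (measurable_set1 _); rewrite setTI.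
transitivity (P ((fun w => (S w, D w)) @^-1` Z)); first by [].
rewrite (joint_law (gam := gauss2 h) indep mZ).
apply/eqP; rewrite eq_le measure_ge0 andbT.
apply: (@le_trans _ _ (\int[distribution P S]_x (\1_[set (0, 0)] x)%:E)%E).
  apply: ge0_le_integral => //.
  - exact: measurable_fun_xsection.
  - by apply/measurable_EFinP; apply: measurable_indic; exact: measurable_point.
  - move=> z _ /=; rewrite indicE; have [->|z0] := eqVneq z (0, 0).
      rewrite (_ : (_ \in _) = true); last exact: mem_set.
      by apply: probability_le1; exact: measurable_xsection.
    have -> : xsection Z z = [set u | z.1 * u.2 - z.2 * u.1 = 0].
      by apply/seteqP; split => u; rewrite /xsection/= inE.
    by rewrite gauss2_line// lee_fin.
by rewrite integral_indic//= setIT lawS// gauss2_point.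
Qed.

End null_cross_product.

Section hull.
Context {R : realType}.

Lemma convex_hull2_convex (A : set (R * R)) : convex_set2 (convex_hull2 A).
Proof. by move=> x y l Ax Ay l0 l1 D convD AD; exact: (convD x y l (Ax D convD AD) (Ay D convD AD) l0 l1). Qed.

Lemma sub_convex_hull2 (A : set (R * R)) : A `<=` convex_hull2 A.
Proof. by move=> x Ax C _; exact. Qed.

Lemma triangle_interior (K : set (R * R)) (p q : R * R) : convex_set2 K ->
  K (0, 0) -> K p -> K q -> p.1 * q.2 - p.2 * q.1 != 0 -> interior K !=set0.
Proof.
move=> cK K0 Kp Kq D0; set D := _ - _ in D0.
pose S := 1 + `|p.1| + `|p.2| + `|q.1| + `|q.2|.
have p1 := normr_ge0 p.1; have p2 := normr_ge0 p.2.
have q1 := normr_ge0 q.1; have q2 := normr_ge0 q.2.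
have S0 : 0 < S by rewrite /S; lra.
(* The ball is centred at the centroid of the triangle, and this radius changes the barycentric
   coordinates [la], [mu], both 1/3 there, by at most 1/6: they stay positive with sum at most 1. *)
pose e := `|D| / (6 * S).
have Dn : 0 < `|D| by rewrite normr_gt0.
have e0 : 0 < e by rewrite divr_gt0// mulr_gt0.
pose x0 := (p.1 + q.1) / 3; pose x1 := (p.2 + q.2) / 3.
exists (x0, x1); apply/interior2P; exists e => // y /= y1 y2.
have close (a b : R) : `|a| + `|b| <= S ->
    `|(((x0 - y.1) * a) - (x1 - y.2) * b) / D| <= 1 / 6.
  move=> ab; rewrite normrM normfV ler_pdivrMr//.
  apply: le_trans (ler_normB _ _) _; rewrite !normrM.
  have h1 := ler_wpM2r (normr_ge0 a) (ltW y1).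
  have h2 := ler_wpM2r (normr_ge0 b) (ltW y2).
  have h3 := ler_wpM2l (ltW e0) ab.
  have h4 : e * S = 1 / 6 * `|D| by rewrite /e; field; exact: lt0r_neq0.
  lra.
pose la := (y.1 * q.2 - y.2 * q.1) / D; pose mu := (y.2 * p.1 - y.1 * p.2) / D.
have laE : `|1 / 3 - la| <= 1 / 6.
  have := close q.2 q.1; rewrite (_ : _ / D = 1 / 3 - la); last first.
    by rewrite /la /x0 /x1 /D; field.
  by apply; rewrite /S; lra.
have muE : `|1 / 3 - mu| <= 1 / 6.
  have := close (- p.2) (- p.1); rewrite (_ : _ / D = 1 / 3 - mu); last first.
    by rewrite /mu /x0 /x1 /D; field.
  by apply; rewrite !normrN /S; lra.
move: laE muE; rewrite !ler_norml => /andP[la1 la2] /andP[mu1 mu2].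
have s0 : 0 < la + mu by lra.
have l0 : 0 <= la / (la + mu) by rewrite divr_ge0//; lra.
have l1 : la / (la + mu) <= 1 by rewrite ler_pdivrMr//; lra.
have Kr := cK p q _ Kp Kq l0 l1.
have := cK _ (0, 0) (la + mu) Kr K0 (ltW s0).
have lamu1 : la + mu <= 1 by lra.
move=> /(_ lamu1); congr K; rewrite [RHS]surjective_pairing /= !mulr0 !addr0.
have sn : la + mu != 0 by exact: lt0r_neq0.
congr pair.
- rewrite (_ : (la + mu) * _ = la * p.1 + mu * q.1); last by field.
  by rewrite /la /mu /D; field.
- rewrite (_ : (la + mu) * _ = la * p.2 + mu * q.2); last by field.
  by rewrite /la /mu /D; field.
Qed.

End hull.

Section hull_of_path.
Context {R : realType} {d : measure_display} {T : measurableType d}.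
Variables (P : probability T R) (X Y : R -> T -> R).
Hypothesis BM : planar_BM P X Y.

Let hull w := convex_hull2 (stopped_path X Y w).
Let W0 : forall w, X 0 w = 0 /\ Y 0 w = 0. Proof. by case: BM. Qed.
Let cW : forall w, continuous (fun t => X t w) /\ continuous (fun t => Y t w).
Proof. by case: BM. Qed.

Lemma hull_bounded w x : hull w x -> `|x.1| <= 1 /\ `|x.2| <= 1.
Proof.
have le1 (u v : R) : u ^+ 2 + v ^+ 2 <= 1 -> `|u| <= 1 /\ `|v| <= 1.
  move=> uv; have u0 := sqr_ge0 u; have v0 := sqr_ge0 v.
  by split; rewrite -ler_sqr ?nnegrE// real_normK ?num_real// expr1n; lra.
move=> /(_ [set x | `|x.1| <= 1 /\ `|x.2| <= 1]); apply; last first.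
  by move=> _ [t /(upto_norm W0 cW)/le1[h1 h2] <-].
move=> y z l [y1 y2] [z1 z2] l0 l1.
have l1' : 0 <= 1 - l by rewrite subr_ge0.
have comb (a b : R) : `|a| <= 1 -> `|b| <= 1 -> `|l * a + (1 - l) * b| <= 1.
  move=> a1 b1; apply: le_trans (ler_normD _ _) _.
  rewrite !normrM (ger0_norm l0) (ger0_norm l1').
  by have := ler_wpM2l l0 a1; have := ler_wpM2l l1' b1; lra.
by split; apply: comb.
Qed.

Lemma upto_component c s w : c ^+ 2 + s ^+ 2 = 1 ->
  upto (component X Y c s) (component X Y (- s) c) w = upto X Y w.
Proof.
move=> cs; rewrite /upto; suff -> : exit_time (component X Y c s) (component X Y (- s) c) w
  = exit_time X Y w by [].
have nE t : component X Y c s t w ^+ 2 + component X Y (- s) c t w ^+ 2 =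
    X t w ^+ 2 + Y t w ^+ 2.
  transitivity ((X t w ^+ 2 + Y t w ^+ 2) * (c ^+ 2 + s ^+ 2)).
    by rewrite /component; ring.
  by rewrite cs mulr1.
rewrite /exit_time; congr ereal_inf; congr image.
by apply/seteqP; split=> t /=; rewrite nE.
Qed.

Lemma hull_support_le w (a : R) x : hull w x -> (dot x (dir a) <=
  fine (max_horiz (component X Y (cos a) (sin a)) (component X Y (- sin a) (cos a)) w)).
Proof.
set h := fine _; move=> /(_ [set x | dot x (dir a) <= h]); apply.
  move=> y z l /= y1 z1 l0 l1; have l1' : 0 <= 1 - l by rewrite subr_ge0.
  by have := ler_wpM2l l0 y1; have := ler_wpM2l l1' z1; rewrite /dot/=; lra.
move=> _ [t ut <-] /=; rewrite -lee_fin -(fin_maximum BM).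
rewrite (_ : dot _ _ = component X Y (cos a) (sin a) t w); last first.
  by rewrite /dot /component/=; ring.
by apply: ereal_sup_ubound; exists t => //; rewrite upto_component// cos2Dsin2.
Qed.

Lemma hull_support_approx w (a e : R) : 0 < e -> exists2 x, hull w x &
  fine (max_horiz (component X Y (cos a) (sin a)) (component X Y (- sin a) (cos a)) w) - e
  < dot x (dir a).
Proof.
move=> e0; set h := fine _.
have : ((h - e)%:E < max_horiz (component X Y (cos a) (sin a)) (component X Y (- sin a) (cos a)) w)%E.
  by rewrite (fin_maximum BM) lte_fin ltrBlDr ltrDl.
move=> /max_horiz_gtP[t]; rewrite upto_component ?cos2Dsin2// => ut ht.
exists (X t w, Y t w); first by apply: sub_convex_hull2; exists t.
by apply: lt_le_trans ht _; rewrite /dot /component/= mulrC [X in _ + X]mulrC.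
Qed.

(** The exit time is positive but random, so the two times have to depend on the path. They are
    taken as [h n] and [2 * h n] for some [n], and the countable union of the collinearity events is
    still null. *)
Lemma hull_interior_as : exists2 D, measurable D /\ P D = 0%E &
  forall w, ~ D w -> interior (hull w) !=set0.
Proof.
pose h (n : nat) : R := n.+1%:R^-1.
have h0 n : 0 < h n by rewrite invr_gt0.
pose D n := [set w | (increment X Y (h n) 0 w).1 * (increment X Y (h n) 1 w).2 -
             (increment X Y (h n) 0 w).2 * (increment X Y (h n) 1 w).1 = 0].
have mD n : measurable (D n).
  have mi k : measurable_fun setT (fun w => (increment X Y (h n) k w).1) /\
      measurable_fun setT (fun w => (increment X Y (h n) k w).2).
    by have m := measurable_increment BM (h n) k; split;
      [exact: (measurableT_comp measurable_fst m)|exact: (measurableT_comp measurable_snd m)].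
  have mf : measurable_fun setT (fun w =>
      (increment X Y (h n) 0 w).1 * (increment X Y (h n) 1 w).2 -
      (increment X Y (h n) 0 w).2 * (increment X Y (h n) 1 w).1).
    by apply: measurable_funB; apply: measurable_funM;
      do ?[exact: (mi 0%N).1|exact: (mi 1%N).1|exact: (mi 0%N).2|exact: (mi 1%N).2].
  by have := mf measurableT [set 0] (measurable_set1 _); rewrite setTI.
exists (\bigcup_n D n).
  split; first exact: bigcup_measurable.
  apply/eqP; rewrite eq_le measure_ge0 andbT.
  apply: (@le_trans _ _ (\sum_(0 <= n <oo) P (D n))%E).
    by apply: measure_sigma_subadditive => //; exact: bigcup_measurable.
  by rewrite eseries0// => n _ _; exact: increments_not_collinear.
move=> w nD.
have [n hn] : exists n, upto X Y w (2 * h n).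
  have [cX cY] := cW w.
  have cN : {for 0, continuous (fun t => X t w * X t w + Y t w * Y t w)}.
    by apply: cvgD; apply: cvgM; (exact: cX || exact: cY).
  have N0 : X 0 w * X 0 w + Y 0 w * Y 0 w < 1.
    by have [-> ->] := W0 w; rewrite mulr0 addr0.
  have [e e0 He] := near_ball (cvgr_lt _ cN _ N0).
  exists (Num.trunc (2 / e)); apply/uptoP; split=> [|u u0 uh].
    by rewrite mulr_ge0// ltW.
  rewrite !expr2; apply: He; rewrite sub0r normrN ger0_norm//.
  apply: lt_trans uh _; rewrite /h ltr_pdivrMr// mulrC -ltr_pdivrMr//.
  exact: truncnS_gt.
have Kt t : upto X Y w t -> hull w (X t w, Y t w) by move=> ut; apply: sub_convex_hull2; exists t.
apply: (@triangle_interior R _ (X (h n) w, Y (h n) w) (X (2 * h n) w, Y (2 * h n) w)).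
- exact: convex_hull2_convex.
- by have := Kt 0 (upto0 _ _ _); have [-> ->] := W0 w.
- apply: Kt; apply/uptoP; split=> [|u u0 uh]; first exact: ltW.
  move/uptoP: hn => [_]; apply => //; apply: lt_trans uh _.
  by rewrite ltr_pMl// ltr1n.
- exact: Kt.
- apply/eqP => cross0; apply: nD; exists n => //; rewrite /D /= /increment/=.
  rewrite mul0r mul1r; have [-> ->] := W0 w; rewrite !subr0 -[RHS]cross0/=; ring.
Qed.

End hull_of_path.

(** * Decimal values *)

Lemma decimal_511655 : (511655 = 511 * 1000 + 655)%N.
Proof. by apply/eqP; vm_compute. Qed.
Lemma decimal_3214826 : (3214826 = 3214 * 1000 + 826)%N.
Proof. by apply/eqP; vm_compute. Qed.
Lemma decimal_million : (1000000 = 1000 * 1000 * 1)%N.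
Proof. by apply/eqP; vm_compute. Qed.
Lemma decimal_ten_millions : (10000000 = 1000 * 1000 * 10)%N.
Proof. by apply/eqP; vm_compute. Qed.

Section final_numerics.
Context {R : realType}.

(* Splitting the large numerals through these two lemmas keeps unification from
   evaluating them. *)
Let natr_split (a m n k : nat) : a = (m * n + k)%N ->
  a%:R = m%:R * n%:R + k%:R :> R.
Proof. by move=> ->; rewrite natrD natrM. Qed.

Let natr_split3 (a m n k : nat) : a = (m * n * k)%N ->
  a%:R = m%:R * n%:R * k%:R :> R.
Proof. by move=> ->; rewrite !natrM. Qed.

Let mean_value_decimal_of (a b e : nat) : a = (511 * 1000 + 655)%N ->
  b = (1000 * 1000 * 1)%N -> e = (1000 * 1000 * 10)%N ->
  `| mean_value - a%:R / b%:R | < 5%:R / e%:R :> R.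
Proof.
move=> /natr_split-> /natr_split3-> /natr_split3->.
have [h1 h2] := @mean_value_approx R; rewrite ltr_norml.
by apply/andP; split; lra.
Qed.

Lemma mean_value_decimal :
  `| mean_value - 511655%:R / 1000000%:R | < 5%:R / 10000000%:R :> R.
Proof.
exact: mean_value_decimal_of decimal_511655 decimal_million decimal_ten_millions.
Qed.

Let perimeter_decimal_of (a b e : nat) : a = (3214 * 1000 + 826)%N ->
  b = (1000 * 1000 * 1)%N -> e = (1000 * 1000 * 10)%N ->
  `| 2 * pi * mean_value - a%:R / b%:R | < 5%:R / e%:R :> R.
Proof.
move=> /natr_split-> /natr_split3-> /natr_split3->.
have [h1 h2] := @mean_value_approx R.
have p1 := @pi_gt_decimal R; have p2 := @pi_lt_decimal R.
have double_ltM (l p m n : R) : 0 <= l -> l < p -> 0 <= m -> m < n ->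
    2 * l * m < 2 * p * n.
  by move=> l0 lp m0 mn; rewrite ltr_pM ?ltr_pM2l ?mulr_ge0.
have l0 : 0 <= pi_lo :> R by rewrite /pi_lo; clear p1 p2 h1 h2; lra.
have m0 : 0 <= 5116 / 10 ^+ 4 + 554 / 10 ^+ 7 :> R by clear p1 p2 h1 h2; lra.
have k1 := double_ltM _ _ _ _ l0 p1 m0 h1.
have k2 := double_ltM _ _ _ _ (pi_ge0 R) p2 (ltW (le_lt_trans m0 h1)) h2.
move: k1 k2; rewrite /pi_lo /pi_hi ltr_norml; clear p1 p2 h1 h2 l0 m0.
move: (2 * pi * mean_value) => z k1 k2.
by apply/andP; split; lra.
Qed.

Lemma perimeter_decimal :
  `| 2 * pi * mean_value - 3214826%:R / 1000000%:R | < 5%:R / 10000000%:R :> R.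
Proof.
exact: perimeter_decimal_of decimal_3214826 decimal_million decimal_ten_millions.
Qed.

End final_numerics.

Import HBNNSimple.

(** * Passage from perimeter bounds to the expectation *)

Section integral_almost_everywhere.
Context {d : measure_display} {T : measurableType d} {R : realType}.
Variables (mu : measure T R) (D : set T).
Hypotheses (mD : measurable D) (muD : mu D = 0%E).
Implicit Types f g : T -> \bar R.

Let ge0_integral_offnull f : measurable_fun setT f -> (forall x, 0 <= f x)%E ->
  (\int[mu]_x f x = \int[mu]_(x in ~` D) f x)%E.
Proof.
move=> mf f0; rewrite (ge0_negligible_integral mD measurableT mf _ muD)//.
by rewrite setTD.
Qed.

(* The perimeter is not known to be measurable: only one side of each
   comparison is. *)
Lemma ge0_integral_le_measurable f g : (forall x, 0 <= f x)%E -> (forall x, 0 <= g x)%E ->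
  measurable_fun setT g -> (forall x, ~ D x -> (f x <= g x)%E) ->
  (\int[mu]_x f x <= \int[mu]_x g x)%E.
Proof.
move=> f0 g0 mg fg; rewrite ge0_integralTE//; apply/ereal_supP => _ [h hf <-].
have mh : measurable_fun setT (fun x => (h x)%:E) by apply/measurable_EFinP.
have h0 x : (0 <= (h x)%:E)%E by rewrite lee_fin.
rewrite -integralT_nnsfun (ge0_integral_offnull mh h0) (ge0_integral_offnull mg g0).
apply: ge0_le_integral => //.
- exact: measurableC.
- exact: measurable_funTS.
- exact: measurable_funTS.
- by move=> x Dx; apply: le_trans (hf x) (fg x Dx).
Qed.

(** The integral of a nonnegative function, measurable or not, is a supremum over the simple
    functions below it; those below [f] set to zero on [D] are also below [g]. *)
Lemma ge0_measurable_integral_le f g : (forall x, 0 <= f x)%E -> (forall x, 0 <= g x)%E ->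
  measurable_fun setT f -> (forall x, ~ D x -> (f x <= g x)%E) ->
  (\int[mu]_x f x <= \int[mu]_x g x)%E.
Proof.
move=> f0 g0 mf fg; rewrite (ge0_integral_offnull mf f0).
rewrite ge0_integralE// [leRHS]ge0_integralTE//.
apply/ereal_supP => _ [h hf <-]; apply: ereal_sup_ubound; exists h => // x.
apply: le_trans (hf x) _; rewrite patchE; case: ifPn => // /set_mem; exact: fg.
Qed.

End integral_almost_everywhere.

Section small_angle_bounds.
Context {R : realType}.
Implicit Types y : R.

Lemma sin_le_id y : 0 <= y -> sin y <= y.
Proof.
move=> y0; have := @sin_le_poly R 0 y erefl y0.
by rewrite /sin_poly big_ord1 expr0 divr1 mul1r expr1.
Qed.

Lemma sin_order1_bounds y : 0 <= y -> y <= 1 -> y * (1 - y) <= sin y.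
Proof.
move=> y0 y1; have := @sin_ge_poly R 1 y erefl y0; apply: le_trans.
have y2 : y ^+ 2 <= y by rewrite expr2 ler_piMl.
by rewrite sin_poly_horner /= ler_wpM2l//; lra.
Qed.

Lemma cos_ge_quadratic y : 0 <= y -> y <= 1 -> 1 - y ^+ 2 / 2 <= cos y.
Proof.
move=> y0 y1; have y20 : 0 <= y / 2 by rewrite divr_ge0.
have -> : cos y = 1 - 2 * sin (y / 2) ^+ 2.
  rewrite [in LHS](splitr y) cosD -!expr2.
  by have := cos2Dsin2 (y / 2); lra.
have s0 : 0 <= sin (y / 2).
  have y21 : y / 2 <= 1 by lra.
  by apply: le_trans (sin_order1_bounds y20 y21); rewrite mulr_ge0//; lra.
have : sin (y / 2) ^+ 2 <= (y / 2) ^+ 2 by rewrite ler_sqr ?nnegrE// sin_le_id.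
by rewrite expr_div_n; lra.
Qed.

(** This is [tan y <= y (1 + y)], from [sin y <= y] and [(1 + y) (1 - y^2 / 2) >= 1] on the unit
    interval. *)
Lemma sin_cos_order1 y : 0 <= y -> y <= 1 -> 0 < cos y /\ sin y <= y * (1 + y) * cos y.
Proof.
move=> y0 y1; have c := cos_ge_quadratic y0 y1; have s := sin_le_id y0.
have y2 : y ^+ 2 <= y by rewrite expr2 ler_piMl.
split; first by lra.
apply: le_trans s _; rewrite -mulrA -[leLHS]mulr1 ler_wpM2l//.
have y3 : y * y ^+ 2 <= y * 1 by rewrite ler_wpM2l//; lra.
have y11 : 0 <= 1 + y by lra.
have := ler_wpM2l y11 c; lra.
Qed.

End small_angle_bounds.

Section expected_perimeter.
Context {R : realType} {d : measure_display} {T : measurableType d}.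
Variables (P : probability T R) (X Y : R -> T -> R).
Hypothesis BM : planar_BM P X Y.

Lemma integral_maximum_mean_value c s : c ^+ 2 + s ^+ 2 = 1 ->
  (\int[P]_w max_horiz (component X Y c s) (component X Y (- s) c) w =
   (@mean_value R)%:E)%E.
Proof.
move=> cs1; have E := integral_maximum BM cs1.
rewrite E /mean_value -E fineK// ge0_fin_numE; last first.
  by apply: integral_ge0 => w _; exact: (maximum_bounds BM _ _ w).1.
apply: (@le_lt_trans _ _ (\int[P]_w 1)%E); last first.
  by rewrite integral_cst// mul1e [ltLHS]probability_setT ltey.
apply: ge0_le_integral => //.
- by move=> w _; exact: (maximum_bounds BM _ _ w).1.
- exact: (measurable_maximum BM).
- by move=> w _; exact: (maximum_bounds BM _ _ w).2.
Qed.

Let M (a : R) := max_horiz (component X Y (cos a) (sin a)) (component X Y (- sin a) (cos a)).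

Let integral_M a : (\int[P]_w M a w = (@mean_value R)%:E)%E.
Proof. exact: integral_maximum_mean_value (cos2Dsin2 a). Qed.

Let mean_value_ge0 : 0 <= @mean_value R.
Proof.
rewrite -lee_fin -(integral_M 0); apply: integral_ge0 => w _.
exact: (maximum_bounds BM _ _ w).1.
Qed.

Let angle_of (N j : nat) : R := j%:R * (2 * pi / N%:R).
Let total (N : nat) (k : R) (w : T) : \bar R := (k%:E * \sum_(j < N) M (angle_of N j) w)%E.

Let M_ge0 a w : (0 <= M a w)%E. Proof. exact: (maximum_bounds BM _ _ w).1. Qed.
Let mM a : measurable_fun setT (M a). Proof. exact: (measurable_maximum BM). Qed.

Let total_ge0 N k w : 0 <= k -> (0 <= total N k w)%E.
Proof. by move=> k0; rewrite mule_ge0 ?lee_fin// sume_ge0. Qed.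

Let measurable_total N k : measurable_fun setT (total N k).
Proof. by apply: emeasurable_funM => //; exact: emeasurable_sum. Qed.

Let integral_total N k : 0 <= k ->
  (\int[P]_w total N k w = (k * (N%:R * mean_value))%:E)%E.
Proof.
move=> k0; rewrite ge0_integralZl//; last first.
- by move=> w _; exact: sume_ge0.
- exact: emeasurable_sum.
rewrite ge0_integral_sum//.
under eq_bigr do rewrite integral_M.
by rewrite sumEFin sumr_const card_ord -EFinM mulr_natl.
Qed.

Let totalE N k w : total N k w = (k * \sum_(j < N) fine (M (angle_of N j) w))%:E.
Proof.
rewrite /total EFinM -sumEFin; congr (_ * _)%E; apply: eq_bigr => j _.
exact: (fin_maximum BM).
Qed.

Let hull_perimeter_ge0 w : (0 <= hull_perimeter X Y w)%E.
Proof.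
apply: (@le_trans _ _ (hausdorff1_delta (boundary2 (convex_hull2 (stopped_path X Y w))) 1)).
  by apply/ereal_infP => _ [U _ <-]; apply: nneseries_ge0 => n _ _; exact: diam2_ge0.
by apply: ereal_sup_ubound; exists 1; rewrite //= ltr01.
Qed.

Lemma integral_hull_perimeter_bounds N : (4 < N)%N ->
  ((2 * sin (pi / N%:R) * (N%:R * mean_value))%:E <= \int[P]_w hull_perimeter X Y w)%E /\
  (\int[P]_w hull_perimeter X Y w <=
    (2 * sin (pi / N%:R) / cos (pi / N%:R) * (N%:R * mean_value))%:E)%E.
Proof.
move=> N5; have [D [mD PD] HD] := hull_interior_as BM.
have N0 : 0 < N%:R :> R by rewrite ltr0n; exact: ltn_trans N5.
have p0 := pi_gt0 R.
have x0 : 0 < pi / N%:R :> R by rewrite divr_gt0.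
have x1 : pi / N%:R < pi / 2 :> R.
  by rewrite ltr_pM2l// ltf_pV2 ?posrE// ltr_nat; exact: ltn_trans N5.
have s0 : 0 < sin (pi / N%:R) :> R by apply: sin_gt0_pi; apply/andP; split; lra.
have c0 : 0 < cos (pi / N%:R) :> R by apply: cos_gt0_pihalf; apply/andP; split; lra.
have k0 : 0 <= 2 * sin (pi / N%:R) :> R by rewrite mulr_ge0// ltW.
have k1 : 0 <= 2 * sin (pi / N%:R) / cos (pi / N%:R) :> R by rewrite divr_ge0// ltW.
have bounds w : ~ D w -> (total N (2 * sin (pi / N%:R)) w <= hull_perimeter X Y w)%E /\
    (hull_perimeter X Y w <= total N (2 * sin (pi / N%:R) / cos (pi / N%:R)) w)%E.
  move=> Dw; have [] := @perimeter2_bounds R (convex_hull2 (stopped_path X Y w)) 1 N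
    (fun j => fine (M (angle_of N j) w)).
  - exact: convex_hull2_convex.
  - exact: (hull_bounded BM).
  - exact: HD.
  - exact: N5.
  - by move=> j x; exact: (hull_support_le BM).
  - by move=> j e; exact: (hull_support_approx BM).
  by rewrite !totalE; move=> h1 h2; split => //; rewrite mulrAC.
split.
- rewrite -integral_total//; apply: (ge0_measurable_integral_le mD PD) => //.
  + by move=> w; exact: total_ge0.
  + by move=> w /bounds[].
- rewrite -integral_total//; apply: (ge0_integral_le_measurable mD PD) => //.
  + by move=> w; exact: total_ge0.
  + by move=> w /bounds[].
Qed.

Lemma integral_hull_perimeter :
  (\int[P]_w hull_perimeter X Y w = (2 * pi * mean_value)%:E)%E.
Proof.
have p0 := pi_gt0 R.
set E := (\int[P]_w _)%E; pose K : R := 2 * pi * mean_value.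
have K0 : 0 <= K by rewrite !mulr_ge0// ltW.
have sandwich x : 0 < x -> exists2 y, 0 < y <= x &
    ((K * (1 - y))%:E <= E)%E /\ (E <= (K * (1 + y))%:E)%E.
  (* With [y = pi / N], the summand 5 ensures [4 < N] and [y <= 1], and the truncation ensures
     [y <= x]. *)
  move=> x0; pose N := (5 + Num.trunc (pi / x))%N.
  have [lo hi] := @integral_hull_perimeter_bounds N (leq_addr _ _).
  have N0 : 0 < N%:R :> R by rewrite ltr0n.
  have y0 : 0 < pi / N%:R :> R by rewrite divr_gt0.
  have yx : pi / N%:R <= x.
    rewrite ler_pdivrMr// mulrC -ler_pdivrMr//; apply/ltW.
    by apply: lt_le_trans (truncnS_gt _) _; rewrite ler_nat /N -addn1 addnC leq_add2r.
  have y1 : pi / N%:R <= 1 :> R.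
    rewrite ler_pdivrMr// mul1r; apply: (@le_trans _ _ 5%:R); last by rewrite ler_nat leq_addr.
    by have := @pi_lt_decimal R; rewrite /pi_hi; lra.
  exists (pi / N%:R); first by rewrite y0.
  have NE : N%:R = pi / (pi / N%:R) :> R by rewrite invf_div mulrC divfK// lt0r_neq0.
  move: lo hi y0 yx y1; rewrite [X in (X * mean_value)]NE; move: (pi / N%:R) => y lo hi y0 yx y1.
  have m0 := mean_value_ge0.
  have sy := sin_order1_bounds (ltW y0) y1.
  have [cy scy] := sin_cos_order1 (ltW y0) y1.
  split.
  - apply: le_trans lo; rewrite lee_fin /K.
    rewrite (_ : 2 * pi * mean_value * (1 - y) = 2 * (pi / y * mean_value) * (y * (1 - y))); last first.
      by field; exact: lt0r_neq0.
    rewrite (_ : 2 * sin y * (pi / y * mean_value) = 2 * (pi / y * mean_value) * sin y); last by ring.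
    by rewrite ler_wpM2l// !mulr_ge0// ?invr_ge0 ltW.
  - apply: le_trans hi _; rewrite lee_fin /K.
    rewrite (_ : 2 * pi * mean_value * (1 + y) = 2 * (pi / y * mean_value) * (y * (1 + y))); last first.
      by field; exact: lt0r_neq0.
    rewrite (_ : 2 * sin y / cos y * (pi / y * mean_value) =
      2 * (pi / y * mean_value) * (sin y / cos y)); last by ring.
    rewrite ler_wpM2l ?ler_pdivrMr//.
    by rewrite !mulr_ge0// ?invr_ge0 ltW.
apply/eqP; rewrite eq_le; apply/andP; split.
(* Only [0 <= K] is at hand, hence the denominator [K + 1]. *)
- apply/lee_addgt0Pr => e e0; have [|y /andP[y0 ye] [_ hi]] := sandwich (e / (K + 1)).
    by rewrite divr_gt0// ltr_wpDl.
  apply: le_trans hi _; rewrite -EFinD lee_fin mulrDr mulr1 lerD2l.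
  apply: le_trans (ler_wpM2l K0 ye) _.
  by rewrite mulrA ler_pdivrMr ?ltr_wpDl// mulrC ler_pM2l// lerDl.
- apply/lee_addgt0Pr => e e0; have [|y /andP[y0 ye] [lo _]] := sandwich (e / (K + 1)).
    by rewrite divr_gt0// ltr_wpDl.
  rewrite -leeBlDr// -EFinB; apply: le_trans lo; rewrite lee_fin mulrBr mulr1 lerD2l lerN2.
  apply: le_trans (ler_wpM2l K0 ye) _.
  by rewrite mulrA ler_pdivrMr ?ltr_wpDl// mulrC ler_pM2l// lerDl.
Qed.

End expected_perimeter.

Theorem theorem1p1 (R : realType) (d : measure_display) (T : measurableType d)
    (P : probability T R) (X Y : R -> T -> R) :
  planar_BM P X Y ->
  let M := max_horiz X Y in
  let c : \bar R := (\int[lebesgue_measure]_(t in `[0%R, (pi / 2)%R])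
                       ((1 - 2 * t / (pi / 2 + t)) * cos t)%:E)%E in
  [/\ (forall a : R, 0 < a -> a < 1 ->
         P [set w | (M w < a%:E)%E] = ((2 * asin a) / (pi - acos a))%:E),
      (\int[P]_w M w)%E = c,
      `| fine c - 511655%:R / 1000000%:R | < 5%:R / 10000000%:R,
      (\int[P]_w hull_perimeter X Y w)%E = ((2 * pi)%:E * \int[P]_w M w)%E &
      `| 2 * pi * fine c - 3214826%:R / 1000000%:R | < 5%:R / 10000000%:R].
Proof.
move=> BM M c.
have cs1 : (1 : R) ^+ 2 + 0 ^+ 2 = 1 by rewrite expr1n expr0n addr0.
have ME : max_horiz (component X Y 1 0) (component X Y (- 0) 1) = M.
  have -> : component X Y 1 0 = X.
    by apply/funext => t; apply/funext => w; rewrite /component mul1r mul0r addr0.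
  have -> // : component X Y (- 0) 1 = Y.
  by apply/funext => t; apply/funext => w; rewrite /component oppr0 mul1r mul0r add0r.
have cE : (\int[P]_w M w)%E = c by rewrite -ME (integral_maximum BM cs1).
split.
- by move=> a a0 a1; have := max_horiz_cdf BM cs1 a0 a1; rewrite ME.
- exact: cE.
- exact: mean_value_decimal.
- rewrite (integral_hull_perimeter BM) -ME.
  by rewrite (integral_maximum_mean_value BM cs1) EFinM.
- exact: perimeter_decimal.
Qed.
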